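(* Let $\mathrm{H}\in C(\mathbb{R})$ with $\mathrm{H}\ge\mathrm{H}(0)=0$, and suppose that $\mathrm{H}$ is strictly level-convex, that is, $\mathrm{H}$ is strictly decreasing on $(-\infty,0)$ and strictly increasing on $(0,\infty)$. Suppose there exist $C_1,C_2>0$ and $r>1$ such that $\mathrm{H}(X)\ge C_1|X|^r-C_2$ for all $X\in\mathbb{R}$. For $t>0$ let $T^-<0<T^+$ denote the two elements of the level set $\{X\in\mathbb{R}:\mathrm{H}(X)=t\}$, and suppose that $$0<\liminf_{t\to\infty}\Big|\frac{T^-}{T^+}\Big|\le\limsup_{t\to\infty}\Big|\frac{T^-}{T^+}\Big|<\infty.$$ Let $a<b$ in $\mathbb{R}$, and consider $\mathrm{E}_\infty(u,\mathcal{O})=\|\mathrm{H}(u'')\|_{L^\infty(\mathcal{O})}$ for $u\in W^{2,\infty}(a,b)$ and measurable $\mathcal{O}\subseteq(a,b)$. If $\mathrm{H}\in C^1(\mathbb{R})$, consider also the equation $\mathrm{A}^2_\infty u=(\mathrm{H}_X(u''))^3(u''')^2=0$ on $(a,b)$. Let $g\in W^{2,\infty}(a,b)$ and, for any $v\in W^{2,\infty}(a,b)$, set $$\mathcal{E}(v):=\frac{v'(b)-v'(a)}{b-a}-\frac{2\big(v(b)-v(a)-v'(a)(b-a)\big)}{(b-a)^2}.$$ Then: (1) There exists a unique $u_*\in\mathrm{AM}^2(\mathrm{E}_\infty,(a,b))\cap W^{2,\infty}_g(a,b)$. If $\mathcal{E}(g)=0$, then $u_*$ is a quadratic polynomial function.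 If $\mathcal{E}(g)\ne0$, then $u_*$ is piecewise quadratic with exactly one point $\xi_*\in(a,b)$ at which $u_*''$ does not exist, and $u_*''$ changes sign at $\xi_*$. Further, $\mathrm{H}(u_*'')$ extends to a constant function on $(a,b)$. Moreover, $u_*$ is the limit of approximate $L^p$ minimisers: $u_*$ is an $L^p$-limit function with data $g$ (see context), and it is the only one. (2) Every $u\in\mathrm{AM}^2(\mathrm{E}_\infty,(a,b))$ has the structure described in (1): $u$ is quadratic if $\mathcal{E}(u)=0$; $u$ is piecewise quadratic with exactly one point in $(a,b)$ at which $u''$ does not exist and changes sign if $\mathcal{E}(u)\neq0$; $\mathrm{H}(u'')$ extends to a constant function on $(a,b)$; and $u$ is the $L^p$-limit function with data $u$. (3) If in addition $\mathrm{H}\in C^1(\mathbb{R})$, the Dirichlet problem $$\mathrm{A}^2_\infty u=0\ \text{ in }(a,b),\qquad u=g,\ u'=g'\ \text{ at }\{a,b\},$$ has a unique Absolutely Minimising $\mathcal{D}$-solution $u_\infty\in W^{2,\infty}_g(a,b)$ (that is, a $\mathcal{D}$-solution belonging to $\mathrm{AM}^2(\mathrm{E}_\infty,(a,b))$), and it is piecewise quadratic with at most one point in $(a,b)$ at which $u_\infty''$ may not exist. In particular every Absolutely Minimising $\mathcal{D}$-solution to this problem has this form. (4) If $\mathrm{H}\in C^1(\mathbb{R})$, every $u\in\mathrm{AM}^2(\mathrm{E}_\infty,(a,b))$ is a $\mathcal{D}$-solution to $\mathrm{A}^2_\infty u=0$ on $(a,b)$.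
   Context: Functions in $W^{2,\infty}(a,b)$ are identified with their $C^1([a,b])$ representatives. $W^{2,\infty}_0(\mathcal{O})$ is the set of $W^{2,\infty}(\mathcal{O})$ functions vanishing together with their derivative on $\partial\mathcal{O}$, and $W^{2,\infty}_g(a,b):=g+W^{2,\infty}_0(a,b)$. Second order Absolute Minimisers: $u\in\mathrm{AM}^2(\mathrm{E}_\infty,(a,b))$ means $u\in W^{2,\infty}(a,b)$ and $\mathrm{E}_\infty(u,\Omega')\le\mathrm{E}_\infty(u+\phi,\Omega')$ for all open $\Omega'\Subset(a,b)$ and all $\phi\in W^{2,\infty}_0(\Omega')$. $L^p$-limit function: for $p\in\mathbb{N}$ and measurable $B\subseteq (a,b)$ put $\mathrm{E}_p(u,B):=\big(\frac1{|B|}\int_B\mathrm{H}(u'')^p\,dx\big)^{1/p}$ (both $\mathrm{E}_p(u,B)$ and $\mathrm{E}_\infty(u,B)$ are taken to be $0$ if $B$ is null). A function $u_\infty\in W^{2,\infty}_g(a,b)$ is called an $L^p$-limit function with data $g$ if: (a) $\mathrm{E}_\infty(u_\infty,(a,b))\le\mathrm{E}_\infty(\psi,(a,b))$ for all $\psi\in W^{2,\infty}_g(a,b)$; and there are $(u_p)_{p=1}^\infty\subseteq W^{2,\infty}_g(a,b)$ and a subsequence $p_j\to\infty$ such that (b) $\mathrm{E}_p(u_p,(a,b))^p\le2^{-p^2}+\inf\{\mathrm{E}_p(v,(a,b))^p:v\in W^{2,\infty}_g(a,b)\}$ for all $p$, and $u_{p_j}\rightharpoonup u_\infty$ weakly in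 $W^{2,q}(a,b)$ for every $q\ge1$; and (c) $\mathrm{E}_\infty(u_\infty,B)\le\liminf_{j}\mathrm{E}_{p_j}(u_{p_j},B)$ for every measurable $B\subseteq(a,b)$. $\mathcal{D}$-solutions: let $\Omega=(a,b)$ and let $\overline{\mathbb{R}}=\mathbb{R}\cup\{\infty\}$ be the one-point compactification of $\mathbb{R}$. A Young measure $\vartheta\in\mathscr{Y}(\Omega,\overline{\mathbb{R}})$ is a map $\vartheta:\Omega\to\mathscr{P}(\overline{\mathbb{R}})$ (Borel probability measures) such that $x\mapsto[\vartheta(x)](U)$ is measurable for every open $U\subseteq\overline{\mathbb{R}}$; $\vartheta^m\overset{*}{\rightharpoonup}\vartheta$ means $\int_\Omega\int\Psi(x,X)\,d[\vartheta^m(x)](X)\,dx\to\int_\Omega\int\Psi(x,X)\,d[\vartheta(x)](X)\,dx$ for all $\Psi\in L^1(\Omega,C(\overline{\mathbb{R}}))$. For $u\in W^{2,1}_{\mathrm{loc}}(\Omega)$ and $h\ne0$ let $\mathrm{D}^{1,h}u''(x)=\frac1h[u''(x+h)-u''(x)]$ ($u''$ extended by $0$ outside $\Omega$). A diffuse third derivative $\mathcal{D}^3u$ is any weak* limit in $\mathscr{Y}(\Omega,\overline{\mathbb{R}})$ of the Dirac-valued maps $\delta_{\mathrm{D}^{1,h_m}u''}$ along some sequence $h_m\to0$, $h_m\neq 0$. The function $u$ is a $\mathcal{D}$-solution of $\mathrm{A}^2_\infty u=0$ if for every diffuse third derivative $\mathcal{D}^3u$ and every $\Phi\in C_c(\mathbb{R})$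 (extended by $0$ at $\infty$), $$\int_{\overline{\mathbb{R}}}\Phi(X)\,\big(\mathrm{H}_X(u''(x))\big)^3X^2\,d[\mathcal{D}^3u(x)](X)=0\quad\text{for a.e. }x\in\Omega.$$ *)

(* Defs.v *)
(* MathComp-Analysis, over an arbitrary R : realType. *)
From HB Require Import structures.
From mathcomp Require Import all_boot all_order all_algebra.
From mathcomp Require Import all_classical all_reals all_analysis.
From mathcomp Require Import measurable_realfun.
Set Implicit Arguments.
Unset Strict Implicit.
Unset Printing Implicit Defensive.
Import Order.TTheory GRing.Theory Num.Theory.
Import numFieldNormedType.Exports.
Local Open Scope ring_scope.
Local Open Scope classical_set_scope.

(* Functions on an open set O are total functions R -> R whose values outside
   O are irrelevant; a Sobolev function of second order is given by its C^1
   representative.  Its second derivative is the pointwise derivative u^`(2) of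
   u^`(), which exists a.e.; at the remaining points u^`(2) is a junk value.
   Measurability on R is Borel measurability; all notions below are insensitive
   to null sets, so nothing changes with Lebesgue-measurable sets. *)

Definition C1_on (R : realType) (O : set R) (u : R -> R) : Prop :=
  forall x, O x -> derivable u x 1 /\ {for x, continuous u^`()}.

Definition compactly_contained (R : realType) (O' O : set R) : Prop :=
  compact (closure O') /\ closure O' `<=` O.

(* For first-order weak derivatives C^1_c and C^oo_c test functions define the
   same notion. *)
Definition test_function (R : realType) (O : set R) (phi : R -> R) : Prop :=
  C1_on setT phi /\
  exists2 K, compact K /\ K `<=` O & forall x, ~ K x -> phi x = 0.

Definition weak_derivative (R : realType) (O : set R) (f f' : R -> R) : Prop :=
  [/\ locally_integrable O f, locally_integrable O f' &
    forall phi, test_function O phi ->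
      \int[lebesgue_measure]_(x in O) (f x * phi^`()%classic x) =
      - \int[lebesgue_measure]_(x in O) (f' x * phi x)].

Definition Lnorm_on (R : realType) (q : \bar R) (O : set R) (f : R -> R) :
    \bar R :=
  'N[lebesgue_measure]_q[(EFin \o f) \_ O]%E.

Definition Lebesgue_space (R : realType) (q : \bar R) (O : set R) :
    set (R -> R) :=
  [set f | measurable_fun O f /\ (Lnorm_on q O f < +oo)%E].

(* The Sobolev space of functions with u, u', u'' in X; for u of class C^1 only
   the weak differentiability of u' is at issue.  By the Lebesgue
   differentiation theorem a weak derivative of u' agrees a.e. with u^`(2). *)
Definition Sobolev2 (R : realType) (X : set (R -> R)) (O : set R) :
    set (R -> R) :=
  [set u | [/\ C1_on O u, X u, X u^`(), X u^`(2) &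
    weak_derivative O u^`() u^`(2)]].

Definition W2 (R : realType) (q : \bar R) (O : set R) : set (R -> R) :=
  Sobolev2 (Lebesgue_space q O) O.

Definition W2_norm (R : realType) (q : \bar R) (O : set R) (u : R -> R) :
    \bar R :=
  (Lnorm_on q O u + Lnorm_on q O u^`() + Lnorm_on q O u^`(2))%E.

Definition W2oo0 (R : realType) (O : set R) : set (R -> R) :=
  [set phi | W2 +oo%E O phi /\
    forall x, (closure O `\` O°) x ->
      phi y @[y --> within O (nbhs x)] --> 0 /\
      phi^`() y @[y --> within O (nbhs x)] --> 0].

Definition W2oog (R : realType) (a b : R) (g : R -> R) : set (R -> R) :=
  [set u | W2oo0 `]a, b[ (u \- g)].

Definition strictly_level_convex (R : realType) (H : R -> R) : Prop :=
  (forall x y, x < y -> y < 0 -> H y < H x) /\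
  (forall x y, 0 < x -> x < y -> H x < H y).

(* Since the integrand vanishes outside O, the norm over the whole line is the
   norm of L^oo(O), and it is 0 when O is null. *)
Definition Eoo (R : realType) (H u : R -> R) (O : set R) : \bar R :=
  Lnorm_on +oo%E O (H \o u^`(2)).

Definition Ep (R : realType) (H : R -> R) (p : nat) (u : R -> R) (B : set R) :
    \bar R :=
  (if lebesgue_measure B == 0 then 0
   else ((fine (lebesgue_measure B))^-1%:E *
         \int[lebesgue_measure]_(x in B) (H (u^`(2)%classic x) ^+ p)%:E)
        `^ (p%:R^-1))%E.

Definition AM2 (R : realType) (H : R -> R) (a b : R) (u : R -> R) : Prop :=
  W2 +oo%E `]a, b[ u /\
  forall O, open O -> compactly_contained O `]a, b[ ->
  forall phi, W2oo0 O phi -> (Eoo H u O <= Eoo H (u \+ phi)%R O)%E.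

Definition W2_functional (R : realType) (q : \bar R) (O : set R)
    (l : (R -> R) -> R) : Prop :=
  (forall (c : R) f g, W2 q O f -> W2 q O g ->
     l (fun x => c * f x + g x) = c * l f + l g) /\
  (exists C : R, forall f, W2 q O f -> (`|l f|%:E <= C%:E * W2_norm q O f)%E).

Definition W2_weak_cvg (R : realType) (q : \bar R) (O : set R)
    (u_ : nat -> R -> R) (u : R -> R) : Prop :=
  forall l, W2_functional q O l -> l (u_ j) @[j --> \oo] --> l u.

(* u_ 0 is unused: the family is indexed by p >= 1. *)
Definition Lp_limit (R : realType) (H : R -> R) (a b : R) (g u : R -> R) :
    Prop :=
  [/\ W2oog a b g u,
    forall psi, W2oog a b g psi -> (Eoo H u `]a, b[ <= Eoo H psi `]a, b[)%E &
    exists (u_ : nat -> R -> R) (s : nat -> nat),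
      [/\ forall p, (0 < p)%N -> W2oog a b g (u_ p),
        (forall j, (0 < s j)%N) /\ {homo s : i j / (i < j)%N},
        forall p, (0 < p)%N ->
          (Ep H p (u_ p) `]a, b[ ^+ p <= (2 ^- (p ^ 2))%:E +
            ereal_inf [set Ep H p v `]a, b[ ^+ p | v in W2oog a b g])%E,
        forall q : R, 1 <= q -> W2_weak_cvg q%:E `]a, b[ (u_ \o s) u &
        forall B, measurable B -> B `<=` `]a, b[ ->
          (Eoo H u B <= limn_einf (fun j => Ep H (s j) (u_ (s j)) B))%E]].

(* The values of v and v' at the endpoints are those of the C^1([a,b])
   representative. *)
Definition calE (R : realType) (a b : R) (v : R -> R) : R :=
  let va := lim (v x @[x --> a^'+]) in
  let vb := lim (v x @[x --> b^'-]) in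
  let v'a := lim (v^`() x @[x --> a^'+]) in
  let v'b := lim (v^`() x @[x --> b^'-]) in
  (v'b - v'a) / (b - a) - 2 * (vb - va - v'a * (b - a)) / (b - a) ^+ 2.

Definition eq_on (R : realType) (O : set R) (u v : R -> R) : Prop :=
  forall x, O x -> u x = v x.

Definition quadratic_on (R : realType) (O : set R) (u : R -> R) : Prop :=
  exists c0 c1 c2 : R, forall x, O x -> u x = c0 + c1 * x + c2 * x ^+ 2.

Definition piecewise_quadratic (R : realType) (a b : R) (u : R -> R) : Prop :=
  exists s : seq R, forall c d, a <= c -> c < d -> d <= b ->
    (forall x, x \in s -> ~ `]c, d[%classic x) -> quadratic_on `]c, d[ u.

Definition no_second_derivative (R : realType) (u : R -> R) (x : R) : Prop :=
  ~ derivable u^`() x 1.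

Definition changes_sign_at (R : realType) (f : R -> R) (x : R) : Prop :=
  ((\forall y \near x^'-, f y < 0) /\ (\forall y \near x^'+, 0 < f y)) \/
  ((\forall y \near x^'-, 0 < f y) /\ (\forall y \near x^'+, f y < 0)).

Definition one_switch (R : realType) (a b : R) (u : R -> R) : Prop :=
  piecewise_quadratic a b u /\
  exists xi : R, [/\ a < xi < b,
    forall x, a < x < b -> (no_second_derivative u x <-> x = xi) &
    changes_sign_at u^`(2) xi].

Definition at_most_one_singularity (R : realType) (a b : R) (u : R -> R) :
    Prop :=
  piecewise_quadratic a b u /\
  forall x y, a < x < b -> a < y < b ->
    no_second_derivative u x -> no_second_derivative u y -> x = y.

Definition constant_energy_density (R : realType) (H : R -> R) (a b : R)
    (u : R -> R) : Prop :=
  exists c : R, forall x, a < x < b -> derivable u^`() x 1 ->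
    H (u^`(2) x) = c.

Definition AM2_structure (R : realType) (H : R -> R) (a b : R)
    (g u : R -> R) : Prop :=
  [/\ calE a b g = 0 -> quadratic_on `]a, b[ u,
    calE a b g != 0 -> one_switch a b u,
    constant_energy_density H a b u,
    Lp_limit H a b g u &
    forall v, Lp_limit H a b g v -> eq_on `]a, b[ v u].

Notation borel_Rbar R :=
  (g_sigma_algebraType (@open (one_point_compactification R))).

Definition Young_measure (R : realType) (O : set R)
    (nu : R -> probability (borel_Rbar R) R) : Prop :=
  forall U : set (one_point_compactification R), open U ->
    measurable_fun O (fun x => nu x U).

(* L^1(O, C(Rbar)), described as usual through Caratheodory functions. *)
Definition L1_C_Rbar (R : realType) (O : set R)
    (Psi : R -> one_point_compactification R -> R) : Prop :=
  [/\ forall x, O x -> continuous (Psi x),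
    forall X, measurable_fun O (fun x => Psi x X) &
    (\int[lebesgue_measure]_(x in O)
       ereal_sup [set `|Psi x X|%:E | X in setT] < +oo)%E].

Definition Young_cvg (R : realType) (O : set R)
    (nu_ : nat -> R -> probability (borel_Rbar R) R)
    (nu : R -> probability (borel_Rbar R) R) : Prop :=
  forall Psi, L1_C_Rbar O Psi ->
    (\int[lebesgue_measure]_(x in O) \int[nu_ m x]_X (Psi x X)%:E)%E
      @[m --> \oo] -->
    (\int[lebesgue_measure]_(x in O) \int[nu x]_X (Psi x X)%:E)%E.

Definition diff_quotient (R : realType) (h : R) (w : R -> R) (x : R) : R :=
  h^-1 * (w (x + h) - w x).

Definition diffuse_D3 (R : realType) (a b : R) (u : R -> R)
    (nu : R -> probability (borel_Rbar R) R) : Prop :=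
  Young_measure `]a, b[ nu /\
  exists h : nat -> R,
    [/\ forall m, h m != 0, h m @[m --> \oo] --> 0 &
      Young_cvg `]a, b[
        (fun m x => \d_(Some (diff_quotient (h m)
           (patch (fun=> 0) `]a, b[ u^`(2)) x) : borel_Rbar R)) nu].

(* The integrand vanishes at oo, as Phi is extended by 0. *)
Definition D_solution (R : realType) (H : R -> R) (a b : R) (u : R -> R) :
    Prop :=
  Sobolev2 (locally_integrable `]a, b[) `]a, b[ u /\
  forall nu, diffuse_D3 a b u nu ->
  forall Phi : R -> R, continuous Phi ->
    (exists2 K, compact K & forall X, ~ K X -> Phi X = 0) ->
    {ae lebesgue_measure, forall x, a < x < b ->
      (\int[nu x]_X
        (if X is Some Y then Phi Y * H^`()%classic (u^`(2)%classic x) ^+ 3 * Y ^+ 2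
         else 0)%:E = 0)%E}.

(* Main.v *)
(* Given boundary data, there is exactly one "bang-bang" function u whose second
   derivative equals p to the left of some xi and q to its right, with
   H p = H q = t and either p = q or p q < 0.  Writing [m, M] = {H <= t}, there
   is a nonzero affine l (constant if p = q, vanishing at xi otherwise) such
   that u'' is M where l > 0 and m where l < 0.  If H(w'') <= t for a w with the
   same boundary values, then l (w'' - u'') <= 0 a.e.; since w'' - u'' is
   orthogonal to affine functions, w = u.  So u is the strict minimiser of the
   supremal energy; the argument survives restriction to any subinterval, which
   makes u an absolute minimiser.  Conversely an absolute minimiser is bang-bang
   on every [c, d] inside (a, b), and these descriptions glue together.
   For near-minimisers u_n of the L^n energies, H(u_n'') exceeds any level s > t
   only on a set where (H(u_n'') / s)^n has small integral.  Together with
   the orthogonality of l to f_n = u_n'' - u'' this gives |l f_n| -> 0 in L^1,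
   hence f_n -> 0 in every L^k: the convergence is strong in W^{2,k}, and the
   lower bound on the energies follows by convergence in measure.
   Finally the difference quotients of a step function vanish away from three
   points, so every diffuse third derivative is the Dirac mass at 0. *)
Require Import Defs.
From HB Require Import structures.
From mathcomp Require Import all_boot all_order all_algebra.
From mathcomp Require Import all_classical all_reals all_analysis.
From mathcomp Require Import measurable_realfun.
From mathcomp Require Import ess_sup_inf.
From mathcomp Require Import ring lra.
Set Implicit Arguments.
Unset Strict Implicit.
Unset Printing Implicit Defensive.
Import Order.TTheory GRing.Theory Num.Theory.
Import numFieldNormedType.Exports.
Local Open Scope ring_scope.
Local Open Scope classical_set_scope.

(** * Bounded measurable functions *)

Section bounded_functions.
Variable R : realType.
Local Notation mu := (@lebesgue_measure R).
Implicit Types (f g : R -> R) (D : set R).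

(** Fixing the boundary values of [u] and [u'] prescribes the integrals of [u''] and of [x * u''].
    For a profile with values [p], then [q], the mean fixes the fraction [th] on which it equals
    [q], and the second moment leaves one scalar equation for the level [t], solved by the
    intermediate value theorem; its right-hand side is the absolute value of [calE], whose sign
    decides which of the two levels comes first. The affine [l] is the multiplier of these two
    linear constraints. Its inequality is kept quantitative, with the violation of [m <= w'' <= M]
    on the right: this is zero for competitors of the supremal energy, and for the power energies it
    is absorbed by [(H (w'') / s) ^+ n], so that one inequality serves both problems. The technical
    obstacle is that [D2 u] is a pointwise derivative with default values: it is additive only
    almost everywhere, which needs a.e. differentiability of [D1 u], and its measurability has to be
    extracted from the continuity of [D1 u]. *)

Definition ae_on D (P : R -> Prop) := {ae mu, forall x, D x -> P x}.

(** On sets of finite measure this class consists of integrable functions and, unlike integrability,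
    is closed under products and under composition with continuous functions; the integrability
    conditions below reduce to these closure rules. *)
Definition aeb D f :=
  measurable_fun D f /\ exists K : R, ae_on D (fun x => `|f x| <= K).

Lemma ae_onW D (P : R -> Prop) : (forall x, D x -> P x) -> ae_on D P.
Proof. by move=> h; apply: aeW => x /h. Qed.

Lemma ae_on_imp D (P Q : R -> Prop) :
  (forall x, D x -> P x -> Q x) -> ae_on D P -> ae_on D Q.
Proof.
move=> PQ; rewrite /ae_on; apply: (@filterS _ _ (ae_filter_ringOfSetsType mu)) => x h Dx; exact/PQ/h.
Qed.

Lemma ae_on_imp2 D (P Q S : R -> Prop) :
  (forall x, D x -> P x -> Q x -> S x) -> ae_on D P -> ae_on D Q -> ae_on D S.
Proof.
move=> PQ; rewrite /ae_on; apply: (@filterS2 _ _ (ae_filter_ringOfSetsType mu)) => x h1 h2 Dx; exact: (PQ x Dx (h1 Dx) (h2 Dx)).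
Qed.

Lemma ae_on_sub D D' (P : R -> Prop) : D' `<=` D -> ae_on D P -> ae_on D' P.
Proof. by move=> s; rewrite /ae_on; apply: (@filterS _ _ (ae_filter_ringOfSetsType mu)) => x h /s. Qed.

Lemma ae_on_neq D c : ae_on D (fun x => x != c).
Proof.
exists [set c]; split; [exact: measurable_set1|exact: lebesgue_measure_set1|].
move=> x /= h; apply: contrapT => xc; apply: h => _; exact/eqP.
Qed.

Lemma ae_on_ex D (P : R -> Prop) :
  measurable D -> (0 < mu D)%E -> ae_on D P -> exists x, D x /\ P x.
Proof.
move=> mD D0 [N [mN N0 sN]]; apply: contrapT => h.
have DN : D `<=` N.
  by move=> x Dx; apply: sN => /= k; apply: h; exists x; split => //; exact: k.
have : (mu D <= mu N)%E by apply: le_measure => //; rewrite inE.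
by rewrite [mu N]N0 leNgt D0.
Qed.

Lemma aeb_sub D D' f : measurable D -> D' `<=` D -> aeb D f -> aeb D' f.
Proof.
move=> mD s [mf [K hK]]; split; first exact: measurable_funS mf.
by exists K; exact: ae_on_sub hK.
Qed.

Lemma aeb_cst D k : aeb D (fun=> k).
Proof. by split; [exact: measurable_cst|exists `|k|; exact: ae_onW]. Qed.

Lemma aebD D f g : aeb D f -> aeb D g -> aeb D (fun x => f x + g x).
Proof.
move=> [mf [K hK]] [mg [L hL]]; split; first exact: measurable_funD.
exists (K + L); apply: ae_on_imp2 hK hL => x _ h1 h2.
by rewrite (le_trans (ler_normD _ _))// lerD.
Qed.

Lemma aebM D f g : aeb D f -> aeb D g -> aeb D (fun x => f x * g x).
Proof.
move=> [mf [K hK]] [mg [L hL]]; split; first exact: measurable_funM.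
exists (K * L); apply: ae_on_imp2 hK hL => x _ h1 h2.
by rewrite normrM ler_pM.
Qed.

Lemma aebZ D k f : aeb D f -> aeb D (fun x => k * f x).
Proof. by move=> h; apply: aebM => //; exact: aeb_cst. Qed.

Lemma aebN D f : aeb D f -> aeb D (fun x => - f x).
Proof.
by move=> /(aebZ (-1)); congr aeb; apply/funext => x; rewrite mulN1r.
Qed.

Lemma aebB D f g : aeb D f -> aeb D g -> aeb D (fun x => f x - g x).
Proof. by move=> hf hg; apply: aebD => //; exact: aebN. Qed.

Lemma aeb_norm D f : aeb D f -> aeb D (fun x => `|f x|).
Proof.
move=> [mf [K hK]]; split; first exact: measurableT_comp.
by exists K; apply: ae_on_imp hK => x _; rewrite normr_id.
Qed.

Lemma aebX D f n : aeb D f -> aeb D (fun x => f x ^+ n).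
Proof.
move=> hf; elim: n => [|n ih]; first exact: aeb_cst.
have := aebM hf ih; congr aeb; apply/funext => x; by rewrite exprS.
Qed.

Lemma aeb_comp D f (F : R -> R) : continuous F -> 
  aeb D f -> aeb D (fun x => F (f x)).
Proof.
move=> cF [mf [K hK]]; split.
  by apply: measurableT_comp => //; exact: continuous_measurable_fun.
have [|M [_ hM]] := @compact_bounded _ _ (F @` `[-K, K]).
  apply: continuous_compact; last exact: segment_compact.
  exact: continuous_subspaceT.
exists (M + 1); apply: ae_on_imp hK => x _; rewrite ler_norml => /andP[h1 h2].
by apply: (hM (M + 1)); [rewrite ltrDl|exists (f x) => //=; rewrite in_itv/= h1 h2].
Qed.

Lemma aeb_indic D A : measurable A -> aeb D \1_A.
Proof.
move=> mA; split; first exact: measurable_indic.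
exists 1; apply: ae_onW => x _; rewrite indicE; case: (_ \in _) => /=.
  by rewrite normr1.
by rewrite normr0.
Qed.

Lemma aeb_integrable D f : measurable D -> (mu D < +oo)%E -> aeb D f ->
  mu.-integrable D (EFin \o f).
Proof.
move=> mD fD [mf [K hK]]; apply/integrableP; split; first exact/measurable_EFinP.
apply: (@le_lt_trans _ _ (`|K|%:E * mu D)%E).
  apply: integral_le_bound => //; first exact/measurable_EFinP.
  apply: ae_on_imp hK => x _ h; by rewrite lee_fin (le_trans h)// ler_norm.
by rewrite lte_mul_pinfty.
Qed.

End bounded_functions.

(** * Integrals of a.e. bounded functions *)

Section Rintegral_bounded.
Variable R : realType.
Local Notation mu := (@lebesgue_measure R).
Variable D : set R.
Hypotheses (mD : measurable D) (fD : (mu D < +oo)%E).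
Implicit Types (f g : R -> R).
Local Notation I f := (\int[mu]_(x in D) f x).

Lemma I_D f g : aeb D f -> aeb D g ->
  \int[mu]_(x in D) (f x + g x) = I f + I g.
Proof. by move=> hf hg; rewrite RintegralD//; exact: aeb_integrable. Qed.

Lemma I_B f g : aeb D f -> aeb D g ->
  \int[mu]_(x in D) (f x - g x) = I f - I g.
Proof. by move=> hf hg; rewrite RintegralB//; exact: aeb_integrable. Qed.

Lemma I_Z k f : aeb D f -> \int[mu]_(x in D) (k * f x) = k * I f.
Proof. by move=> hf; rewrite RintegralZl//; exact: aeb_integrable. Qed.

Lemma I_N f : aeb D f -> \int[mu]_(x in D) (- f x) = - I f.
Proof.
move=> hf; rewrite -mulN1r -I_Z//; apply: eq_Rintegral => x _.
by rewrite mulN1r.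
Qed.

Lemma I_eq f g : measurable_fun D f -> measurable_fun D g ->
  ae_on D (fun x => f x = g x) -> I f = I g.
Proof.
move=> mf mg fg; congr fine; apply: ae_eq_integral => //; try exact/measurable_EFinP.
by apply: ae_on_imp fg => x _ ->.
Qed.

Lemma I_ge0 f : aeb D f -> ae_on D (fun x => 0 <= f x) -> 0 <= I f.
Proof.
move=> hf f0.
rewrite (@I_eq f (fun x => `|f x|)).
- by apply: Rintegral_ge0 => x _.
- by case: hf.
- by case: (aeb_norm hf).
- by apply: ae_on_imp f0 => x _ h; rewrite ger0_norm.
Qed.

Lemma I_le f g : aeb D f -> aeb D g -> ae_on D (fun x => f x <= g x) ->
  I f <= I g.
Proof.
move=> hf hg fg; rewrite -subr_ge0 -I_B//; apply: I_ge0; first exact: aebB.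
by apply: ae_on_imp fg => x _; rewrite subr_ge0.
Qed.

Lemma I_norm f : aeb D f -> `|I f| <= \int[mu]_(x in D) `|f x|.
Proof. by move=> hf; apply: le_normr_Rintegral => //; exact: aeb_integrable. Qed.

Lemma I_EFin f : aeb D f -> (\int[mu]_(x in D) (f x)%:E)%E = (I f)%:E.
Proof.
move=> hf; rewrite fineK//; apply: integrable_fin_num => //; exact: aeb_integrable.
Qed.

Lemma I_indic A : measurable A -> A `<=` D -> I (\1_A) = fine (mu A).
Proof.
by move=> mA AD; rewrite /Rintegral integral_indic// setIidl.
Qed.

Lemma I_norm_le f K : aeb D f -> ae_on D (fun x => `|f x| <= K) ->
  `|I f| <= K * fine (mu D).
Proof.
move=> hf hK; apply: (le_trans (I_norm hf)).
rewrite -Rintegral_cst//; apply: I_le => //; [exact: aeb_norm|exact: aeb_cst].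
Qed.

Lemma I_eq0 f : aeb D f -> (forall x, D x -> 0 <= f x) -> I f <= 0 ->
  ae_on D (fun x => f x = 0).
Proof.
move=> hf f0 If.
have If0 : I f = 0 by apply/eqP; rewrite eq_le If Rintegral_ge0.
have : (\int[mu]_(x in D) `|(f x)%:E| = 0)%E.
  under eq_integral => x xD do
    rewrite /= (ger0_norm (f0 _ (set_mem xD))).
  by rewrite I_EFin// If0.
move/(ae_eq_integral_abs mu mD) => h.
have mf : measurable_fun D (EFin \o f) by apply/measurable_EFinP; case: hf.
by apply: ae_on_imp (h mf) => x _ [].
Qed.

Lemma measurable_ge f (s : R) : aeb D f -> measurable (D `&` [set x | s <= f x]).
Proof.
move=> [mf _]; rewrite (_ : [set x | _] = f @^-1` `[s, +oo[); first exact: mf.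
by apply/seteqP; split => x /=; rewrite in_itv/= andbT.
Qed.

Lemma I_subset f A : measurable A -> A `<=` D -> aeb D f ->
  (forall x, D x -> 0 <= f x) -> \int[mu]_(x in A) f x <= I f.
Proof.
move=> mA AD hf f0; apply: fine_le.
- apply: integrable_fin_num => //.
  apply: (@integrableS _ _ _ mu D A (EFin \o f)) => //.
  exact: aeb_integrable.
- by apply: integrable_fin_num => //; exact: aeb_integrable.
- apply: ge0_subset_integral => //.
  by apply/measurable_EFinP; case: hf.
Qed.

Lemma fin_sub A : measurable A -> A `<=` D -> (mu A < +oo)%E.
Proof.
by move=> mA AD; apply: le_lt_trans fD; apply: le_measure => //; rewrite inE.
Qed.

Lemma I_chebyshev f (s : R) : aeb D f -> (forall x, D x -> 0 <= f x) -> 0 < s ->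
  s * fine (mu (D `&` [set x | s <= f x])) <= I f.
Proof.
move=> hf f0 s0; set A := _ `&` _.
have mA : measurable A by exact: measurable_ge.
rewrite -I_indic//; last by move=> x [].
rewrite -I_Z//; last exact: aeb_indic.
apply: I_le => //; first exact/aebZ/aeb_indic.
apply: ae_onW => x Dx; rewrite indicE; case: (boolP (x \in A)) => [|_].
  by rewrite inE => -[_ /=]; rewrite mulr1.
by rewrite mulr0 f0.
Qed.

Lemma I_restrict A f : A `<=` D ->
  \int[mu]_(x in A) f x = \int[mu]_(x in D) (f x * \1_A x).
Proof.
move=> AD; rewrite -[A in LHS](setIidr AD) Rintegral_mkcondr.
apply: eq_Rintegral => x _; rewrite patchE indicE.
by case: ifPn => _; rewrite ?mulr1 ?mulr0.
Qed.

End Rintegral_bounded.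

(* A continuous function is differentiable at x iff for every n there is a scale
   m at which its difference quotients oscillate by at most 1/(n+1); the points
   where they oscillate more form an open set. *)
Section measurable_derivative.
Variable R : realType.
Variables (O : set R) (f : R -> R).
Hypotheses (oO : open O) (cf : forall x, O x -> {for x, continuous f}).

Let q (h x : R) : R := h^-1 * (f (h + x) - f x).

Let osc (m n : nat) : set R :=
  [set x | O x /\ exists h k : R, [/\ 0 < `|h| < m.+1%:R^-1,
    0 < `|k| < m.+1%:R^-1, O (h + x), O (k + x) & n.+1%:R^-1 < `|q h x - q k x|]].

Let open_osc m n : open (osc m n).
Proof.
rewrite openE => x [Ox [h [k [hm km Oh Ok xhk]]]].
have cvq (l : R) : O (l + x) -> q l y @[y --> x] --> q l x.
  move=> Ol; apply: cvgM; first exact: cvg_cst.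
  apply: cvgB; last exact: cf.
  apply: (@cvg_comp _ _ _ (fun y => l + y) f _ (nbhs (l + x))) => /=.
    by apply: cvgD; [exact: cvg_cst|exact: cvg_id].
  exact: cf.
have nO (l : R) : O (l + x) -> \forall y \near x, O (l + y).
  move=> Ol; have : l + y @[y --> x] --> l + x.
    by apply: cvgD; [exact: cvg_cst|exact: cvg_id].
  by apply; exact: open_nbhs_nbhs.
rewrite /interior; near=> y; split; first by near: y; exact: open_nbhs_nbhs.
exists h, k; split => //; [by near: y; exact: nO|by near: y; exact: nO|].
near: y; apply: cvgr_gt xhk.
by apply: cvg_norm; apply: cvgB; exact: cvq.
Unshelve. all: by end_near. Qed.

Let Df : set R := O `&` \bigcap_n \bigcup_m ~` osc m n.

Let DfE x : Df x <-> O x /\ derivable f x 1.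
Proof.
have dE : derivable f x 1 <-> cvg (q h x @[h --> 0^']).
  rewrite /derivable; set g := fun _ => _.
  suff -> : g = q^~ x by [].
  by apply/funext => h; rewrite /g /q /= [h *: 1]mulr1.
split=> [[Ox hx]|[Ox dfx]]; split => //.
  (* Cauchy criterion: all quotients at steps below [1 / (m + 1)] lie within [e] of any single one
     of them, [q k x]. *)
  apply/dE; apply: cauchy_cvg; apply: cauchy_exP => e e0.
  have [n ne] : exists n : nat, n.+1%:R^-1 < e.
    by have [n] := ltr_add_invr e0; rewrite add0r; exists n.
  have [m _ Hm] := hx n I.
  have nO : \forall h \near (0:R), O (h + x).
    have : h + x @[h --> (0:R)] --> 0 + x.
      by apply: cvgD; [exact: cvg_id|exact: cvg_cst].
    by apply; rewrite add0r; exact: open_nbhs_nbhs.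
  have nP : \forall h \near (0:R)^', [/\ O (h + x), 0 < `|h| & `|h| < m.+1%:R^-1].
    near=> h; split.
    - by near: h; exact: nbhs_dnbhs.
    - by rewrite normr_gt0; near: h; exact: nbhs_dnbhs_neq.
    - by near: h; apply: dnbhs0_lt; rewrite invr_gt0.
  have [k [Ok k0 km]] : exists k : R, [/\ O (k + x), 0 < `|k| & `|k| < m.+1%:R^-1].
    exact: filter_ex nP.
  exists (q k x); move: nP; apply: filterS => h [Oh h0 hm].
  rewrite /ball /=; apply: le_lt_trans ne; rewrite leNgt; apply/negP => qkh.
  apply: Hm; split => //; exists k, h; split => //; [exact/andP|exact/andP].
move=> n _.
have /cvg_ex[l ql] := dE.1 dfx.
have n2 : (0 : R) < n.+1%:R^-1 / 2 by rewrite divr_gt0.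
move/cvgrPdist_lt: ql => /(_ _ n2)[d /= d0 dq].
have [m] := ltr_add_invr d0; rewrite add0r => md.
exists m => // -[_ [h [k]]].
case=> /andP[h0 hm] /andP[k0 km] _ _; apply/negP; rewrite -leNgt.
have close (y : R) : 0 < `|y| -> `|y| < m.+1%:R^-1 -> `|l - q y x| < n.+1%:R^-1 / 2.
  move=> y0 ym; apply: dq => /=; first by rewrite sub0r normrN; exact: lt_trans md.
  by rewrite -normr_gt0.
have e3 (A B C : R) : A - B = (C - B) - (C - A) by ring.
rewrite (e3 _ _ l).
rewrite (le_trans (ler_normB _ _))// [leRHS]splitr ltW// ltrD//; exact: close.
Unshelve. all: by end_near. Qed.

Let mDf : measurable Df.
Proof.
apply: measurableI; first exact: open_measurable.
apply: bigcap_measurable => // n _; apply: bigcup_measurable => // m _.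
by apply: measurableC; exact: open_measurable.
Qed.

Let mf : measurable_fun O f.
Proof.
by apply: open_continuous_measurable_fun => // x; rewrite inE; exact: cf.
Qed.

Lemma measurable_derivative : measurable_fun O f^`().
Proof.
have mO : measurable O by exact: open_measurable.
(* Off [Df] the derivative is the default value of a divergent limit, a constant; on [Df] it is the
   pointwise limit of the difference quotients at the steps [1 / (n + 1)]. *)
have -> : O = Df `|` (O `\` Df).
  by apply/seteqP; split=> [x Ox|x [[]|[]]//]; have [|] := pselect (Df x); [left|right].
apply/measurable_funU => //; first exact: measurableD.
split; last first.
  apply: (eq_measurable_fun (fun=> point)); last exact: measurable_cst.
  move=> x; rewrite inE => -[Ox nDx]; rewrite derive1E /derive; symmetry.
  apply: dvgP => h; apply: nDx; apply/DfE; split => //.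
(* Extension by zero makes the quotients measurable on the whole line and does not affect the
   derivative at points of the open set [O]. *)
pose fO : R -> R := f \_ O.
have mfO : measurable_fun setT fO by exact: ((measurable_restrictT f mO).1 mf).
pose s (n : nat) (x : R) : R := n.+1%:R * (fO (n.+1%:R^-1 + x) - fO x).
apply: (measurable_fun_cvg (h := s)).
  move=> n; apply: measurable_funM; first exact: measurable_cst.
  apply: measurable_funB; last exact: measurable_funTS.
  apply: measurable_funTS; apply: measurableT_comp => //.
  by apply: measurable_funD => //; exact: measurable_cst.
move=> x /DfE[Ox dfx].
have e1 : {near x, f =1 fO}.
  near=> y; rewrite /fO patchE ifT// inE; near: y; exact: open_nbhs_nbhs.
have dfOx := near_eq_derivable e1 dfx.
have -> : f^`() x = fO^`() x by rewrite !derive1E; exact: near_eq_derive.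
have : h^-1 *: (fO (h + x) - fO x) @[h --> 0^'] --> fO^`() x.
  rewrite derive1E; move: dfOx; rewrite /derivable /derive.
  set g := fun _ => _; set g' := fun _ => _.
  by have -> : g = g' by apply/funext => h; rewrite /g /g' /= [h *: 1]mulr1.
set g := fun _ => _; move=> hg.
have -> : s^~ x = g \o (fun n => n.+1%:R^-1).
  by apply/funext => n; rewrite /s /g /= invrK.
apply: (cvg_comp (fun n => n.+1%:R^-1) g _ hg) => A [e /= e0 eA].
have [m] := ltr_add_invr e0; rewrite add0r => me.
exists m => // n /= mn; apply: eA => /=; last by rewrite invr_neq0.
rewrite sub0r normrN ger0_norm ?invr_ge0//; apply: le_lt_trans me.
by rewrite lef_pV2 ?posrE// ler_nat.
Unshelve. all: by end_near. Qed.

End measurable_derivative.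

(** * Explicit C^1 approximations of step functions *)

Section positive_part.
Variable R : realType.
Implicit Types x y c h : R.

Definition pos (x : R) : R := Num.max 0 x.

Lemma pos_ge0 x : 0 <= x -> pos x = x.
Proof. by move=> x0; rewrite /pos max_r. Qed.

Lemma pos_le0 x : x <= 0 -> pos x = 0.
Proof. by move=> x0; rewrite /pos max_l. Qed.

Lemma continuous_pos : continuous pos.
Proof.
move=> x; apply: (@continuous_max _ _ (fun=> 0) id); first exact: cvg_cst.
exact: cvg_id.
Qed.

Lemma is_derive_pos2 x : is_derive x 1 (fun y => pos y ^+ 2) (2 * pos x).
Proof.
have [x0|x0|->] := ltgtP x 0.
- rewrite pos_le0 ?ltW// mulr0.
  apply: (@near_eq_is_derive _ _ _ (fun=> 0)) => //.
    near=> y; rewrite pos_le0 ?expr0n//; near: y; exact: lt_le_nbhsl.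
- rewrite pos_ge0 ?ltW//.
  apply: (@near_eq_is_derive _ _ _ (fun y => y ^+ 2)) => //.
    near=> y; rewrite pos_ge0//; near: y; exact: lt_le_nbhsr.
  have := is_deriveM (is_derive_id x (1 : R)) (is_derive_id x (1 : R)).
  have -> : @idfun R * @idfun R = fun y => y ^+ 2 by apply/funext => y; rewrite expr2.
  by rewrite /= /GRing.scale /= !mulr1 -mulr2n mulr_natl.
- have H : (fun h => h^-1 *: (((fun y => pos y ^+ 2) \o shift 0) (h *: 1) - pos 0 ^+ 2)) @ 0^' --> (0:R).
    have : pos h @[h --> (0:R)^'] --> (0:R).
      have : pos h @[h --> (0:R)] --> pos 0 by exact: continuous_pos.
      rewrite (pos_ge0 (lexx 0)) => h.
      exact: cvg_trans (@cvg_app _ _ _ _ pos (@nbhs_dnbhs _ (0:R))) h.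
    apply: cvg_trans; apply: near_eq_cvg; near=> h.
    have h0 : h != 0 by near: h; exact: nbhs_dnbhs_neq.
    rewrite /= addr0 [h *: 1]mulr1 (pos_ge0 (lexx 0)) expr0n subr0.
    have [hp|hp] := leP 0 h; first by rewrite pos_ge0// expr2 scalerA mulVf// scale1r.
    by rewrite pos_le0 ?ltW// expr0n scaler0.
  rewrite pos_ge0// mulr0; split; last exact: cvg_lim H.
  by apply/cvg_ex; exists 0.
Unshelve. all: by end_near. Qed.

Lemma is_derive_pos2_shift c x :
  is_derive x 1 (fun y => pos (y - c) ^+ 2) (2 * pos (x - c)).
Proof.
have h1 := is_derive_pos2 (x - c).
have h2 : is_derive x 1 (fun y => y - c) 1.
  by apply: is_derive_eq; rewrite oppr0 addr0.
have := @is_derive1_comp _ (fun y => pos y ^+ 2) (fun y => y - c) x _ _ h1 h2.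
by rewrite mulr1.
Qed.

End positive_part.

Section smooth_step.
Variable R : realType.
(** A Heaviside function mollified to class [C^1]: the primitive of the hat function [dstep h],
    which has mass one and support [[0, 2 * h]]. *)
Definition step (h s : R) : R :=
  (pos s ^+ 2 - 2 * pos (s - h) ^+ 2 + pos (s - 2 * h) ^+ 2) / (2 * h ^+ 2).

Definition dstep (h s : R) : R :=
  (pos s - 2 * pos (s - h) + pos (s - 2 * h)) / h ^+ 2.

Lemma step_le0 (h s : R) : 0 < h -> s <= 0 -> step h s = 0.
Proof.
move=> h0 s0.
by rewrite /step !pos_le0 ?expr0n ?mulr0 ?subr0 ?addr0 ?mul0r//; lra.
Qed.

Lemma step_ge (h s : R) : 0 < h -> 2 * h <= s -> step h s = 1.
Proof.
move=> h0 s0; rewrite /step !pos_ge0; [|lra|lra|lra].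
by field; exact: lt0r_neq0.
Qed.

Lemma step_bound (h s : R) : 0 < h -> 0 <= step h s <= 1.
Proof.
move=> h0; have h2 : 0 < 2 * h ^+ 2 by nra.
have [s0|s0] := leP s 0; first by rewrite step_le0// lexx ler01.
have [s1|s1] := leP (2 * h) s; first by rewrite step_ge// lexx ler01.
rewrite /step (pos_ge0 (ltW s0)) (pos_le0 (x := s - 2 * h)); last lra.
rewrite ler_pdivlMr// ler_pdivrMr// expr0n /= addr0 mul0r mul1r.
have [s2|s2] := leP s h; first by rewrite pos_le0; [apply/andP; split; nra|lra].
by rewrite pos_ge0; [apply/andP; split; nra|lra].
Qed.

Lemma dstep_out (h s : R) : 0 < h -> s <= 0 \/ 2 * h <= s -> dstep h s = 0.
Proof.
move=> h0 [] hs; first by rewrite /dstep !pos_le0 ?mulr0 ?subr0 ?addr0 ?mul0r//; lra.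
rewrite /dstep !pos_ge0; [|lra|lra|lra].
by field; exact: lt0r_neq0.
Qed.

Lemma dstep_ge0 (h s : R) : 0 < h -> 0 <= dstep h s.
Proof.
move=> h0; have h2 : 0 < h ^+ 2 by nra.
have [s0|s0] := leP s 0; first by rewrite dstep_out//; left.
have [s1|s1] := leP (2 * h) s; first by rewrite dstep_out//; right.
rewrite /dstep (pos_ge0 (ltW s0)) (pos_le0 (x := s - 2 * h)); last lra.
apply: divr_ge0; last exact: ltW.
have [s2|s2] := leP s h; first by rewrite pos_le0; lra.
by rewrite pos_ge0; lra.
Qed.

Lemma is_derive_step_shift (h c x : R) : 0 < h ->
  is_derive x (1:R) (fun y => step h (y - c)) (dstep h (x - c)).
Proof.
move=> h0; have d1 := is_derive_pos2_shift c x.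
have d2 := is_derive_pos2_shift (c + h) x.
have d3 := is_derive_pos2_shift (c + 2 * h) x.
have -> : (fun y => step h (y - c)) = (fun y => ((2 * h ^+ 2)^-1) *
    (pos (y - c) ^+ 2 - 2 * pos (y - (c + h)) ^+ 2 + pos (y - (c + 2 * h)) ^+ 2)).
  by apply/funext => y; rewrite /step mulrC !opprD !addrA.
apply: is_derive_eq.
rewrite /dstep !opprD !addrA /=.
have sc (k z : R) : k *: z = k * z by [].
by rewrite !sc; field; exact: lt0r_neq0.
Qed.

Lemma continuous_dstep_shift (h c : R) : 0 < h -> continuous (fun y => dstep h (y - c)).
Proof.
move=> h0 x; have cp (k : R) : (fun y => pos (y - k)) y @[y --> x] --> pos (x - k).
  apply: (@cvg_comp _ _ _ (fun y => y - k) (@pos R) _ (nbhs (x - k))) => /=.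
    by apply: cvgB; [exact: cvg_id|exact: cvg_cst].
  exact: continuous_pos.
have -> : (fun y => dstep h (y - c)) = (fun y => 
    (pos (y - c) - 2 * pos (y - (c + h)) + pos (y - (c + 2 * h))) * (h ^+ 2)^-1).
  by apply/funext => y; rewrite /dstep !opprD !addrA.
apply: cvgM; last exact: cvg_cst.
apply: cvgD; last exact: cp.
apply: cvgB; first exact: cp.
by apply: cvgM; [exact: cvg_cst|exact: cp].
Qed.

End smooth_step.

(** * Interval integrals and the passage from weak derivatives to increments *)

Section intervals.
Variable R : realType.
Local Notation mu := (@lebesgue_measure R).
Implicit Types a b c d x y : R.

Lemma itv_fin c d : (mu `]c, d[%classic < +oo)%E.
Proof. by rewrite lebesgue_measure_itv /=; case: ifP => _; rewrite -?EFinD ltry. Qed.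

Lemma itvcc_fin c d : (mu `[c, d]%classic < +oo)%E.
Proof. by rewrite lebesgue_measure_itv /=; case: ifP => _; rewrite -?EFinD ltry. Qed.

Lemma fine_itv c d : c <= d -> fine (mu `]c, d[%classic) = d - c.
Proof.
rewrite le_eqVlt => /predU1P[->|cd]; rewrite lebesgue_measure_itv /= lte_fin.
  by rewrite ltxx subrr.
by rewrite cd.
Qed.

Lemma fine_itvcc c d : c <= d -> fine (mu `[c, d]%classic) = d - c.
Proof.
rewrite le_eqVlt => /predU1P[->|cd]; rewrite lebesgue_measure_itv /= lte_fin.
  by rewrite ltxx subrr.
by rewrite cd.
Qed.

Lemma is_derive_continuous (F : R -> R) x l : is_derive x (1:R) F l -> {for x, continuous F}.
Proof.
by move=> h; apply/differentiable_continuous/derivable1_diffP.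
Qed.

Lemma FTC2_segment (F f : R -> R) a b : a <= b ->
  (forall x, is_derive x (1:R) F (f x)) -> continuous f ->
  \int[mu]_(x in `[a, b]) f x = F b - F a.
Proof.
rewrite le_eqVlt => /predU1P[<-|ab] dF cf.
  by rewrite set_itv1 Rintegral_set1 subrr.
rewrite /Rintegral (continuous_FTC2 (F := F) ab)//.
- exact: continuous_subspaceT.
- split.
  + by move=> x _; case: (dF x).
  + by apply: cvg_at_right_filter; exact: is_derive_continuous.
  + by apply: cvg_at_left_filter; exact: is_derive_continuous.
- by move=> x _; rewrite derive1E; exact: derive_val.
Qed.

Lemma continuous_aeb (f : R -> R) c d : continuous f -> aeb `]c, d[ f.
Proof.
move=> cf; apply: (aeb_comp cf); split; first exact: measurable_id.
exists (Num.max `|c| `|d|); apply: ae_onW => x /=; rewrite in_itv /= => /andP[cx xd].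
rewrite le_max; have [x0|x0] := leP 0 x.
  by apply/orP; right; rewrite !ger0_norm//; lra.
by apply/orP; left; rewrite !ltr0_norm//; lra.
Qed.

Lemma test_function_step c d x y (h : R) : 0 < h -> c < x -> x <= y -> y + 2 * h < d ->
  test_function `]c, d[ (fun s => step h (s - x) - step h (s - y)).
Proof.
move=> h0 cx xy yd; have der s : is_derive s (1:R) (fun s => step h (s - x) - step h (s - y))
    (dstep h (s - x) - dstep h (s - y)).
  by apply: is_deriveB; exact: is_derive_step_shift.
split.
  move=> s _; split; first by case: (der s).
  rewrite (_ : derive1 _ = (fun s => dstep h (s - x) - dstep h (s - y))); last first.
    by apply/funext => z; rewrite derive1E; case: (der z).
  by apply: cvgB; exact: continuous_dstep_shift.
exists (`[x, y + 2 * h]%classic).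
  split; first exact: segment_compact.
  by move=> s /=; rewrite !in_itv /= => /andP[h1 h2]; apply/andP; split; lra.
move=> s /= /negP; rewrite in_itv /= negb_and -!ltNge => /orP[hs|hs].
  by rewrite !step_le0 ?subr0//; lra.
by rewrite !step_ge ?subrr//; lra.
Qed.

Lemma I_dstep c d x (h : R) : 0 < h -> c < x -> x + 2 * h < d ->
  \int[mu]_(s in `]c, d[) dstep h (s - x) = 1.
Proof.
move=> h0 cx xd.
have sub : `[x, x + 2 * h] `<=` `]c, d[.
  by move=> s /=; rewrite !in_itv /= => /andP[h1 h2]; apply/andP; split; lra.
have -> : 1 = \int[mu]_(s in `[x, x + 2 * h]) dstep h (s - x).
  have xh : x <= x + 2 * h by lra.
  rewrite (FTC2_segment xh (fun s => is_derive_step_shift x s h0) (@continuous_dstep_shift _ h x h0)).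
  have -> : x + 2 * h - x = 2 * h by ring.
  by rewrite subrr step_ge// step_le0// subr0.
rewrite (I_restrict _ sub); apply: eq_Rintegral => s _; rewrite indicE.
case: (boolP (s \in _)) => [_|]; first by rewrite mulr1.
rewrite notin_setE /= => /negP; rewrite in_itv /= negb_and -!ltNge => hs.
by rewrite dstep_out ?mul0r//; case/orP: hs => hs; [left|right]; lra.
Qed.

Lemma subset_cc_oo c d x y : c < x -> y < d -> `[x, y] `<=` `]c, d[.
Proof.
move=> cx yd s /=; rewrite !in_itv /= => /andP[xs sy].
by rewrite (lt_le_trans cx xs) (le_lt_trans sy yd).
Qed.

Lemma indic_cc x y s : \1_`[x, y] s = (if x <= s <= y then 1 else 0) :> R.
Proof. by rewrite indicE mem_setE in_itv /=; case: ifP. Qed.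

Lemma step_indic x y (h s : R) : 0 < h -> x + 2 * h <= y ->
  `|step h (s - x) - step h (s - y) - \1_`[x, y] s| <=
  \1_`[x, x + 2 * h] s + \1_`[y, y + 2 * h] s.
Proof.
move=> h0 xy; rewrite !indic_cc.
have B1 := step_bound (s - x) h0; have B2 := step_bound (s - y) h0.
have [sx|sx] := ltP s x.
  rewrite !step_le0; [|lra|lra|lra|lra].
  by rewrite /= !subrr normr0 addr_ge0//; case: ifP.
have [sy|sy] := ltP (y + 2 * h) s.
  rewrite !step_ge; [|lra|lra|lra|lra].
  have -> : (s <= y) = false by lra.
  by rewrite andbF /= !subrr normr0 addr_ge0//; case: ifP.
have [s1|s1] := leP s (x + 2 * h).
  rewrite (step_le0 (s := s - y))//; last lra.
  have -> : (s <= y) = true by lra.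
  by rewrite /= subr0; case: ifP => _; rewrite ler_norml; lra.
have [s2|s2] := ltP s y.
  rewrite (step_le0 (s := s - y))//; last lra.
  rewrite (step_ge (s := s - x))//; last lra.
  by rewrite (ltW s2) /= subr0 subrr normr0 addr_ge0//; case: ifP.
rewrite (step_ge (s := s - x))//; last lra.
rewrite /= add0r; by case: ifP => _; rewrite ler_norml; lra.
Qed.

(* Testing against a C^1 approximation of the indicator of [x, y]. *)
Lemma weak_FTC c d (f w : R -> R) :
  (forall x, c < x < d -> {for x, continuous f}) ->
  aeb `]c, d[ f -> aeb `]c, d[ w ->
  (forall phi, test_function `]c, d[ phi ->
    \int[mu]_(x in `]c, d[) (f x * phi^`()%classic x) =
    - \int[mu]_(x in `]c, d[) (w x * phi x)) ->
  forall x y, c < x -> x <= y -> y < d ->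
  f y - f x = \int[mu]_(s in `[x, y]) w s.
Proof.
move=> cf bf bw weak x y cx; rewrite le_eqVlt => /predU1P[<- _|xy yd].
  by rewrite set_itv1 Rintegral_set1 subrr.
have mO : measurable (`]c, d[%classic : set R) by [].
have fO := itv_fin c d.
case: (bw) => mw [K hK].
apply/eqP; rewrite -subr_eq0 -normr_le0; apply/ler_addgt0Pr => e e0; rewrite add0r.
pose eta := e / 3; have eta0 : 0 < eta by rewrite divr_gt0.
have nearby z : c < z < d -> exists2 r : R, 0 < r & forall s, `|s - z| <= r -> `|f s - f z| <= eta.
  move=> /cf /cvgrPdist_le /(_ _ eta0)[r /= r0 hr]; exists (r / 2); first by rewrite divr_gt0.
  move=> s sz; rewrite distrC; apply: hr; rewrite /= distrC (le_lt_trans sz)//; lra.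
have [r1 r10 hr1] : exists2 r : R, 0 < r & forall s, `|s - x| <= r -> `|f s - f x| <= eta.
  by apply: nearby; lra.
have [r2 r20 hr2] : exists2 r : R, 0 < r & forall s, `|s - y| <= r -> `|f s - f y| <= eta.
  by apply: nearby; lra.
pose K1 := `|K| + 1; have K10 : 0 < K1 by rewrite ltr_pwDr.
(* A step [h] this small makes [f] vary by at most [eta] on both bumps, keeps the bumps disjoint and
   inside []c, d[], and bounds by [eta] the contribution of [w] over the two ramps, of total length
   [4 * h]. *)
pose m1 := Num.min (Num.min r1 r2) (Num.min (y - x) (d - y)).
have m10 : 0 < m1 by rewrite !lt_min r10 r20 !subr_gt0 xy yd.
pose h := Num.min (m1 / 4) (eta / (4 * K1)).
have h0 : 0 < h by rewrite lt_min !divr_gt0// mulr_gt0.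
have hm : 4 * h <= m1.
  have : h <= m1 / 4 by rewrite ge_min lexx.
  lra.
have hK1 : 4 * h * K1 <= eta.
  have : h <= eta / (4 * K1) by rewrite ge_min lexx orbT.
  by rewrite ler_pdivlMr ?mulr_gt0//; lra.
have [h1 h2 h3 h4] : [/\ 4 * h <= r1, 4 * h <= r2, 4 * h <= y - x & 4 * h <= d - y].
  by move: hm; rewrite !le_min => /andP[/andP[-> ->] /andP[-> ->]].
have yd' : y + 2 * h < d by lra.
have := weak _ (test_function_step h0 cx (ltW xy) yd').
set phi := fun s => step h (s - x) - _.
have dphi : phi^`()%classic = fun s => dstep h (s - x) - dstep h (s - y).
  apply/funext => s; rewrite derive1E; apply: (@derive_val _ _ _ _ _ phi).
  by apply: is_deriveB; exact: is_derive_step_shift.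
rewrite dphi.
have bd z : aeb `]c, d[ (fun s => dstep h (s - z)).
  exact/continuous_aeb/continuous_dstep_shift.
have bphi : aeb `]c, d[ phi.
  apply: continuous_aeb => s.
  by apply: (@is_derive_continuous _ _ (dstep h (s - x) - dstep h (s - y))); apply: is_deriveB; exact: is_derive_step_shift.
have -> : \int[mu]_(s in `]c, d[) (f s * (dstep h (s - x) - dstep h (s - y))) =
    \int[mu]_(s in `]c, d[) (f s * dstep h (s - x)) - \int[mu]_(s in `]c, d[) (f s * dstep h (s - y)).
  rewrite -I_B//; [|exact: aebM|exact: aebM].
  by apply: eq_Rintegral => s _; rewrite mulrBr.
(* The bump [dstep h (s - z)] has mass one and lives on [[z, z + 2 * h]], so it averages [f] to
   within [eta] of [f z]. *)
have avg z r : c < z -> z + 2 * h < d -> 2 * h <= r ->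
    (forall s, `|s - z| <= r -> `|f s - f z| <= eta) ->
    `|\int[mu]_(s in `]c, d[) (f s * dstep h (s - z)) - f z| <= eta.
  move=> cz zd hr hz.
  rewrite -[X in _ - X]mulr1 -(I_dstep h0 cz zd) -I_Z//.
  rewrite -I_B//; [|exact: aebM|exact: aebZ].
  apply: le_trans (I_norm _ _ _) _ => //; first by apply: aebB; [exact: aebM|exact: aebZ].
  rewrite -[leRHS]mulr1 -(I_dstep h0 cz zd) -I_Z//.
  apply: I_le => //; [|exact: aebZ|].
    by apply: aeb_norm; apply: aebB; [exact: aebM|exact: aebZ].
  apply: ae_onW => s _; rewrite -mulrBl normrM (ger0_norm (dstep_ge0 _ h0)).
  have [zs|zs] := leP s z; first by rewrite dstep_out ?mulr0//; left; lra.
  have [zs'|zs'] := leP (z + 2 * h) s; first by rewrite dstep_out ?mulr0//; right; lra.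
  rewrite ler_wpM2r ?dstep_ge0//; apply: hz.
  by move: zs zs' hr; clear; rewrite ler_norml; lra.
have A1 : `|\int[mu]_(s in `]c, d[) (f s * dstep h (s - x)) - f x| <= eta.
  by apply: avg hr1 => //; move: h0 h1 h3 yd'; clear; lra.
have A2 : `|\int[mu]_(s in `]c, d[) (f s * dstep h (s - y)) - f y| <= eta.
  by apply: avg hr2 => //; [exact: lt_trans xy|move: h0 h2; clear; lra].
set Ix := \int[mu]_(s in `]c, d[) (f s * dstep h (s - x)).
set Iy := \int[mu]_(s in `]c, d[) (f s * dstep h (s - y)).
have sub : `[x, y] `<=` `]c, d[ by exact: subset_cc_oo.
have subx : `[x, x + 2 * h] `<=` `]c, d[.
  by apply: subset_cc_oo => //; rewrite (le_lt_trans _ yd')// lerD2r ltW.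
have suby : `[y, y + 2 * h] `<=` `]c, d[.
  by apply: subset_cc_oo => //; exact: lt_trans xy.
have A3 : `|\int[mu]_(s in `]c, d[) (w s * phi s) - \int[mu]_(s in `[x, y]) w s| <= eta.
  rewrite (I_restrict _ sub) -I_B//; [|exact: aebM|by apply: aebM => //; exact: aeb_indic].
  apply: le_trans (I_norm _ _ _) _ => //.
    by apply: aebB; [exact: aebM|apply: aebM => //; exact: aeb_indic].
  apply: le_trans hK1.
  have -> : 4 * h * K1 = K1 * (\int[mu]_(s in `]c, d[) (\1_(`[x, x + 2 * h]) s + \1_(`[y, y + 2 * h]) s)).
    rewrite I_D//; [|exact: aeb_indic|exact: aeb_indic].
    have le2 z : z <= z + 2 * h by rewrite lerDl mulr_ge0// ltW.
    rewrite !I_indic// !fine_itvcc//.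
    by ring.
  rewrite -I_Z//; last by apply: aebD; exact: aeb_indic.
  apply: I_le => //.
  - by apply/aeb_norm/aebB; [exact: aebM|apply: aebM => //; exact: aeb_indic].
  - by apply/aebZ/aebD; exact: aeb_indic.
  apply: ae_on_imp hK => s _ ws.
  rewrite -mulrBr normrM ler_pM//.
    by rewrite (le_trans ws)// /K1 (le_trans (ler_norm K))// lerDl.
  apply: step_indic => //; move: h3 h0; clear; lra.
move=> E.
move: A1 A2 A3 E; rewrite -/Ix -/Iy.
set Iw := \int[mu]_(s in `]c, d[) _; set Iwxy := \int[mu]_(s in `[x, y]) _.
move=> A1 A2 A3 E.
move: A1 A2 A3 E; rewrite !ler_norml /eta; clear => /andP[? ?] /andP[? ?] /andP[? ?] E.
by apply/andP; split; lra.
Qed.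

End intervals.

(** * Sobolev functions on an interval *)

Local Notation D1 := derive1.
Local Notation D2 := (derive1n 2).

#[local] Opaque Rintegral derive1.

Section Loo.
Variable R : realType.
Local Notation mu := (@lebesgue_measure R).
Implicit Types (f u v : R -> R) (D O : set R).

Lemma Lnorm_oo_leP D f (k : R) : 0 <= k ->
  (Lnorm_on +oo%E D f <= k%:E)%E <-> ae_on D (fun x => `|f x| <= k).
Proof.
move=> k0; rewrite /Lnorm_on unlock.
(* The norm with exponent [+oo] is defined by cases on whether the whole space is null. *)
have -> : (0 < mu [set: R])%E.
  by rewrite -set_itvNyy lebesgue_measure_itv /= ltry.
split=> [/ess_supP|h].
  apply: (@filterS _ _ (ae_filter_ringOfSetsType mu)) => x /= h Dx.
  by move: h; rewrite patchE mem_set.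
apply/ess_supP; move: h; rewrite /ae_on.
apply: (@filterS _ _ (ae_filter_ringOfSetsType mu)) => x /= h.
rewrite patchE; case: ifPn => [|_]; last by rewrite abse0 lee_fin.
by rewrite inE => /h.
Qed.

Lemma Lebesgue_oo_aeb D f : Lebesgue_space +oo%E D f <-> aeb D f.
Proof.
split=> -[mf h]; split => //.
  have l0 : (0 <= Lnorm_on +oo%E D f)%E by exact: Lnorm_ge0.
  exists (fine (Lnorm_on +oo%E D f)).
  by apply/Lnorm_oo_leP; [exact: fine_ge0|rewrite fineK// ge0_fin_numE].
case: h => K hK; apply: (@le_lt_trans _ _ (`|K|%:E)); last exact: ltry.
apply/Lnorm_oo_leP => //; apply: ae_on_imp hK => x _ h.
by rewrite (le_trans h)// ler_norm.
Qed.

Lemma aeb_locally_integrable O f : open O -> (mu O < +oo)%E -> aeb O f ->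
  locally_integrable O f.
Proof.
move=> oO fO bf; apply: open_integrable_locally => //; apply: aeb_integrable => //.
exact: open_measurable.
Qed.

Lemma C1_on_continuous O u x : C1_on O u -> O x -> {for x, continuous u}.
Proof.
by move=> h /h[dx _]; apply/differentiable_continuous/derivable1_diffP.
Qed.

Lemma C1_on_is_derive O u x : C1_on O u -> O x -> is_derive x 1 u ((D1 u) x).
Proof. by move=> h /h[dx _]; rewrite derive1E; exact: derivableP. Qed.

Lemma is_derive1E u x l : is_derive x (1:R) u l -> (D1 u) x = l.
Proof. by move=> h; rewrite derive1E; case: h. Qed.

Lemma open_near O x : open O -> O x -> \forall y \near x, O y.
Proof. by move=> oO Ox; exact: open_nbhs_nbhs. Qed.

Lemma eq_on_derive O u v x : open O -> O x -> (forall y, O y -> u y = v y) ->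
  (D1 u) x = (D1 v) x.
Proof.
move=> oO Ox uv; rewrite !derive1E; apply: near_eq_derive.
by apply: filterS (open_near oO Ox) => y /uv.
Qed.

Lemma eq_on_derivable O u v x : open O -> O x -> (forall y, O y -> u y = v y) ->
  derivable u x 1 -> derivable v x 1.
Proof.
move=> oO Ox uv; apply: near_eq_derivable.
by apply: filterS (open_near oO Ox) => y /uv.
Qed.

Lemma eq_on_is_derive O u v x l : open O -> O x -> (forall y, O y -> u y = v y) ->
  is_derive x (1:R) u l -> is_derive x (1:R) v l.
Proof.
move=> oO Ox uv; apply: near_eq_is_derive.
by apply: filterS (open_near oO Ox) => y /uv.
Qed.

Lemma test_function_aeb O phi c d : test_function O phi ->
  aeb `]c, d[ phi /\ aeb `]c, d[ (D1 phi).
Proof.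
move=> [h _]; split; apply: continuous_aeb => x.
  exact: (C1_on_continuous h).
by case: (h x I).
Qed.

Lemma test_function_out O phi : test_function O phi ->
  exists K, [/\ closed K, K `<=` O, forall x, ~ K x -> phi x = 0 &
    forall x, ~ K x -> (D1 phi) x = 0].
Proof.
move=> [h [K [cK KO] phi0]]; exists K.
have clK : closed K by exact: compact_closed.
split => // x nKx.
rewrite (@eq_on_derive (~` K) _ (fun=> 0))//; last exact: closed_openC.
by rewrite derive1E derive_cst.
Qed.

Lemma test_function_sub O O' phi : O' `<=` O -> test_function O' phi ->
  test_function O phi.
Proof.
by move=> s [h [K [cK KO] phi0]]; split => //; exists K => //; split => // x /KO/s.
Qed.

Lemma weak_derivative_sub O O' f f' : open O' -> O' `<=` O ->
  (mu O' < +oo)%E -> aeb O' f -> aeb O' f' ->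
  weak_derivative O f f' -> weak_derivative O' f f'.
Proof.
move=> oO' s fO' bf bf' [_ _ h]; split; try exact: aeb_locally_integrable.
move=> phi tphi; have [K [cK KO phi0 dphi0]] := test_function_out tphi.
have E (F : R -> R) : (forall x, ~ K x -> F x = 0) ->
    \int[mu]_(x in O') F x = \int[mu]_(x in O) F x.
  move=> F0; rewrite (Rintegral_mkcond mu O') (Rintegral_mkcond mu O).
  apply: eq_Rintegral => x _; rewrite !patchE.
  case: ifPn => xO'; case: ifPn => xO //.
    by move: xO' xO; rewrite inE notin_setE => /s.
  by rewrite F0// => /KO; move: xO'; rewrite notin_setE.
rewrite !E; [exact/h/(test_function_sub s)| |] => x /=.
  by move=> /phi0 ->; rewrite mulr0.
by move=> /dphi0 ->; rewrite mulr0.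
Qed.

Lemma W2oo_sub O O' u : open O -> open O' -> O' `<=` O -> (mu O' < +oo)%E ->
  W2 +oo%E O u -> W2 +oo%E O' u.
Proof.
move=> oO oO' s fO' [hC /Lebesgue_oo_aeb h0 /Lebesgue_oo_aeb h1 /Lebesgue_oo_aeb h2 hw].
have mO := open_measurable oO.
have bs f : aeb O f -> aeb O' f by exact: aeb_sub.
split; try by apply/Lebesgue_oo_aeb; exact: bs.
  by move=> x /s/hC.
by apply: weak_derivative_sub hw => //; exact: bs.
Qed.

End Loo.

Section W2_interval.
Variable R : realType.
Local Notation mu := (@lebesgue_measure R).
Variables c d : R.
Local Notation O := (`]c, d[%classic : set R).
Implicit Types (f u v : R -> R).

Let oO : open O. Proof. exact: interval_open. Qed.
Let mO : measurable O. Proof. by []. Qed.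
Let fO : (mu O < +oo)%E. Proof. exact: itv_fin. Qed.

Lemma W2ooP u : W2 +oo%E O u <->
  [/\ C1_on O u, aeb O u, aeb O (D1 u), aeb O (D2 u) &
    forall phi, test_function O phi ->
      \int[mu]_(x in O) ((D1 u) x * (D1 phi) x) =
      - \int[mu]_(x in O) ((D2 u) x * phi x)].
Proof.
split=> [[hC /Lebesgue_oo_aeb h0 /Lebesgue_oo_aeb h1 /Lebesgue_oo_aeb h2 [_ _ hw]] //|].
move=> [hC h0 h1 h2 hw].
by split => //; try exact/Lebesgue_oo_aeb; split => //; exact: aeb_locally_integrable.
Qed.

Lemma C1_on_continuous_derive u x : C1_on O u -> O x -> {for x, continuous (D1 u)}.
Proof. by move=> h /h[]. Qed.

Lemma W2_FTC u x y : W2 +oo%E O u -> c < x -> x <= y -> y < d ->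
  (D1 u) y - (D1 u) x = \int[mu]_(s in `[x, y]) (D2 u) s.
Proof.
move=> /W2ooP[hC h0 h1 h2 hw] cx xy yd; apply: (weak_FTC _ h1 h2 hw) => // z.
by move=> cz; case: (hC z) => //=; rewrite in_itv.
Qed.

(** Inside the interval [D1 u] is, up to a constant, a primitive of [D2 u], so Lebesgue's
    differentiation theorem applies. Only from here on is [D2 u] known to be a genuine derivative
    almost everywhere. *)
Lemma W2_ae_derivable u : W2 +oo%E O u -> ae_on O (fun x => derivable (D1 u) x 1).
Proof.
move=> Wu; have /W2ooP[hC h0 h1 h2 hw] := Wu.
pose w : R -> R := (D2 u) \_ O.
have lw : locally_integrable setT w.
  apply: integrable_locally_restrict => //; exact: aeb_integrable.
have iw (A : set R) : measurable A -> mu.-integrable A (EFin \o w).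
  move=> mA; apply: (@integrableS _ _ _ mu setT) => //.
  rewrite /w -restrict_EFin; apply/integrable_restrict => //.
  by rewrite setTI; exact: aeb_integrable.
have := FTC1Ny (fun y : R => iw (`]-oo, y]%classic) (measurable_itv _)) lw.
rewrite /ae_on; apply: (@filterS _ _ (ae_filter_ringOfSetsType mu)) => x /= [dF _].
rewrite in_itv /= => /andP[cx xd].
(* The integral formula for [D1 u] needs a base point inside the open interval; any point between
   [c] and [x] serves. *)
pose x0 := (c + x) / 2.
have cx0 : c < x0 by rewrite /x0; lra.
have x0x : x0 < x by rewrite /x0; lra.
set F := fun y => _ in dF.
have dF' := derivableD dF (derivable_cst ((D1 u) x0 - F x0) x 1).
move: dF'; apply: (@eq_on_derivable _ `]x0, d[) => //=.
  by rewrite in_itv /= x0x xd.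
move=> y /=; rewrite in_itv /= => /andP[x0y yd].
rewrite [LHS](_ : _ = F y + ((D1 u) x0 - F x0))//.
suff E : (D1 u) y - (D1 u) x0 = F y - F x0.
  by rewrite -[RHS](subrK ((D1 u) x0)) E; ring.
rewrite (W2_FTC Wu cx0 (ltW x0y) yd).
rewrite /F Rintegral_itvB//; [|exact: iw|by rewrite bnd_simp ltW].
rewrite Rintegral_itv_obnd_cbnd; last exact: iw.
apply: eq_Rintegral => s; rewrite inE /= in_itv /= => /andP[s1 s2].
by rewrite /w patchE mem_set//= in_itv /= (lt_le_trans cx0 s1) (le_lt_trans s2).
Qed.

Lemma derive_lin k u v x : C1_on O u -> C1_on O v -> O x ->
  is_derive x 1 (fun y => k * u y + v y) (k * (D1 u) x + (D1 v) x).
Proof.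
move=> hu hv Ox; have du := C1_on_is_derive hu Ox; have dv := C1_on_is_derive hv Ox.
by apply: is_deriveD; exact: is_deriveZ.
Qed.

Lemma C1_on_lin k u v : C1_on O u -> C1_on O v -> C1_on O (fun y => k * u y + v y).
Proof.
move=> hu hv x Ox; split; first by case: (derive_lin k hu hv Ox).
have : {for x, continuous (fun y => k * (D1 u) y + (D1 v) y)}.
  apply: cvgD; last exact: C1_on_continuous_derive.
  by apply: cvgM; [exact: cvg_cst|exact: C1_on_continuous_derive].
rewrite /prop_for /continuous_at (is_derive1E (derive_lin k hu hv Ox)).
apply: cvg_trans; apply: near_eq_cvg; apply: filterS (open_near oO Ox) => y Oy.
by rewrite (is_derive1E (derive_lin k hu hv Oy)).
Qed.

(** The identity can fail where a summand has no second derivative, since default values do not add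
    up. *)
Lemma derive2_lin k u v : W2 +oo%E O u -> W2 +oo%E O v ->
  ae_on O (fun x => (D2 (fun y => k * u y + v y)) x = k * (D2 u) x + (D2 v) x).
Proof.
move=> Wu Wv; have /W2ooP[hu _ _ _ _] := Wu; have /W2ooP[hv _ _ _ _] := Wv.
apply: ae_on_imp2 (W2_ae_derivable Wu) (W2_ae_derivable Wv) => x Ox du dv.
rewrite /derive1n /=; apply: is_derive1E.
apply: (@eq_on_is_derive _ O (fun y => k * (D1 u) y + (D1 v) y) _ _ _ oO Ox).
  by move=> y Oy; rewrite (is_derive1E (derive_lin k hu hv Oy)).
have := derivableP du; have := derivableP dv; rewrite -!derive1E => d1 d2.
by apply: is_deriveD; exact: is_deriveZ.
Qed.

Lemma W2_lin k u v : W2 +oo%E O u -> W2 +oo%E O v ->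
  W2 +oo%E O (fun y => k * u y + v y).
Proof.
move=> Wu Wv; have /W2ooP[hu u0 u1 u2 uw] := Wu; have /W2ooP[hv v0 v1 v2 vw] := Wv.
have hC := C1_on_lin k hu hv.
have E1 x : O x -> (D1 (fun y => k * u y + v y)) x = k * (D1 u) x + (D1 v) x.
  by move=> Ox; rewrite (is_derive1E (derive_lin k hu hv Ox)).
have E2 := derive2_lin k Wu Wv.
have cC x : O x -> {for x, continuous (D1 (fun y => k * u y + v y))} by move=> /hC[].
have b1 : aeb O (D1 (fun y => k * u y + v y)).
  have : aeb O (fun y => k * (D1 u) y + (D1 v) y) by apply: aebD => //; exact: aebZ.
  move=> [mf [K hK]]; split.
    apply: eq_measurable_fun mf => x; rewrite inE => Ox.
    by rewrite E1.
  by exists K; apply: ae_on_imp hK => x Ox; rewrite E1.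
have b2 : aeb O (D2 (fun y => k * u y + v y)).
  split; first exact: measurable_derivative.
  have [_ [K hK]] : aeb O (fun y => k * (D2 u) y + (D2 v) y) by apply: aebD => //; exact: aebZ.
  by exists K; apply: ae_on_imp2 hK E2 => x _ h ->.
have b0 : aeb O (fun y => k * u y + v y) by apply: aebD v0; exact: aebZ.
apply/W2ooP; split; [exact: hC|exact: b0|exact: b1|exact: b2|].
move=> phi tphi; have [bp bp'] := test_function_aeb c d tphi.
have bl : aeb O (fun x => k * D2 u x + D2 v x) by apply: aebD v2; exact: aebZ.
have -> : \int[mu]_(x in O) (D2 (fun y => k * u y + v y) x * phi x) =
    \int[mu]_(x in O) ((k * D2 u x + D2 v x) * phi x).
  apply: I_eq => //; [by case: (aebM b2 bp)|by case: (aebM bl bp)|].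
  by apply: ae_on_imp E2 => x _ ->.
rewrite (eq_Rintegral mu (g := fun x => k * ((D1 u) x * (D1 phi) x) + (D1 v) x * (D1 phi) x)); last first.
  by move=> x; rewrite inE => Ox; rewrite E1// mulrDl mulrA.
rewrite I_D//; [|exact/aebZ/aebM|exact: aebM].
rewrite I_Z//; last exact: aebM.
rewrite uw// vw//.
under [in RHS]eq_Rintegral do rewrite mulrDl -mulrA.
rewrite I_D//; [|exact/aebZ/aebM|exact: aebM].
rewrite I_Z//; last exact: aebM.
have alg (A B : R) : k * - A - B = - (k * A + B) by ring.
exact: alg.
Qed.

End W2_interval.

(** * Moments of the second derivative and boundary traces *)

Section moments.
Variable R : realType.
Local Notation mu := (@lebesgue_measure R).
Variables c d : R.
Local Notation O := (`]c, d[%classic : set R).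
Implicit Types (f u v phi : R -> R).

Let oO : open O. Proof. exact: interval_open. Qed.
Let mO : measurable O. Proof. by []. Qed.
Let fO : (mu O < +oo)%E. Proof. exact: itv_fin. Qed.

(** The product [u * phi] extended by zero is [C^1] on the whole line, because [phi] vanishes near
    the ends, so its derivative has integral zero. *)
Lemma C1_weak_derivative u phi : C1_on O u -> aeb O u -> aeb O (D1 u) ->
  test_function O phi ->
  \int[mu]_(x in O) (u x * D1 phi x) = - \int[mu]_(x in O) (D1 u x * phi x).
Proof.
move=> hu bu bu' tphi.
have [cd|dc] := leP c d; last first.
  have -> : O = set0 by rewrite set_itv_ge// bnd_simp -leNgt ltW.
  by rewrite !Rintegral_set0 oppr0.
have [K [cK KO phi0 dphi0]] := test_function_out tphi.
have [bp bp'] := test_function_aeb c d tphi.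
have hphi := tphi.1.
pose W := (fun x => u x * phi x) \_ O.
pose W' := (fun x => u x * D1 phi x + phi x * D1 u x) \_ O.
have oK : open (~` K) by exact: closed_openC.
have WO x : O x -> W x = u x * phi x by move=> Ox; rewrite /W patchE mem_set.
have W'O x : O x -> W' x = u x * D1 phi x + phi x * D1 u x.
  by move=> Ox; rewrite /W' patchE mem_set.
have WK x : ~ K x -> W x = 0.
  by move=> Kx; rewrite /W patchE; case: ifP => // _; rewrite phi0// mulr0.
have W'K x : ~ K x -> W' x = 0.
  by move=> Kx; rewrite /W' patchE; case: ifP => // _; rewrite phi0// dphi0// mulr0 mul0r addr0.
have dW x : is_derive x (1:R) W (W' x).
  have [Ox|nOx] := pselect (O x).
    apply: (@eq_on_is_derive _ O (fun x => u x * phi x) _ _ _ oO Ox).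
      by move=> y Oy; rewrite WO.
    rewrite W'O//; have d1 := C1_on_is_derive hu Ox; have d2 := C1_on_is_derive hphi (I : setT x).
    exact: is_deriveM.
  have nKx : (~` K) x by move=> /KO.
  apply: (@eq_on_is_derive _ (~` K) (fun=> 0) _ _ _ oK nKx).
    by move=> y nKy; rewrite WK.
  by rewrite W'K//; exact: is_derive_cst.
have cW' : continuous W'.
  move=> x; have [Ox|nOx] := pselect (O x).
    have : (fun x => u x * D1 phi x + phi x * D1 u x) y @[y --> x] --> u x * D1 phi x + phi x * D1 u x.
      apply: cvgD; apply: cvgM.
      - exact: (C1_on_continuous hu).
      - by case: (hphi x I).
      - exact: (C1_on_continuous hphi).
      - by case: (hu x Ox).
    rewrite /continuous_at W'O//; apply: cvg_trans; apply: near_eq_cvg.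
    by apply: filterS (open_near oO Ox) => y Oy; rewrite W'O.
  have nKx : (~` K) x by move=> /KO.
  rewrite /continuous_at W'K//.
  have : (fun=> 0 : R) y @[y --> x] --> (0 : R) by exact: cvg_cst.
  apply: cvg_trans; apply: near_eq_cvg.
  by apply: filterS (open_near oK nKx) => y nKy; rewrite W'K.
have cO : ~ O c by rewrite /= in_itv /= ltxx.
have dO : ~ O d by rewrite /= in_itv /= ltxx andbF.
have := FTC2_segment cd dW cW'.
rewrite !WK; [|by move=> /KO|by move=> /KO].
rewrite subrr => E0.
have : \int[mu]_(x in O) (u x * D1 phi x + phi x * D1 u x) = 0.
  rewrite -E0 (Rintegral_mkcond mu `[c, d]) (Rintegral_mkcond mu O).
  apply: eq_Rintegral => x _; rewrite !patchE.
  case: ifPn => [xO|nxO].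
    have Ox : O x by rewrite inE in xO.
    rewrite W'O// mem_set//; move: Ox => /=; rewrite !in_itv /= => /andP[h1 h2].
    by rewrite !ltW.
  case: ifP => // _; rewrite /W' patchE (negbTE nxO).
  by [].
rewrite I_D//; [|exact: aebM|exact: aebM].
move/eqP; rewrite addr_eq0 => /eqP ->; congr (- _); apply: eq_Rintegral => x _.
by rewrite mulrC.
Qed.

(** Permits testing the weak equation of [D1 u] with [l * psi] in the moment identity. *)
Lemma test_function_affine_mul l1 l0 phi : test_function O phi ->
  test_function O (fun x => (l1 * x + l0) * phi x) /\
  forall x, D1 (fun x => (l1 * x + l0) * phi x) x = (l1 * x + l0) * D1 phi x + l1 * phi x.
Proof.
move=> [hphi [K [cK KO] phi0]].
have dl (x : R) : is_derive x (1 : R) (fun x : R => l1 * x + l0) l1.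
  apply: (is_derive_eq (is_deriveD (is_deriveZ l1 (is_derive_id x (1:R))) (is_derive_cst l0 x (1:R)))).
  by rewrite addr0 /GRing.scale /= mulr1.
have dd x : is_derive x (1:R) (fun x => (l1 * x + l0) * phi x) ((l1 * x + l0) * D1 phi x + l1 * phi x).
  have dp := C1_on_is_derive hphi (I : setT x).
  apply: (is_derive_eq (is_deriveM (dl x) dp)).
  by rewrite /GRing.scale /= [phi x * _]mulrC.
have cl : continuous (fun x : R => l1 * x + l0).
  by move=> x; exact: is_derive_continuous (dl x).
split; last by move=> x; exact: is_derive1E.
split; last by exists K => // x /phi0 ->; rewrite mulr0.
move=> x _; split; first by case: (dd x).
rewrite (_ : D1 _ = fun x => (l1 * x + l0) * D1 phi x + l1 * phi x); last first.
  by apply/funext => y; exact: is_derive1E.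
apply: cvgD; apply: cvgM.
- exact: cl.
- by case: (hphi x I).
- exact: cvg_cst.
- exact: (C1_on_continuous hphi).
Qed.

Lemma affine_aeb l1 l0 : aeb O (fun x => l1 * x + l0).
Proof.
apply: continuous_aeb => x; apply: cvgD; last exact: cvg_cst.
by apply: cvgM; [exact: cvg_cst|exact: cvg_id].
Qed.

(** With [l = l1 * x + l0], the weak derivative of [l * D1 u - l1 * u] is [l * D2 u], as the terms
    [l1 * D1 u] cancel. *)
Lemma W2_moment u l1 l0 x y : W2 +oo%E O u -> c < x -> x <= y -> y < d ->
  ((l1 * y + l0) * D1 u y - l1 * u y) - ((l1 * x + l0) * D1 u x - l1 * u x) =
  \int[mu]_(s in `[x, y]) ((l1 * s + l0) * D2 u s).
Proof.
move=> /W2ooP[hu b0 b1 b2 hw] cx xy yd.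
have bl := affine_aeb l1 l0.
apply: (@weak_FTC _ c d (fun x => (l1 * x + l0) * D1 u x - l1 * u x)
  (fun s => (l1 * s + l0) * D2 u s)) => //; [|by apply: aebB; [exact: aebM|exact: aebZ]|exact: aebM|].
- move=> z cz; have Oz : O z by rewrite /= in_itv.
  apply: cvgB; apply: cvgM; [|by case: (hu z Oz)|exact: cvg_cst|exact: (C1_on_continuous hu)].
  by apply: cvgD; [apply: cvgM; [exact: cvg_cst|exact: cvg_id]|exact: cvg_cst].
move=> psi tpsi; have [bp bp'] := test_function_aeb c d tpsi.
have [tl dl] := test_function_affine_mul l1 l0 tpsi.
have E1 := hw _ tl.
have E2 := C1_weak_derivative hu b0 b1 tpsi.
have [_ blp'] := test_function_aeb c d tl.
have blpsi : aeb O (fun x => (l1 * x + l0) * D1 psi x + l1 * psi x).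
  by apply: aebD; [exact: aebM|exact: aebZ].
transitivity (\int[mu]_(x in O) (D1 u x * D1 (fun x => (l1 * x + l0) * psi x) x -
   l1 * (D1 u x * psi x + u x * D1 psi x))).
  by apply: eq_Rintegral => s _; rewrite dl; ring.
rewrite I_B//; [|exact: aebM|by apply/aebZ/aebD; exact: aebM].
rewrite I_Z//; last by apply/aebD; exact: aebM.
rewrite I_D//; [|exact: aebM|exact: aebM].
rewrite E1 E2 subrr mulr0 subr0; congr (- _).
by apply: eq_Rintegral => s _; ring.
Qed.

(** Lipschitz bounds give one-sided limits at the endpoints by the Cauchy criterion. [D1 u] is
    bounded starting from its value at the midpoint, and [u] is then controlled by the mean value
    theorem. *)
Lemma W2_lipschitz u : W2 +oo%E O u -> exists K : R, [/\ 0 <= K,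
  forall x y, c < x -> x <= y -> y < d -> `|D1 u y - D1 u x| <= K * (y - x) &
  forall x y, c < x -> x <= y -> y < d -> `|u y - u x| <= K * (y - x)].
Proof.
move=> Wu; have /W2ooP[hu b0 b1 [m2 [K hK]] hw] := Wu.
have L x y : c < x -> x <= y -> y < d -> `|D1 u y - D1 u x| <= `|K| * (y - x).
  move=> cx xy yd; rewrite (W2_FTC Wu cx xy yd) -(fine_itvcc xy).
  have sub := subset_cc_oo cx yd.
  apply: I_norm_le => //; first exact: itvcc_fin.
    by apply: aeb_sub sub _ => //; split => //; exists K.
  by apply: ae_on_imp (ae_on_sub sub hK) => s _ h; rewrite (le_trans h) ?ler_norm.
have [cd|dc] := ltP c d; last first.
  by exists 0; split => // x y cx xy yd; move: cx xy yd dc; clear; lra.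
pose m := (c + d) / 2.
have [cm md] : c < m /\ m < d by rewrite /m; split; lra.
pose M := `|D1 u m| + `|K| * (d - c).
have B x : c < x -> x < d -> `|D1 u x| <= M.
  move=> cx xd; rewrite -[D1 u x](subrK (D1 u m)) addrC (le_trans (ler_normD _ _))// lerD2l.
  have [xm|mx] := leP x m.
    by rewrite distrC (le_trans (L _ _ cx xm md))// ler_wpM2l//; lra.
  by rewrite (le_trans (L _ _ cm (ltW mx) xd))// ler_wpM2l//; lra.
have M0 : 0 <= M by rewrite addr_ge0// mulr_ge0// subr_ge0 ltW.
exists (`|K| + M); split; first by rewrite addr_ge0.
  by move=> x y cx xy yd; rewrite (le_trans (L _ _ cx xy yd))// ler_wpM2r ?subr_ge0// lerDl.
move=> x y cx xy yd.
have d1 z : z \in `]x, y[%R -> is_derive z 1 u (D1 u z).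
  rewrite in_itv /= => /andP[xz zy]; apply: (C1_on_is_derive hu).
  by rewrite /= in_itv /= (lt_trans cx xz) (lt_trans zy yd).
have d2 : {within `[x, y], continuous u}.
  apply: continuous_in_subspaceT => z; rewrite inE /= in_itv /= => /andP[xz zy].
  apply: (C1_on_continuous hu).
  by rewrite /= in_itv /= (lt_le_trans cx xz) (le_lt_trans zy yd).
have [z zxy ->] := MVT_segment xy d1 d2.
move: zxy; rewrite in_itv /= => /andP[xz zy].
rewrite normrM (@ger0_norm _ (y - x)) ?subr_ge0//; apply: ler_wpM2r; first by rewrite subr_ge0.
by rewrite (le_trans (B z _ _)) ?lerDr//; [exact: lt_le_trans xz|exact: le_lt_trans yd].
Qed.

Lemma lipschitz_cvg_right f (K : R) : c < d -> 0 <= K ->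
  (forall x y, c < x -> x <= y -> y < d -> `|f y - f x| <= K * (y - x)) ->
  exists A : R, f x @[x --> c^'+] --> A.
Proof.
move=> cd K0 hf; suff /cvg_ex[A hA] : cvg (f x @[x --> c^'+]) by exists A.
apply: cauchy_cvg; apply: cauchy_exP => e e0.
pose r := Num.min ((d - c) / 2) (e / (K + 1)).
have K1 : 0 < K + 1 by rewrite ltr_wpDl.
have r0 : 0 < r by rewrite lt_min !divr_gt0// subr_gt0.
have r1 : r <= (d - c) / 2 by rewrite ge_min lexx.
have r2 : r * (K + 1) <= e by rewrite -ler_pdivlMr// ge_min lexx orbT.
exists (f (c + r)); change (\forall x \near c^'+, ball (f (c + r)) e (f x)); near=> x.
have cx : c < x by near: x; exact: nbhs_right_gt.
have xr : x < c + r by near: x; apply: nbhs_right_lt; rewrite ltrDl.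
have := hf x (c + r) cx (ltW xr) _; rewrite /ball /=.
have -> : c + r < d by move: r1 cd; clear; lra.
move=> /(_ isT) h; apply: (le_lt_trans h).
have t1 : K * (c + r - x) <= K * r by rewrite ler_wpM2l//; lra.
by rewrite (le_lt_trans t1)//; lra.
Unshelve. all: by end_near. Qed.

Lemma lipschitz_cvg_left f (K : R) : c < d -> 0 <= K ->
  (forall x y, c < x -> x <= y -> y < d -> `|f y - f x| <= K * (y - x)) ->
  exists A : R, f x @[x --> d^'-] --> A.
Proof.
move=> cd K0 hf; suff /cvg_ex[A hA] : cvg (f x @[x --> d^'-]) by exists A.
apply: cauchy_cvg; apply: cauchy_exP => e e0.
pose r := Num.min ((d - c) / 2) (e / (K + 1)).
have K1 : 0 < K + 1 by rewrite ltr_wpDl.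
have r0 : 0 < r by rewrite lt_min !divr_gt0// subr_gt0.
have r1 : r <= (d - c) / 2 by rewrite ge_min lexx.
have r2 : r * (K + 1) <= e by rewrite -ler_pdivlMr// ge_min lexx orbT.
exists (f (d - r)); change (\forall x \near d^'-, ball (f (d - r)) e (f x)); near=> x.
have cx : x < d by near: x; exact: nbhs_left_lt.
have xr : d - r < x by near: x; apply: nbhs_left_gt; rewrite gtrBl.
have := hf (d - r) x _ (ltW xr) cx; rewrite /ball /= distrC.
have -> : c < d - r by move: r1 cd; clear; lra.
move=> /(_ isT) h; apply: (le_lt_trans h).
have t1 : K * (x - (d - r)) <= K * r by rewrite ler_wpM2l//; lra.
by rewrite (le_lt_trans t1)//; lra.
Unshelve. all: by end_near. Qed.

(** Traces are one-sided limits, since a representative carries no information at or beyond [c] and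
    [d]. *)
Definition boundary_values u (A A' B B' : R) :=
  [/\ u x @[x --> c^'+] --> A, D1 u x @[x --> c^'+] --> A',
      u x @[x --> d^'-] --> B & D1 u x @[x --> d^'-] --> B'].

Lemma W2_boundary_values u : c < d -> W2 +oo%E O u ->
  exists A A' B B' : R, boundary_values u A A' B B'.
Proof.
move=> cd /W2_lipschitz[K [K0 h1 h0]].
have [A hA] := lipschitz_cvg_right cd K0 h0.
have [A' hA'] := lipschitz_cvg_right cd K0 h1.
have [B hB] := lipschitz_cvg_left cd K0 h0.
have [B' hB'] := lipschitz_cvg_left cd K0 h1.
by exists A, A', B, B'.
Qed.

(** Turns boundary data into integrals of [D2 u] against affine functions; zero data give the
    orthogonality on which the minimality arguments rest. *)
Lemma W2_moment_total u l1 l0 A A' B B' : c < d -> W2 +oo%E O u ->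
  boundary_values u A A' B B' ->
  ((l1 * d + l0) * B' - l1 * B) - ((l1 * c + l0) * A' - l1 * A) =
  \int[mu]_(s in O) ((l1 * s + l0) * D2 u s).
Proof.
move=> cd Wu [hA hA' hB hB'].
have /W2ooP[_ _ _ b2 _] := Wu.
pose w s := (l1 * s + l0) * D2 u s.
have bw : aeb O w by apply: aebM => //; exact: affine_aeb.
have [mw [K0 hK0]] := bw; pose K := `|K0|.
have hK : ae_on O (fun x => `|w x| <= K).
  by apply: ae_on_imp hK0 => s _ h; rewrite (le_trans h) ?ler_norm.
pose G x := (l1 * x + l0) * D1 u x - l1 * u x.
have hGc : G x @[x --> c^'+] --> (l1 * c + l0) * A' - l1 * A.
  apply: cvgB; apply: cvgM => //; [|exact: cvg_cst].
  apply: cvgD; last exact: cvg_cst.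
  by apply: cvgM; [exact: cvg_cst|apply: cvg_at_right_filter; exact: cvg_id].
have hGd : G x @[x --> d^'-] --> (l1 * d + l0) * B' - l1 * B.
  apply: cvgB; apply: cvgM => //; [|exact: cvg_cst].
  apply: cvgD; last exact: cvg_cst.
  by apply: cvgM; [exact: cvg_cst|apply: cvg_at_left_filter; exact: cvg_id].
set Gc := (X in _ - X); set Gd := (X in X - _).
apply/eqP; rewrite -subr_eq0 -normr_le0; apply/ler_addgt0Pr => e e0; rewrite add0r.
have K00 : 0 <= K by rewrite normr_ge0.
have K10 : 0 < K + 1 by rewrite ltr_wpDl.
(* The two end pieces, of total length at most [2 * r], contribute at most [e / 2]; the values of
   [G] at either end contribute [e / 4] each. *)
pose r := Num.min (e / 4 / (K + 1)) ((d - c) / 2).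
have r0 : 0 < r by rewrite lt_min !divr_gt0// subr_gt0.
have r1 : r <= (d - c) / 2 by rewrite ge_min lexx orbT.
have r2 : r * (K + 1) <= e / 4 by rewrite -ler_pdivlMr// ge_min lexx.
have e4 : 0 < e / 4 by rewrite divr_gt0.
have [x [cx xr Gx]] : exists x, [/\ c < x, x < c + r & `|Gc - G x| < e / 4].
  apply: (@filter_ex _ (c^'+)); near=> x; split.
  - by near: x; exact: nbhs_right_gt.
  - by near: x; apply: nbhs_right_lt; rewrite ltrDl.
  - by near: x; move/cvgrPdist_lt: hGc; exact.
have [y [yd yr Gy]] : exists y, [/\ y < d, d - r < y & `|Gd - G y| < e / 4].
  apply: (@filter_ex _ (d^'-)); near=> y; split.
  - by near: y; exact: nbhs_left_lt.
  - by near: y; apply: nbhs_left_gt; rewrite gtrBl.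
  - by near: y; move/cvgrPdist_lt: hGd; exact.
have xy : x <= y by move: r1 xr yr; clear; lra.
have E := W2_moment l1 l0 Wu cx xy yd.
have sub := subset_cc_oo cx yd.
have D : `|\int[mu]_(s in O) w s - \int[mu]_(s in `[x, y]) w s| <= K * ((d - c) - (y - x)).
  have bi : aeb O (\1_`[x, y] : R -> R) by exact: aeb_indic.
  rewrite (I_restrict _ sub) -I_B//; [|exact: aebM].
  have -> : K * (d - c - (y - x)) = \int[mu]_(s in O) (K * (1 - \1_`[x, y] s)).
    rewrite I_Z//; last by apply: aebB => //; exact: aeb_cst.
    rewrite I_B//; last exact: aeb_cst.
    by rewrite Rintegral_cst// I_indic// fine_itv ?ltW// fine_itvcc// mul1r.
  apply: le_trans (I_norm _ _ _) _ => //; first by apply: aebB => //; exact: aebM.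
  apply: I_le => //.
  - by apply/aeb_norm/aebB => //; exact: aebM.
  - by apply: aebZ; apply: aebB => //; exact: aeb_cst.
  apply: ae_on_imp hK => s _ h.
  rewrite -[X in X - _]mulr1 -mulrBr normrM ler_pM// indic_cc.
  by case: ifP => _; rewrite ?subrr ?subr0 ?normr0 ?normr1.
move: E D; rewrite -/(w _) -/(G x) -/(G y).
rewrite (_ : \int[mu]_(s in `[x, y]) ((l1 * s + l0) * D2 u s) = \int[mu]_(s in `[x, y]) w s)//.
rewrite (_ : \int[mu]_(s in O) ((l1 * s + l0) * D2 u s) = \int[mu]_(s in O) w s)//.
move=> <-; move: (\int[mu]_(s in O) w s) => I.
have KK : K * (d - c - (y - x)) <= e / 2.
  have : d - c - (y - x) <= 2 * r by move: xr yr; clear; lra.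
  by move: r2 r0 K00; clear; nra.
move=> D; move: (le_trans D KK) Gx Gy.
rewrite ler_norml => /andP[? ?]; rewrite ltr_norml => /andP[? ?].
rewrite ltr_norml => /andP[? ?]; rewrite ler_norml.
by apply/andP; split; lra.
Unshelve. all: by end_near. Qed.

End moments.

(** * Zero boundary values and orthogonality to affine functions *)

Section boundary.
Variable R : realType.
Local Notation mu := (@lebesgue_measure R).
Implicit Types (f u v phi : R -> R) (c d : R).

Lemma near_right_itv c d : c < d -> \forall x \near c^'+, `]c, d[%classic x.
Proof.
move=> cd; near=> x; rewrite /= in_itv /=; apply/andP; split.
  by near: x; exact: nbhs_right_gt.
by near: x; exact: nbhs_right_lt.
Unshelve. all: by end_near. Qed.

Lemma near_left_itv c d : c < d -> \forall x \near d^'-, `]c, d[%classic x.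
Proof.
move=> cd; near=> x; rewrite /= in_itv /=; apply/andP; split.
  by near: x; exact: nbhs_left_gt.
by near: x; exact: nbhs_left_lt.
Unshelve. all: by end_near. Qed.

Lemma cvg_within_left_end c d f (l : R) : c < d ->
  f y @[y --> within `]c, d[ (nbhs c)] --> l <-> f y @[y --> c^'+] --> l.
Proof.
move=> cd; have E (A : set R) : within `]c, d[ (nbhs c) A <-> (c^'+) A.
  split=> h; rewrite /at_right /within /= in h *.
    have hd : \forall y \near c, y < d by exact: lt_nbhsl.
    by apply: filterS2 h hd => y /= h yd cy; apply: h; rewrite in_itv /= cy yd.
  by apply: filterS h => y /= h; rewrite in_itv /= => /andP[/h].
by split=> h A /h /E.
Qed.

Lemma cvg_within_right_end c d f (l : R) : c < d ->
  f y @[y --> within `]c, d[ (nbhs d)] --> l <-> f y @[y --> d^'-] --> l.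
Proof.
move=> cd; have E (A : set R) : within `]c, d[ (nbhs d) A <-> (d^'-) A.
  split=> h; rewrite /at_left /within /= in h *.
    have hd : \forall y \near d, c < y by exact: lt_nbhsr.
    by apply: filterS2 h hd => y /= h yd cy; apply: h; rewrite in_itv /= cy yd.
  by apply: filterS h => y /= h; rewrite in_itv /= => /andP[_ /h].
by split=> h A /h /E.
Qed.

Lemma closure_oo c d : c < d -> closure `]c, d[%classic = `[c, d]%classic.
Proof.
move=> cd; apply/seteqP; split.
  exact: itv_closure.
move=> x /=; rewrite in_itv /= => /andP[cx xd] A nA.
have [e /= e0 eA] := nA.
pose l := Num.max c (x - e / 2); pose r := Num.min d (x + e / 2).
have e2 : 0 < e / 2 by rewrite divr_gt0.
have [l1 l2] : c <= l /\ x - e / 2 <= l by rewrite !le_max !lexx orbT.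
have [r1 r2] : r <= d /\ r <= x + e / 2 by rewrite !ge_min !lexx orbT.
have lr : l < r.
  by rewrite lt_min !gt_max; apply/andP; split; apply/andP; split; lra.
exists ((l + r) / 2); split; first by rewrite /= in_itv /=; apply/andP; split; lra.
by apply: eA => /=; rewrite ltr_norml; lra.
Qed.

Lemma boundary_oo c d : c < d -> closure `]c, d[%classic `\` `]c, d[%classic° = [set c; d].
Proof.
move=> cd; rewrite closure_oo//.
have -> : `]c, d[%classic° = `]c, d[%classic.
  by apply/interior_id; exact: interval_open.
apply/seteqP; split => x /=; rewrite !in_itv /=.
  by move=> [/andP[cx xd] /negP]; rewrite negb_and -!leNgt => /orP[h|h]; [left|right]; lra.
by move=> [->|->]; split; rewrite ?lexx ?ltxx ?andbF ?ltW.
Qed.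

Lemma W2oo0P c d phi : c < d -> W2oo0 `]c, d[ phi <->
  W2 +oo%E `]c, d[ phi /\ boundary_values c d phi 0 0 0 0.
Proof.
move=> cd; split=> -[W h]; split => //.
  have bc : (closure `]c, d[%classic `\` `]c, d[%classic°) c by rewrite boundary_oo//=; left.
  have bd : (closure `]c, d[%classic `\` `]c, d[%classic°) d by rewrite boundary_oo//=; right.
  have [hc1 hc2] := h c bc; have [hd1 hd2] := h d bd.
  by split; [exact/(cvg_within_left_end _ _ cd)|exact/(cvg_within_left_end _ _ cd)|
     exact/(cvg_within_right_end _ _ cd)|exact/(cvg_within_right_end _ _ cd)].
case: h => h1 h2 h3 h4 x; rewrite boundary_oo//= => -[->|->].
  by split; exact/(cvg_within_left_end _ _ cd).
by split; exact/(cvg_within_right_end _ _ cd).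
Qed.

(** [c] and [d] lie outside the open set [O] but in its closure, so they are boundary points of [O],
    where [phi] has zero trace. This reduces minimality on open sets to intervals. *)
Lemma W2oo0_component (O : set R) c d phi : open O -> c < d -> `]c, d[ `<=` O ->
  ~ O c -> ~ O d -> W2oo0 O phi -> W2oo0 `]c, d[ phi.
Proof.
move=> oO cd sub nOc nOd [W h].
have clO x : `[c, d]%classic x -> closure O x.
  by rewrite -closure_oo// => /(closureS sub).
have iO : O° = O by apply/interior_id.
split.
  by apply: (@W2oo_sub _ O) => //; exact: itv_fin.
move=> x; rewrite boundary_oo//= => hx.
have bx : (closure O `\` O°) x.
  rewrite iO; split; first by apply: clO; case: hx => -> /=; rewrite in_itv /= lexx ltW.
  by case: hx => ->.
have [h1 h2] := h x bx.
have wi : within `]c, d[ (nbhs x) `=>` within O (nbhs x).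
  by move=> A; rewrite /within /=; apply: filterS => y /= hA /sub.
by split; [apply: cvg_trans h1|apply: cvg_trans h2] => A /wi.
Qed.

Lemma boundary_values_lin c d k u v A A' B B' C C' D D' : c < d ->
  C1_on `]c, d[ u -> C1_on `]c, d[ v ->
  boundary_values c d u A A' B B' -> boundary_values c d v C C' D D' ->
  boundary_values c d (fun x => k * u x + v x)
    (k * A + C) (k * A' + C') (k * B + D) (k * B' + D').
Proof.
move=> cd hu hv [u1 u2 u3 u4] [v1 v2 v3 v4].
have E x : `]c, d[%classic x -> k * D1 u x + D1 v x = D1 (fun x => k * u x + v x) x.
  by move=> Ox; rewrite (is_derive1E (derive_lin k hu hv Ox)).
split.
- by apply: cvgD => //; apply: cvgM => //; exact: cvg_cst.
- have : k * D1 u x + D1 v x @[x --> c^'+] --> k * A' + C'.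
    by apply: cvgD => //; apply: cvgM => //; exact: cvg_cst.
  apply: cvg_trans; apply: near_eq_cvg.
  by apply: filterS (near_right_itv cd) => x /E.
- by apply: cvgD => //; apply: cvgM => //; exact: cvg_cst.
- have : k * D1 u x + D1 v x @[x --> d^'-] --> k * B' + D'.
    by apply: cvgD => //; apply: cvgM => //; exact: cvg_cst.
  apply: cvg_trans; apply: near_eq_cvg.
  by apply: filterS (near_left_itv cd) => x /E.
Qed.

Lemma W2_D2_eq0 c d phi : c < d -> W2 +oo%E `]c, d[ phi ->
  phi x @[x --> c^'+] --> (0 : R) -> D1 phi x @[x --> c^'+] --> (0 : R) ->
  ae_on `]c, d[ (fun x => D2 phi x = 0) -> forall x, `]c, d[%classic x -> phi x = 0.
Proof.
move=> cd W b1 b2 h.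
have /W2ooP[hC _ _ a2 _] := W.
have d1_eq x y : c < x -> x <= y -> y < d -> D1 phi y = D1 phi x.
  move=> cx xy yd; apply/eqP; rewrite -subr_eq0 (W2_FTC W cx xy yd).
  have sub := subset_cc_oo cx yd.
  have mO : measurable (`]c, d[%classic : set R) by [].
  have a3 : aeb `[x, y] (D2 phi) by exact: aeb_sub sub a2.
  rewrite (@I_eq _ _ _ (D2 phi) (fun=> 0))//; last first.
  - exact: ae_on_sub h.
  - by case: a3.
  by rewrite Rintegral_cst// mul0r.
have d1_0 x : `]c, d[%classic x -> D1 phi x = 0.
  rewrite /= in_itv /= => /andP[cx xd].
  have : D1 phi y @[y --> c^'+] --> D1 phi x.
    have : (fun=> D1 phi x) y @[y --> c^'+] --> D1 phi x by exact: cvg_cst.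
    apply: cvg_trans; apply: near_eq_cvg; apply: filterS (near_right_itv cx) => y.
    by rewrite /= in_itv /= => /andP[cy yx]; rewrite (d1_eq y x)// ltW.
  by move=> /cvg_unique; apply.
have d0_eq x y : c < x -> x <= y -> y < d -> phi y = phi x.
  move=> cx xy yd; apply/eqP; rewrite -subr_eq0.
  have e1 z : z \in `]x, y[%R -> is_derive z 1 phi (D1 phi z).
    rewrite in_itv /= => /andP[xz zy]; apply: (C1_on_is_derive hC).
    by rewrite /= in_itv /= (lt_trans cx xz) (lt_trans zy yd).
  have e2 : {within `[x, y], continuous phi}.
    apply: continuous_in_subspaceT => z; rewrite inE /= in_itv /= => /andP[xz zy].
    apply: (C1_on_continuous hC).
    by rewrite /= in_itv /= (lt_le_trans cx xz) (le_lt_trans zy yd).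
  have [z] := MVT_segment xy e1 e2; rewrite in_itv /= => /andP[xz zy] ->.
  by rewrite d1_0 ?mul0r//= in_itv /= (lt_le_trans cx xz) (le_lt_trans zy yd).
move=> x; rewrite /= in_itv /= => /andP[cx xd].
have : phi y @[y --> c^'+] --> phi x.
  have : (fun=> phi x) y @[y --> c^'+] --> phi x by exact: cvg_cst.
  apply: cvg_trans; apply: near_eq_cvg; apply: filterS (near_right_itv cx) => y.
  by rewrite /= in_itv /= => /andP[cy yx]; rewrite (d0_eq y x)// ltW.
by move=> /cvg_unique; apply.
Qed.

Lemma W2oo0_moment c d phi l1 l0 : c < d -> W2oo0 `]c, d[ phi ->
  \int[mu]_(s in `]c, d[) ((l1 * s + l0) * D2 phi s) = 0.
Proof.
move=> cd /(W2oo0P _ cd)[W bv]; rewrite -(W2_moment_total l1 l0 cd W bv).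
by rewrite !mulr0 !subrr.
Qed.

(* [D2 phi] is orthogonal to affine functions, so the integrand, being of
   constant sign with zero integral, vanishes a.e. *)
Lemma W2oo0_sign c d phi l1 l0 : c < d -> W2oo0 `]c, d[ phi ->
  (l1 != 0) || (l0 != 0) ->
  ae_on `]c, d[ (fun x => (l1 * x + l0) * D2 phi x <= 0) ->
  forall x, `]c, d[%classic x -> phi x = 0.
Proof.
move=> cd W0 l hs; have /(W2oo0P _ cd)[W [b1 b2 _ _]] := W0.
apply: W2_D2_eq0 => //; have /W2ooP[_ _ _ a2 _] := W.
pose w s := (l1 * s + l0) * D2 phi s.
have bw : aeb `]c, d[ w by apply: aebM => //; exact: affine_aeb.
have bnw := aeb_norm bw.
have mO : measurable (`]c, d[%classic : set R) by [].
have E : \int[mu]_(x in `]c, d[) `|w x| = 0.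
  have <- : - (\int[mu]_(x in `]c, d[) w x) = 0.
    by rewrite -[RHS]oppr0; congr (- _); exact: W2oo0_moment.
  rewrite -(I_N mO (itv_fin c d) bw); apply: I_eq => //; [by case: bnw|by case: (aebN bw)|].
  by apply: ae_on_imp hs => x _ h; rewrite ler0_norm.
have := I_eq0 mO (itv_fin c d) bnw (fun _ _ => normr_ge0 _).
rewrite E => /(_ (lexx 0)) w0.
(* The only possible zero of the affine factor. For [l1 = 0] the quotient is 0 by convention, and
   excluding that point is harmless. *)
have nz := @ae_on_neq R `]c, d[ (- l0 / l1).
apply: ae_on_imp2 w0 nz => x _ /normr0_eq0/eqP; rewrite mulf_eq0 => /orP[/eqP e|/eqP//].
move=> /eqP; case: (eqVneq l1 0) l e => [-> /= l0n|l1n _ e xn].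
  by rewrite mul0r add0r => e; rewrite e eqxx in l0n.
exfalso; apply: xn; apply: (mulfI l1n); rewrite mulrCA divff// mulr1.
by apply/eqP; rewrite -addr_eq0 e.
Qed.

End boundary.

(** * Quadratic functions with one kink in the derivative *)

Section one_switch_function.
Variable R : realType.
Local Notation mu := (@lebesgue_measure R).
Implicit Types (A a p q xi x : R).

(* [A] and [A'] are the values of the function and of its derivative at [a]; the
   second derivative is [p] to the left of [xi] and [q] to its right. *)
Definition quad A (A' : R) a p q xi x : R :=
  A + A' * (x - a) + p / 2 * (x - a) ^+ 2 + (q - p) / 2 * pos (x - xi) ^+ 2.

Definition dquad (A' : R) a p q xi x : R := A' + p * (x - a) + (q - p) * pos (x - xi).

Lemma is_derive_sub a x : is_derive x (1:R) (fun y => y - a) 1.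
Proof.
apply: (is_derive_eq (is_deriveB (is_derive_id x (1:R)) (is_derive_cst a x (1:R)))).
by rewrite subr0.
Qed.

Lemma is_derive_quad A (A' : R) a p q xi x :
  is_derive x (1:R) (quad A A' a p q xi) (dquad A' a p q xi x).
Proof.
have d1 := is_derive_sub a x.
have d2 := is_derive_pos2_shift xi x.
have d3 := is_deriveX 2 d1.
have h := is_deriveD (is_deriveD (is_deriveD (is_derive_cst A x (1:R)) (is_deriveZ A' d1))
  (is_deriveZ (p / 2) d3)) (is_deriveZ ((q - p) / 2) d2).
apply: (is_derive_eq h).
by rewrite /dquad /GRing.scale /=; field.
Qed.

Lemma D1_quad A (A' : R) a p q xi : D1 (quad A A' a p q xi) = dquad A' a p q xi.
Proof. by apply/funext => x; apply: is_derive1E; exact: is_derive_quad. Qed.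

Lemma continuous_pos_shift xi : continuous (fun y : R => pos (y - xi)).
Proof.
move=> x; apply: (@cvg_comp _ _ _ (fun y => y - xi) (@pos R) _ (nbhs (x - xi))) => /=.
  by apply: cvgB; [exact: cvg_id|exact: cvg_cst].
exact: continuous_pos.
Qed.

Lemma continuous_dquad (A' : R) a p q xi : continuous (dquad A' a p q xi).
Proof.
move=> x; apply: cvgD.
  apply: cvgD; first exact: cvg_cst.
  by apply: cvgM; [exact: cvg_cst|apply: cvgB; [exact: cvg_id|exact: cvg_cst]].
by apply: cvgM; [exact: cvg_cst|exact: continuous_pos_shift].
Qed.

Lemma continuous_quad A (A' : R) a p q xi : continuous (quad A A' a p q xi).
Proof. by move=> x; exact: is_derive_continuous (is_derive_quad A A' a p q xi x). Qed.

Lemma is_derive_dquad_l (A' : R) a p q xi x : x < xi ->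
  is_derive x (1:R) (dquad A' a p q xi) p.
Proof.
move=> xxi.
apply: (@eq_on_is_derive _ `]-oo, xi[%classic (fun x => A' + p * (x - a))).
- exact: interval_open.
- by rewrite /= in_itv.
- move=> y /=; rewrite in_itv /= => yxi.
  by rewrite /dquad pos_le0 ?mulr0 ?addr0// subr_le0 ltW.
apply: (is_derive_eq (is_deriveD (is_derive_cst A' x (1:R)) (is_deriveZ p (is_derive_sub a x)))).
by rewrite add0r /GRing.scale /= mulr1.
Qed.

Lemma is_derive_dquad_r (A' : R) a p q xi x : xi < x ->
  is_derive x (1:R) (dquad A' a p q xi) q.
Proof.
move=> xxi.
apply: (@eq_on_is_derive _ `]xi, +oo[%classic (fun x => A' + p * (x - a) + (q - p) * (x - xi))).
- exact: interval_open.
- by rewrite /= in_itv /= andbT.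
- move=> y /=; rewrite in_itv /= andbT => yxi.
  by rewrite /dquad pos_ge0// subr_ge0 ltW.
apply: (is_derive_eq (is_deriveD (is_deriveD (is_derive_cst A' x (1:R))
  (is_deriveZ p (is_derive_sub a x))) (is_deriveZ (q - p) (is_derive_sub xi x)))).
by rewrite add0r /GRing.scale /= !mulr1 addrC subrK.
Qed.

Lemma is_derive_dquad_eq (A' : R) a p xi x : is_derive x (1:R) (dquad A' a p p xi) p.
Proof.
(* With equal phases the position of the switch is immaterial, so it is moved to the right of
   [x]. *)
have -> : dquad A' a p p xi = dquad A' a p p (x + 1).
  by apply/funext => y; rewrite /dquad subrr !mul0r.
by apply: is_derive_dquad_l; rewrite ltrDl.
Qed.

(** Subtracting the affine part leaves [(q - p) * pos (y - xi)], whose quotients at [xi] tend to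
    [q - p] from the right and to 0 from the left. *)
Lemma dquad_not_derivable (A' : R) a p q xi : p != q -> ~ derivable (dquad A' a p q xi) xi 1.
Proof.
move=> pq dd; pose l := derive (dquad A' a p q xi) xi (1 : R).
have h : is_derive xi (1 : R) (dquad A' a p q xi) l by exact: derivableP.
have dq := is_deriveB h (is_derive_dquad_eq A' a p xi xi).
have E : dquad A' a p q xi - dquad A' a p p xi = fun y => (q - p) * pos (y - xi).
  apply/funext => y; change (dquad A' a p q xi y - dquad A' a p p xi y = (q - p) * pos (y - xi)).
  by rewrite /dquad; ring.
have := dq; rewrite E => -[dv dl].
have cv : (fun h : R => h^-1 * ((q - p) * pos h)) @ 0^' --> l - p.
  move: dv; rewrite /derivable => dv; rewrite -dl /derive.
  move: dv; set g := fun h => _; set g' := fun h => _.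
  suff -> : g = g' by [].
  apply/funext => k; rewrite /g /g' /= [k *: 1]mulr1 addrK subrr (pos_ge0 (lexx 0)) mulr0 subr0.
  by [].
have c1 : (fun h : R => h^-1 * ((q - p) * pos h)) @ 0^'+ --> l - p.
  apply: (cvg_trans (cvg_app _ _)) cv => B hB.
  have {}hB : \forall y \near (0 : R), y != 0 -> B y by exact: hB.
  change (\forall y \near (0 : R), 0 < y -> B y).
  by apply: filterS hB => y hy y0; apply: hy; rewrite gt_eqF.
have c2 : (fun h : R => h^-1 * ((q - p) * pos h)) @ 0^'- --> l - p.
  apply: (cvg_trans (cvg_app _ _)) cv => B hB.
  have {}hB : \forall y \near (0 : R), y != 0 -> B y by exact: hB.
  change (\forall y \near (0 : R), y < 0 -> B y).
  by apply: filterS hB => y hy y0; apply: hy; rewrite lt_eqF.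
have e1 : l - p = q - p.
  have : (fun=> q - p) h @[h --> (0:R)^'+] --> q - p by exact: cvg_cst.
  move=> c3; apply: cvg_unique c1 _ => //.
  apply: cvg_trans c3; apply: near_eq_cvg; near=> y.
  have y0 : 0 < y by near: y; exact: nbhs_right_gt.
  by rewrite pos_ge0 ?ltW// mulrCA mulVf ?mulr1// gt_eqF.
have e2 : l - p = 0.
  have : (fun=> 0 : R) h @[h --> (0:R)^'-] --> (0 : R) by exact: cvg_cst.
  move=> c3; apply: cvg_unique c2 _ => //.
  apply: cvg_trans c3; apply: near_eq_cvg; near=> y.
  have y0 : y < 0 by near: y; exact: nbhs_left_lt.
  by rewrite pos_le0 ?ltW// !mulr0.
by move: pq; rewrite eq_sym -subr_eq0 -e1 e2 eqxx.
Unshelve. all: by end_near. Qed.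

Lemma D2_quad_l A (A' : R) a p q xi x : x < xi -> D2 (quad A A' a p q xi) x = p.
Proof.
by move=> h; rewrite /derive1n /= D1_quad; apply/is_derive1E/is_derive_dquad_l.
Qed.

Lemma D2_quad_r A (A' : R) a p q xi x : xi < x -> D2 (quad A A' a p q xi) x = q.
Proof.
by move=> h; rewrite /derive1n /= D1_quad; apply/is_derive1E/is_derive_dquad_r.
Qed.

Lemma D2_quad_eq A (A' : R) a p xi x : D2 (quad A A' a p p xi) x = p.
Proof.
by rewrite /derive1n /= D1_quad; apply/is_derive1E/is_derive_dquad_eq.
Qed.

Lemma D2_quad_ae (D : set R) A (A' : R) a p q xi :
  ae_on D (fun x => D2 (quad A A' a p q xi) x = p + (q - p) * \1_`[xi, +oo[ x).
Proof.
apply: ae_on_imp (ae_on_neq D xi) => x _ xn.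
have -> : \1_`[xi, +oo[ x = ((xi <= x)%R : bool)%:R :> R by rewrite indicE mem_setE in_itv /= andbT.
case: ltgtP xn => // h _.
  by rewrite D2_quad_r// mulr1 addrC subrK.
by rewrite D2_quad_l// mulr0 addr0.
Qed.

(** Integration by parts for [(x - xi) * phi] on [[xi, d]]: the first factor kills the boundary term
    at [xi], the second the one at [d]. *)
Lemma weak_derivative_pos c d xi phi : c < xi < d -> test_function `]c, d[ phi ->
  \int[mu]_(x in `]c, d[) (pos (x - xi) * D1 phi x) =
  - \int[mu]_(x in `]c, d[) (\1_`[xi, +oo[ x * phi x).
Proof.
move=> /andP[cxi xid] tphi.
have [K [cK KO phi0 dphi0]] := test_function_out tphi.
have dK : ~ K d by move=> /KO /=; rewrite in_itv /= ltxx andbF.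
have hphi := tphi.1.
have cphi : continuous phi by move=> x; exact: (C1_on_continuous hphi).
have cdphi : continuous (D1 phi) by move=> x; case: (hphi x I).
have dd x : is_derive x (1:R) (fun x => (x - xi) * phi x) ((x - xi) * D1 phi x + phi x).
  have d1 := is_deriveM (is_derive_sub xi x) (C1_on_is_derive hphi (I : setT x)).
  by apply: (is_derive_eq d1); rewrite /GRing.scale /= mulr1.
have ci : continuous (fun x => x - xi).
  by move=> x; apply: cvgB; [exact: cvg_id|exact: cvg_cst].
have cc : continuous (fun x => (x - xi) * D1 phi x + phi x).
  move=> x; apply: cvgD; last exact: cphi.
  by apply: cvgM; [exact: ci|exact: cdphi].
have := FTC2_segment (ltW xid) dd cc.
rewrite phi0// mulr0 subrr mul0r subrr.
have mI : measurable (`[xi, d]%classic : set R) by [].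
have fI := itvcc_fin xi d.
have bI (f : R -> R) : continuous f -> aeb `[xi, d] f.
  move=> cf; apply: (@aeb_sub _ `]c, (d + 1)[) => //; last exact: continuous_aeb.
  by apply: subset_cc_oo => //; rewrite ltrDl.
rewrite I_D//; [|by apply: bI => x; apply: cvgM; [exact: ci|exact: cdphi]|exact: bI].
move/eqP; rewrite addr_eq0 => /eqP E.
transitivity (\int[mu]_(x in `[xi, d]) ((x - xi) * D1 phi x)); last first.
  rewrite E; congr (- _); rewrite (Rintegral_mkcond mu `]c, d[) (Rintegral_mkcond mu `[xi, d]).
  apply: eq_Rintegral => x _; rewrite !patchE indicE !mem_setE !in_itv /= andbT.
  have [xxi|xxi] := leP xi x; last by rewrite mul0r; case: ifP.
  have [xd|xd|->] := ltgtP x d; rewrite ?andbF ?andbT /= ?mul1r.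
  - by rewrite (lt_le_trans cxi xxi).
  - by [].
  - by rewrite phi0.
rewrite (Rintegral_mkcond mu `]c, d[) (Rintegral_mkcond mu `[xi, d]).
apply: eq_Rintegral => x _; rewrite !patchE !mem_setE !in_itv /=.
have [xxi|xxi] := leP xi x; last by rewrite /= pos_le0 ?mul0r ?subr_le0 ?ltW//; case: ifP.
rewrite pos_ge0 ?subr_ge0// (lt_le_trans cxi xxi) /=.
by have [xd|xd|->] := ltgtP x d => //; rewrite dphi0// mulr0.
Qed.

(** The derivative is an affine function plus a multiple of [pos (x - xi)], each with a known weak
    derivative. *)
Lemma W2_quad c d A (A' : R) a p q xi : c < xi < d ->
  W2 +oo%E `]c, d[ (quad A A' a p q xi).
Proof.
move=> xi_in; have mO : measurable (`]c, d[%classic : set R) by [].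
have fO := itv_fin c d.
have b2 : aeb `]c, d[ (D2 (quad A A' a p q xi)).
  split.
    apply: measurable_derivative; first exact: interval_open.
    by move=> x _; rewrite /= D1_quad; exact: continuous_dquad.
  exists (`|p| + `|q - p|); apply: ae_on_imp (D2_quad_ae _ A A' a p q xi) => x _ ->.
  rewrite (le_trans (ler_normD _ _))// lerD2l normrM indicE.
  by case: (_ \in _); rewrite ?normr1 ?normr0 ?mulr1 ?mulr0.
have bq : aeb `]c, d[ (quad A A' a p q xi) by apply: continuous_aeb; exact: continuous_quad.
have bdq : aeb `]c, d[ (dquad A' a p q xi) by apply: continuous_aeb; exact: continuous_dquad.
apply/W2ooP; rewrite D1_quad; split; [|exact: bq|exact: bdq|exact: b2|].
  move=> x _; split; first by case: (is_derive_quad A A' a p q xi x).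
  by rewrite D1_quad; exact: continuous_dquad.
move=> phi tphi; have [bp bp'] := test_function_aeb c d tphi.
have bi : aeb `]c, d[ (\1_`[xi, +oo[ : R -> R) by exact: aeb_indic.
have bpos : aeb `]c, d[ (fun x : R => pos (x - xi)).
  by apply: continuous_aeb; exact: continuous_pos_shift.
have baff : aeb `]c, d[ (fun x => p * x + (A' - p * a)) by exact: affine_aeb.
have daff x : is_derive x (1:R) (fun x => p * x + (A' - p * a)) p.
  apply: (is_derive_eq (is_deriveD (is_deriveZ p (is_derive_id x (1:R))) (is_derive_cst (A' - p * a) x (1:R)))).
  by rewrite addr0 /GRing.scale /= mulr1.
have D1aff : D1 (fun x => p * x + (A' - p * a)) = fun=> p.
  by apply/funext => x; exact: is_derive1E.
have Caff : C1_on `]c, d[ (fun x => p * x + (A' - p * a)).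
  by move=> x _; split; [case: (daff x)|rewrite D1aff; exact: cvg_cst].
have bp0 : aeb `]c, d[ (fun=> p) by exact: aeb_cst.
have E1 := C1_weak_derivative Caff baff; rewrite D1aff in E1.
have {}E1 := E1 _ bp0 tphi.
have E2 := weak_derivative_pos xi_in tphi.
have -> : \int[mu]_(x in `]c, d[) (D2 (quad A A' a p q xi) x * phi x) =
    \int[mu]_(x in `]c, d[) (p * phi x + (q - p) * (\1_`[xi, +oo[ x * phi x)).
  have bb : aeb `]c, d[ (fun x => p * phi x + (q - p) * (\1_`[xi, +oo[ x * phi x)).
    by apply: aebD; [exact: aebM|apply: aebZ; exact: aebM].
  apply: I_eq => //; [by case: (aebM b2 bp)|by case: bb|].
  by apply: ae_on_imp (D2_quad_ae _ A A' a p q xi) => x _ ->; rewrite mulrDl mulrA.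
have -> : \int[mu]_(x in `]c, d[) (dquad A' a p q xi x * D1 phi x) =
    \int[mu]_(x in `]c, d[) ((p * x + (A' - p * a)) * D1 phi x + (q - p) * (pos (x - xi) * D1 phi x)).
  by apply: eq_Rintegral => x _; rewrite /dquad; ring.
rewrite I_D//; [|exact: aebM|by apply: aebZ; exact: aebM].
rewrite I_D//; [|exact: aebM|by apply: aebZ; exact: aebM].
rewrite (I_Z mO fO (q - p))//; last exact: aebM.
rewrite (I_Z mO fO (q - p))//; last exact: aebM.
by rewrite E1 E2 mulrN opprD.
Qed.

Lemma boundary_values_quad c d A (A' : R) a p q xi :
  boundary_values c d (quad A A' a p q xi) (quad A A' a p q xi c) (dquad A' a p q xi c)
    (quad A A' a p q xi d) (dquad A' a p q xi d).
Proof.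
rewrite /boundary_values D1_quad.
by split; [apply: cvg_at_right_filter|apply: cvg_at_right_filter|
  apply: cvg_at_left_filter|apply: cvg_at_left_filter];
  [exact: continuous_quad|exact: continuous_dquad|exact: continuous_quad|exact: continuous_dquad].
Qed.

End one_switch_function.

(** * Bang-bang profiles *)

Section level_convexity.
Variable R : realType.
Implicit Types (H T : R -> R).

(** The signs are weak so as to include the level 0 with [m = M = 0], which is the case of an affine
    minimiser. *)
Definition level_set H (t m M : R) :=
  [/\ 0 <= t, m <= 0, 0 <= M, H m = t & H M = t].

Section monotonicity.
Variable H : R -> R.
Hypotheses (H0 : H 0 = 0) (H_ge0 : forall X, H 0 <= H X)
  (H_slc : strictly_level_convex H).

(** Strict monotonicity is given on the open half-lines; the point [X / 2] links it to the minimum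
    at 0. *)
Lemma slc_gt0 X : X != 0 -> 0 < H X.
Proof.
case: H_slc => hd hi; have [X0|X0|->] := ltgtP X 0; rewrite ?eqxx// => _.
  have X2 : X / 2 < 0 by move: X0; lra.
  have XX2 : X < X / 2 by move: X0; lra.
  by apply: le_lt_trans (hd _ _ XX2 X2); rewrite -H0.
have X2 : 0 < X / 2 by move: X0; lra.
have XX2 : X / 2 < X by move: X0; lra.
by apply: le_lt_trans (hi _ _ X2 XX2); rewrite -H0.
Qed.

Lemma slc_incr x y : 0 <= x -> x < y -> H x < H y.
Proof.
case: H_slc => _ hi; rewrite le_eqVlt => /predU1P[<- y0|]; last exact: hi.
by rewrite H0 slc_gt0// gt_eqF.
Qed.

Lemma slc_decr x y : x < y -> y <= 0 -> H y < H x.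
Proof.
case: H_slc => hd _ xy; rewrite le_eqVlt => /predU1P[y0|]; last exact: hd.
by rewrite y0 H0 slc_gt0// lt_eqF// -y0.
Qed.

Lemma level_set_le t m M X : level_set H t m M -> H X <= t -> m <= X <= M.
Proof.
move=> [t0 m0 M0 Hm HM] HX; apply/andP; split; rewrite leNgt; apply/negP => h.
  by have := slc_decr h m0; rewrite Hm ltNge HX.
by have := slc_incr M0 h; rewrite HM ltNge HX.
Qed.

Lemma level_set0 : level_set H 0 0 0.
Proof. by split. Qed.

Lemma slc_le_max k X : `|X| <= k -> H X <= Num.max (H k) (H (- k)).
Proof.
rewrite ler_norml le_max => /andP[]; have [X0 _|X0 + _] := leP 0 X.
  by rewrite le_eqVlt => /predU1P[->|/(slc_incr X0)/ltW ->//]; rewrite lexx.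
by rewrite le_eqVlt => /predU1P[->|/slc_decr/(_ (ltW X0))/ltW ->]; rewrite ?lexx orbT.
Qed.

End monotonicity.

(** Monotonicity alone gives continuity of the inverse: [f (T t - r) < s < f (T t + r)] traps
    [T s]. *)
Lemma continuous_increasing_inverse (f T : R -> R) :
  (forall x y, 0 <= x -> x < y -> f x < f y) ->
  (forall t, 0 < t -> 0 < T t /\ f (T t) = t) ->
  forall t, 0 < t -> {for t, continuous T}.
Proof.
move=> fi hT t t0; have [T0 fT] := hT t t0.
apply/cvgrPdist_le => e e0.
(* The bound [T t / 2] keeps [T t - r] in the half-line where [f] is monotone. *)
pose r := Num.min e (T t / 2).
have r0 : 0 < r by rewrite lt_min e0 divr_gt0.
have re : r <= e by rewrite ge_min lexx.
have rT : r <= T t / 2 by rewrite ge_min lexx orbT.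
have h1 : f (T t - r) < t by rewrite -{2}fT; apply: fi; move: r0 rT T0; lra.
have h2 : t < f (T t + r) by rewrite -{1}fT; apply: fi; [exact: ltW|rewrite ltrDl].
near=> s.
have s0 : 0 < s by near: s; exact: lt_nbhsr.
have [Ts0 fTs] := hT s s0.
have s1 : f (T t - r) < s by near: s; exact: lt_nbhsr.
have s2 : s < f (T t + r) by near: s; exact: lt_nbhsl.
rewrite ler_distl; apply/andP; split; rewrite leNgt; apply/negP => k.
  have : f (T t + r) < f (T s).
    by apply: fi; [rewrite addr_ge0// ltW|move: k re; lra].
  by rewrite fTs => /lt_trans/(_ s2); rewrite ltxx.
have : f (T s) < f (T t - r).
  apply: fi; first exact: ltW.
  by move: k re; lra.
by rewrite fTs => /(lt_trans s1); rewrite ltxx.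
Unshelve. all: by end_near. Qed.

End level_convexity.

(** * Existence of bang-bang profiles and their multiplier *)

Section bang_bang.
Variable R : realType.
Variables (H : R -> R) (Tm Tp : R -> R).
Hypotheses (H0 : H 0 = 0) (H_ge0 : forall X, H 0 <= H X)
  (H_slc : strictly_level_convex H)
  (H_levels : forall t, 0 < t ->
     Tm t < 0 < Tp t /\ [set X | H X = t] = [set Tm t; Tp t]).

Let H_incr := slc_incr H0 H_ge0 H_slc.
Let H_decr := slc_decr H0 H_ge0 H_slc.

Lemma levels_spec t : 0 < t -> [/\ Tm t < 0, 0 < Tp t, H (Tm t) = t & H (Tp t) = t].
Proof.
move=> /H_levels[/andP[h1 h2] h]; split => //.
  by have : [set X | H X = t] (Tm t) by rewrite h; left.
by have : [set X | H X = t] (Tp t) by rewrite h; right.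
Qed.

Lemma levels_pos X : 0 < X -> Tp (H X) = X.
Proof.
move=> X0; have t0 : 0 < H X by apply: slc_gt0; rewrite ?gt_eqF.
have [/andP[h1 h2] h] := H_levels t0.
have : [set Y | H Y = H X] X by [].
rewrite h /= => -[e|//]; exfalso.
by move: h1; rewrite -e => /(lt_trans X0); rewrite ltxx.
Qed.

Lemma levels_neg X : X < 0 -> Tm (H X) = X.
Proof.
move=> X0; have t0 : 0 < H X by apply: slc_gt0; rewrite ?lt_eqF.
have [/andP[h1 h2] h] := H_levels t0.
have : [set Y | H Y = H X] X by [].
rewrite h /= => -[//|e]; exfalso.
by move: h2; rewrite -e => /lt_trans/(_ X0); rewrite ltxx.
Qed.

Lemma level_set_T t : 0 < t -> level_set H t (Tm t) (Tp t).
Proof. by move=> t0; have [h1 h2 h3 h4] := levels_spec t0; split => //; exact: ltW. Qed.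

Lemma continuous_Tp t : 0 < t -> {for t, continuous Tp}.
Proof.
apply: (@continuous_increasing_inverse _ H Tp) => //.
by move=> s s0; have [h1 h2 h3 h4] := levels_spec s0.
Qed.

Lemma continuous_Tm t : 0 < t -> {for t, continuous Tm}.
Proof.
move=> t0; have h : {for t, continuous (fun s => - Tm s)}.
  apply: (@continuous_increasing_inverse _ (fun x => H (- x)) (fun s => - Tm s)) => //.
    by move=> x y x0 xy; apply: H_decr; rewrite ?ltrN2// oppr_le0.
  by move=> s s0; have [h1 h2 h3 h4] := levels_spec s0; rewrite oppr_gt0 opprK.
have -> : Tm = fun s => - - Tm s by apply/funext => s; rewrite opprK.
exact: cvgN.
Qed.

(** With [p = Tm t] and [q = Tp t], the mean condition forces [th = (al - p) / (q - p)], and then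
    [F al t = (q - p) * th * (1 - th)]. *)
Let F (al t : R) : R := (al - Tm t) * (Tp t - al) / (Tp t - Tm t).

Lemma switch_level (al E : R) : 0 < E ->
  exists t, [/\ 0 < t, Tm t < al, al < Tp t & F al t = E].
Proof.
move=> E0.
have cF t : 0 < t -> {for t, continuous (F al)}.
  move=> t0; have [h1 h2 _ _] := levels_spec t0.
  have cp := continuous_Tp t0; have cm := continuous_Tm t0.
  apply: cvgM; first by apply: cvgM; [apply: cvgB => //; exact: cvg_cst|apply: cvgB => //; exact: cvg_cst].
  by apply: cvgV; [rewrite subr_eq0 gt_eqF// (lt_trans h1)|exact: cvgB].
(* At the level [t2] both roots have absolute value at least [k], so both factors [x], [y] of [F]
   are at least [2 * E], whence [x * y / (x + y) >= E]. *)
pose k := `|al| + 2 * E.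
have k0 : 0 < k by rewrite ltr_wpDl// mulr_gt0.
pose t2 := Num.max (H k) (H (- k)).
have Hk0 : 0 < H k by apply: slc_gt0; rewrite ?gt_eqF.
have t20 : 0 < t2 by rewrite lt_max Hk0.
have [a1 a2 a3 a4] := levels_spec t20.
have Tp2 : k <= Tp t2.
  rewrite leNgt; apply/negP => /(H_incr (ltW a2)); rewrite a4 => h.
  have : H k <= t2 by rewrite le_max lexx.
  by rewrite leNgt h.
have Tm2 : Tm t2 <= - k.
  rewrite leNgt; apply/negP => /H_decr/(_ (ltW a1)); rewrite a3 => h.
  have : H (- k) <= t2 by rewrite le_max lexx orbT.
  by rewrite leNgt h.
have F2 : E <= F al t2.
  have A := ler_norm al; have B := ler_norm (- al); rewrite normrN in B.
  rewrite /F ler_pdivlMr; last by move: a1 a2; lra.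
  have x2 : 2 * E <= al - Tm t2 by move: Tm2 B; rewrite /k; lra.
  have y2 : 2 * E <= Tp t2 - al by move: Tp2 A; rewrite /k; lra.
  have -> : Tp t2 - Tm t2 = (al - Tm t2) + (Tp t2 - al) by ring.
  move: x2 y2 E0; move: (al - Tm t2) (Tp t2 - al) => x y; nra.
(* At [t1 = H al] one factor of [F] vanishes. If [al = 0] this level is 0, hence excluded, and
   [H (E / 2)] replaces it, where [F] is at most [Tp t1 = E / 2]. *)
have [t1 [t10 t12 F1]] : exists t1, [/\ 0 < t1, t1 <= t2 & F al t1 <= E].
  have [al0|al0] := eqVneq al 0.
    exists (H (E / 2)); have E2 : 0 < E / 2 by rewrite divr_gt0.
    have HE0 : 0 < H (E / 2) by apply: slc_gt0; rewrite ?gt_eqF.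
    split => //.
      apply: slc_le_max => //; rewrite ger0_norm ?ltW// /k al0 normr0.
      by move: E0; lra.
    have [b1 b2 b3 b4] := levels_spec HE0.
    rewrite /F levels_pos// al0 sub0r subr0 ler_pdivrMr; last by rewrite subr_gt0 (lt_trans b1).
    move: b1 E0; move: (Tm _) => y; nra.
  have Ha0 : 0 < H al by exact: slc_gt0.
  exists (H al); split => //.
    by apply: slc_le_max => //; rewrite /k lerDl mulr_ge0// ltW.
  rewrite (_ : F al (H al) = 0) ?ltW// /F.
  move: al0; case: ltgtP => // al0 _; first by rewrite levels_neg// subrr !mul0r.
  by rewrite levels_pos// subrr mulr0 mul0r.
have [||t + Ft] := @IVT _ (F al) t1 t2 E t12.
- apply: continuous_in_subspaceT => t; rewrite inE /= in_itv /= => /andP[h _].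
  by apply: cF; exact: lt_le_trans h.
- by rewrite ge_min F1 le_max F2 orbT.
rewrite in_itv /= => /andP[h _]; have t0 := lt_le_trans t10 h.
have [b1 b2 _ _] := levels_spec t0.
have D0 : 0 < Tp t - Tm t by rewrite subr_gt0 (lt_trans b1).
(* The two factors have the same sign, and they cannot both be negative because [Tm t < Tp t]. *)
have : 0 < (al - Tm t) * (Tp t - al) by rewrite -(pmulr_lgt0 _ (_ : 0 < (Tp t - Tm t)^-1)) ?invr_gt0// -/(F al t) Ft.
move=> P; exists t; split => //.
  by rewrite ltNge; apply/negP => h1; move: P h1 D0; nra.
by rewrite ltNge; apply/negP => h1; move: P h1 D0; nra.
Qed.

(** The strict inequalities make every genuine switch a change of sign; level 0 occurs only among
    the constant profiles. *)
Definition bang (t m M p q : R) :=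
  level_set H t m M /\
  [\/ p = q /\ (p = m \/ p = M), [/\ p = m, q = M & m < 0 < M] |
      [/\ p = M, q = m & m < 0 < M]].

(* [al] and [ga] are the averages over (a, b) of u'' and of its product with
   2 (b - x) / (b - a), and [th] is the fraction (b - xi) / (b - a). *)
Lemma bang_exists (al ga : R) : exists t m M p q th : R,
  [/\ bang t m M p q, 0 < th < 1, p + (q - p) * th = al,
      p + (q - p) * th ^+ 2 = ga & al = ga -> p = q].
Proof.
have key (E : R) : 0 < E -> exists t p q th : R, [/\ 0 < t, p = Tm t, q = Tp t, 0 < th < 1 &
    p + (q - p) * th = al /\ (q - p) * th * (1 - th) = E].
  move=> E0; have [t [t0 h1 h2 h3]] := switch_level al E0.
  exists t, (Tm t), (Tp t), ((al - Tm t) / (Tp t - Tm t)).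
  have D0 : 0 < Tp t - Tm t by rewrite subr_gt0 (lt_trans h1).
  have Dn : Tp t - Tm t != 0 by rewrite gt_eqF.
  split => //.
    apply/andP; split; first by apply: divr_gt0 => //; rewrite subr_gt0.
    by rewrite ltr_pdivrMr// mul1r ltrD2r.
  by split; [field|rewrite -h3 /F; field].
(* If [ga > al] the positive level must come first: [p] and [q] are exchanged and [th] becomes
   [1 - th]. If [ga = al] the profile is constant, and [th = 1 / 2] is an arbitrary choice. *)
have [E0|E0|E0] := ltgtP al ga.
- have ga0 : 0 < ga - al by rewrite subr_gt0.
  have [t [p [q [th [t0 hp hq /andP[th0 th1] [e1 e2]]]]]] := key _ ga0.
  exists t, p, q, q, p, (1 - th); have [a1 a2 a3 a4] := levels_spec t0.
  split.
  + split; first by rewrite hp hq; exact: level_set_T.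
    by apply: Or33; split => //; rewrite hp hq a1.
  + by rewrite subr_gt0 th1 gtrBl.
  + by rewrite -e1; ring.
  + have -> : ga = al + (ga - al) by ring.
    by rewrite -e2 -e1; ring.
  + by move=> E; rewrite E ltxx in E0.
- have ga0 : 0 < al - ga by rewrite subr_gt0.
  have [t [p [q [th [t0 hp hq /andP[th0 th1] [e1 e2]]]]]] := key _ ga0.
  exists t, p, q, p, q, th; have [a1 a2 a3 a4] := levels_spec t0.
  split => //.
  + split; first by rewrite hp hq; exact: level_set_T.
    by apply: Or32; split => //; rewrite hp hq a1.
  + by rewrite th0.
  + have -> : ga = al - (al - ga) by ring.
    by rewrite -e2 -e1; ring.
  + by move=> E; rewrite E ltxx in E0.
have th : 0 < 1 / 2 :> R /\ 1 / 2 < 1 :> R by split; lra.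
have [al0|al0|al0] := ltgtP al 0.
- have t0 : 0 < H al by apply: slc_gt0; rewrite ?lt_eqF.
  exists (H al), (Tm (H al)), (Tp (H al)), al, al, (1 / 2); split => //.
  + split; first exact: level_set_T.
    by apply: Or31; split => //; left; rewrite levels_neg.
  + by apply/andP.
  + by rewrite subrr mul0r addr0.
  + by rewrite subrr mul0r addr0.
- have t0 : 0 < H al by apply: slc_gt0; rewrite ?gt_eqF.
  exists (H al), (Tm (H al)), (Tp (H al)), al, al, (1 / 2); split => //.
  + split; first exact: level_set_T.
    by apply: Or31; split => //; right; rewrite levels_pos.
  + by apply/andP.
  + by rewrite subrr mul0r addr0.
  + by rewrite subrr mul0r addr0.
- exists 0, 0, 0, 0, 0, (1 / 2); split => //.
  + by split; [exact: level_set0|apply: Or31; split => //; left].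
  + by apply/andP.
  + by rewrite subrr mul0r addr0.
  + by rewrite subrr mul0r addr0 -E0 al0.
Qed.

Lemma bang_constant_energy t m M p q : bang t m M p q -> H p = t /\ H q = t.
Proof.
by move=> [[_ _ _ h1 h2]] [[-> [->|->]]|[-> -> _]|[-> -> _]].
Qed.

(* [l1 * x + l0] plays the role of a Lagrange multiplier for the two
   boundary constraints. *)
Lemma bang_multiplier t m M p q (xi : R) : bang t m M p q ->
  exists l1 l0 : R, (l1 != 0) || (l0 != 0) /\ forall x X, x != xi ->
  let l := l1 * x + l0 in let w := if x < xi then p else q in
  `|l| * `|X - w| + l * (X - w) <= 2 * (pos (X - M) + pos (m - X)) * `|l|.
Proof.
move=> [_ hb].
have pos0 (y : R) : 0 <= pos y by rewrite /pos le_max lexx.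
(* The bound measures the violation of [m <= X <= M]; without violation the inequality to be proved
   says exactly that [l * (X - w) <= 0]. *)
have up X : `|X - M| + (X - M) <= 2 * (pos (X - M) + pos (m - X)).
  have h0 := pos0 (m - X); have [h|h] := leP 0 (X - M).
    by rewrite (pos_ge0 h) ger0_norm//; move: h h0; lra.
  by rewrite (pos_le0 (ltW h)) ltr0_norm//; move: h h0; lra.
have dn X : `|X - m| - (X - m) <= 2 * (pos (X - M) + pos (m - X)).
  have h0 := pos0 (X - M); have mX : m - X = - (X - m) by rewrite opprB.
  have h1 := pos0 (m - X); have [h|h] := leP 0 (X - m).
    by rewrite ger0_norm//; move: h h0 h1; lra.
  rewrite (_ : pos (m - X) = m - X); last by rewrite pos_ge0// mX oppr_ge0 ltW.
  by rewrite ltr0_norm//; move: h h0; lra.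
have upl l X : 0 < l ->
    `|l| * `|X - M| + l * (X - M) <= 2 * (pos (X - M) + pos (m - X)) * `|l|.
  by move=> l0; rewrite gtr0_norm// -mulrDr mulrC ler_pM2r.
have dnl l X : l < 0 ->
    `|l| * `|X - m| + l * (X - m) <= 2 * (pos (X - M) + pos (m - X)) * `|l|.
  move=> l0; rewrite ltr0_norm//.
  have -> : - l * `|X - m| + l * (X - m) = (`|X - m| - (X - m)) * - l by ring.
  by rewrite ler_pM2r ?oppr_gt0.
case: hb => [[-> [->|->]]|[-> -> _]|[-> -> _]].
- exists 0, (-1); split; first by rewrite oppr_eq0 oner_eq0 orbT.
  by move=> x X _ /=; rewrite if_same mul0r add0r; apply: dnl; rewrite oppr_lt0.
- exists 0, 1; split; first by rewrite oner_eq0 orbT.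
  by move=> x X _ /=; rewrite if_same mul0r add0r; apply: upl.
- exists 1, (- xi); split; first by rewrite oner_eq0.
  move=> x X xn /=; rewrite mul1r; move: xn; case: ltgtP => // h _.
    by apply: dnl; rewrite subr_lt0.
  by apply: upl; rewrite subr_gt0.
- exists (-1), xi; split; first by rewrite oppr_eq0 oner_eq0.
  move=> x X xn /=; rewrite mulN1r (addrC (- x) xi); move: xn; case: ltgtP => // h _.
    by apply: upl; rewrite subr_gt0.
  by apply: dnl; rewrite subr_lt0.
Qed.

End bang_bang.

(** * Absolute minimisers *)

Section energy.
Variable R : realType.
Local Notation mu := (@lebesgue_measure R).
Variable H : R -> R.
Hypotheses (H0 : H 0 = 0) (H_ge0 : forall X, H 0 <= H X)
  (H_slc : strictly_level_convex H).
Implicit Types (u v phi g : R -> R).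

Let H_nneg X : 0 <= H X. Proof. by rewrite -H0. Qed.

Lemma Eoo_leP u D (s : R) : 0 <= s ->
  (Eoo H u D <= s%:E)%E <-> ae_on D (fun x => H (D2 u x) <= s).
Proof.
move=> s0; split=> [/(Lnorm_oo_leP _ _ s0)|h].
  by apply: ae_on_imp => x _ /=; rewrite ger0_norm.
by apply/(Lnorm_oo_leP _ _ s0); apply: ae_on_imp h => x _ /=; rewrite ger0_norm.
Qed.

Lemma Eoo_ge0 u D : (0 <= Eoo H u D)%E.
Proof. exact: Lnorm_ge0. Qed.

Lemma D2_quad A (A' : R) a p q xi x : x != xi ->
  D2 (quad A A' a p q xi) x = if x < xi then p else q.
Proof.
case: ltgtP => // h _; first exact: D2_quad_l.
exact: D2_quad_r.
Qed.

(** [xi] need not lie in [D]: sets that see one phase only are covered, which makes restriction to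
    subintervals free of cases. *)
Definition switches D u (p q xi : R) :=
  ae_on D (fun x => D2 u x = if x < xi then p else q).

Lemma switches_sub D D' u (p q xi : R) : D' `<=` D -> switches D u p q xi ->
  switches D' u p q xi.
Proof. by move=> s; exact: ae_on_sub. Qed.

Lemma switches_quad D A (A' : R) a p q xi : switches D (quad A A' a p q xi) p q xi.
Proof. by apply: ae_on_imp (ae_on_neq D xi) => x _ xn; rewrite D2_quad. Qed.

Lemma Eoo_bang t m M p q xi u D : bang H t m M p q -> switches D u p q xi ->
  (Eoo H u D <= t%:E)%E.
Proof.
move=> hb hu; have [h1 h2] := bang_constant_energy hb.
case: (hb) => -[t0 _ _ _ _] _.
by apply/Eoo_leP => //; apply: ae_on_imp hu => x _ ->; case: ifP; rewrite ?h1 ?h2.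
Qed.

Lemma Eoo_sub u D D' : D' `<=` D -> (Eoo H u D' <= Eoo H u D)%E.
Proof.
move=> sub; case E : (Eoo H u D) => [s| |]; [|exact: leey|].
  have s0 : 0 <= s by rewrite -lee_fin -E Eoo_ge0.
  have : (Eoo H u D <= s%:E)%E by rewrite E.
  by move=> /(Eoo_leP _ _ s0) h; apply/(Eoo_leP _ _ s0); exact: ae_on_sub h.
by have := Eoo_ge0 u D; rewrite E.
Qed.

Lemma add_lin u v : u \+ v = (fun x => 1 * u x + v x).
Proof. by apply/funext => x; rewrite /= mul1r. Qed.

Lemma sub_lin u v : u \- v = (fun x => -1 * v x + u x).
Proof. by apply/funext => x; rewrite /= mulN1r addrC. Qed.

Lemma bang_strict_minimiser c d t m M p q xi u phi : c < d ->
  bang H t m M p q -> W2 +oo%E `]c, d[ u -> switches `]c, d[ u p q xi ->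
  W2oo0 `]c, d[ phi -> (Eoo H (u \+ phi)%R `]c, d[ <= t%:E)%E ->
  forall x, `]c, d[%classic x -> phi x = 0.
Proof.
move=> cd hb Wq hu W0; case: (hb) => L _; case: (L) => t0 _ _ _ _.
move=> /(Eoo_leP _ _ t0) hE.
have [Wphi _] := (W2oo0P _ cd).1 W0.
have [l1 [l0 [ln hl]]] := bang_multiplier xi hb.
have E2 := derive2_lin 1 Wq Wphi.
apply: (W2oo0_sign cd W0 ln).
have hE' := ae_on_imp2 (fun x _ h1 h2 => conj h1 h2) hE E2.
have hu' := ae_on_imp2 (fun x _ h1 h2 => conj h1 h2) hu (ae_on_neq _ xi).
apply: ae_on_imp2 hE' hu' => x _ [h1 h2] [hx xn].
rewrite add_lin h2 mul1r in h1.
have /andP[mX XM] := level_set_le H0 H_ge0 H_slc L h1.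
have := hl x (D2 u x + D2 phi x) xn; lazy zeta.
rewrite (pos_le0 (x := _ - M)) ?subr_le0// (pos_le0 (x := m - _)) ?subr_le0//.
have cancel (X Y : R) : X + Y - X = Y by ring.
rewrite addr0 mulr0 mul0r -hx cancel => h.
by apply: le_trans h; rewrite lerDr mulr_ge0.
Qed.

(** The endpoints are the supremum and the infimum of the complement of [O] on either side of [x0].
    They exist because [a] and [b] are not in [O], and lie outside [O] because the complement is
    closed. *)
Lemma open_component (O : set R) x0 a b : open O -> O `<=` `]a, b[ -> O x0 ->
  exists c d : R, [/\ c < x0 < d, `]c, d[ `<=` O, ~ O c & ~ O d].
Proof.
move=> oO sO Ox0; have nb y : O y -> exists2 e : R, 0 < e & forall z, `|y - z| < e -> O z.
  by move=> Oy; have [e /= e0 he] := open_nbhs_nbhs (conj oO Oy); exists e.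
have /andP[ax xb] : a < x0 < b by have := sO _ Ox0; rewrite /= in_itv.
pose A := [set y : R | y <= x0 /\ ~ O y].
pose B := [set y : R | x0 <= y /\ ~ O y].
have hA : has_sup A.
  split; last by exists x0 => y [].
  by exists a; split; [exact: ltW|move=> /sO /=; rewrite in_itv /= ltxx].
have hB : has_inf B.
  split; last by exists x0 => y [].
  by exists b; split; [exact: ltW|move=> /sO /=; rewrite in_itv /= ltxx andbF].
have nOc : ~ O (sup A).
  move=> /nb[e e0 he]; have [y [yx nOy] ye] := sup_adherent e0 hA.
  apply: (nOy); apply: he.
  have yA : y <= sup A by apply: ub_le_sup; [exact: hA.2|split].
  by rewrite ger0_norm ?subr_ge0// ltrBlDr -ltrBlDl.
have nOd : ~ O (inf B).
  move=> /nb[e e0 he]; have [y [yx nOy] ye] := inf_adherent e0 hB.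
  apply: (nOy); apply: he.
  have yB : inf B <= y by apply: ge_inf; [exact: hB.2|split].
  by rewrite ler0_norm ?subr_le0// opprB ltrBlDl.
have cx : sup A <= x0 by apply: ge_sup => [|y []//]; exact: hA.1.
have xd : x0 <= inf B by apply: lb_le_inf => [|y []//]; exact: hB.1.
exists (sup A), (inf B); split => //.
  apply/andP; split; rewrite lt_neqAle ?cx ?xd andbT; apply/eqP => e.
    by apply: nOc; rewrite e.
  by apply: nOd; rewrite -e.
move=> y /=; rewrite in_itv /= => /andP[cy yd]; apply: contrapT => nOy.
have [yx|xy] := leP y x0.
  have : y <= sup A by apply: ub_le_sup; [exact: hA.2|].
  by rewrite leNgt cy.
have : inf B <= y by apply: ge_inf; [exact: hB.2|split => //; exact: ltW].
by rewrite leNgt yd.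
Qed.

(** By strict minimality a competitor with energy below [t] would coincide with [u], yet
    [H (u'') = t] almost everywhere on a set of positive measure. *)
Lemma bang_energy_ge c d t m M p q xi u phi : c < d ->
  bang H t m M p q -> W2 +oo%E `]c, d[ u -> switches `]c, d[ u p q xi ->
  W2oo0 `]c, d[ phi -> (t%:E <= Eoo H (u \+ phi)%R `]c, d[)%E.
Proof.
move=> cd hb Wu hu W0; rewrite leNgt; apply/negP => lt_E.
have oI : open (`]c, d[%classic : set R) by exact: interval_open.
have phi0 := bang_strict_minimiser cd hb Wu hu W0 (ltW lt_E).
have [s Es] : exists s : R, Eoo H (u \+ phi)%R `]c, d[ = s%:E.
  have : Eoo H (u \+ phi)%R `]c, d[ \is a fin_num.
    by rewrite ge0_fin_numE ?Eoo_ge0//; apply: lt_trans lt_E _; exact: ltry.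
  by exists (fine (Eoo H (u \+ phi)%R `]c, d[)); rewrite fineK.
have s0 : 0 <= s by rewrite -lee_fin -Es Eoo_ge0.
have st : s < t by rewrite -lte_fin -Es.
have hs : ae_on `]c, d[ (fun x => H (D2 (u \+ phi) x) <= s) by apply/Eoo_leP => //; rewrite Es.
have [h1 h2] := bang_constant_energy hb.
have D2E x : `]c, d[%classic x -> D2 (u \+ phi) x = D2 u x.
  move=> Ix; apply: (eq_on_derive oI Ix) => y Iy.
  by apply: (eq_on_derive oI Iy) => z Iz; rewrite /= phi0// addr0.
have mucd : (0 < mu `]c, d[%classic)%E.
  by rewrite lebesgue_measure_itv /= lte_fin cd -EFinD lte_fin subr_gt0.
have hn := ae_on_imp2 (fun x _ k1 k2 => conj k1 k2) hs hu.
have [x [Ix [k1 k2]]] := ae_on_ex (measurable_itv _) mucd hn.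
by move: k1; rewrite D2E// k2; case: ifP => _; rewrite ?h1 ?h2 leNgt st.
Qed.

(** A single component of [O] suffices: there every competitor already has energy at least [t], and
    [u] has at most [t] on all of [O]. *)
Lemma AM2_quad a b t m M p q A (A' : R) xi : a < xi < b -> bang H t m M p q ->
  AM2 H a b (quad A A' a p q xi).
Proof.
move=> axb hb; have Wq := W2_quad A A' a p q axb.
split; first exact: Wq.
move=> O oO [_ clO] phi W0.
have sO : O `<=` `]a, b[ by move=> x Ox; apply: clO; exact: subset_closure.
set u := quad _ _ _ _ _ _ in Wq *.
have [[x0 Ox0]|nO] := pselect (exists x, O x); last first.
  apply: (@le_trans _ _ 0%E); last exact: Eoo_ge0.
  by apply/(Eoo_leP _ _ (lexx 0)); apply: ae_onW => x Ox; case: nO; exists x.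
have [c [d [/andP[cx xd] sub nOc nOd]]] := open_component oO sO Ox0.
have cd : c < d := lt_trans cx xd.
have W0' := W2oo0_component oO cd sub nOc nOd W0.
have Wq' : W2 +oo%E `]c, d[ u.
  by apply: W2oo_sub Wq => //; [exact: subset_trans sub sO|exact: itv_fin].
apply: le_trans (Eoo_bang hb (switches_quad _ _ _ _ _ _ _)) _.
apply: le_trans (Eoo_sub _ sub).
exact: bang_energy_ge cd hb Wq' (switches_quad _ _ _ _ _ _ _) W0'.
Qed.

Variables (Tm Tp : R -> R).
Hypothesis H_levels : forall t, 0 < t ->
     Tm t < 0 < Tp t /\ [set X | H X = t] = [set Tm t; Tp t].

Lemma boundary_calE a b u A (A' : R) B (B' : R) : boundary_values a b u A A' B B' ->
  calE a b u = (B' - A') / (b - a) - 2 * (B - A - A' * (b - a)) / (b - a) ^+ 2.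
Proof.
move=> [h1 h2 h3 h4]; rewrite /calE.
by rewrite (cvg_lim (@Rhausdorff R) h1) (cvg_lim (@Rhausdorff R) h2) (cvg_lim (@Rhausdorff R) h3) (cvg_lim (@Rhausdorff R) h4).
Qed.

Lemma W2oo0_quad_sub a b g : a < b -> W2 +oo%E `]a, b[ g ->
  exists t m M p q xi A A' : R, [/\ bang H t m M p q, a < xi < b &
    W2oo0 `]a, b[ (quad A A' a p q xi \- g)].
Proof.
move=> ab Wg; have [A [A' [B [B' bv]]]] := W2_boundary_values ab Wg.
have ba0 : 0 < b - a by rewrite subr_gt0.
have ban : b - a != 0 by rewrite gt_eqF.
have [t [m [M [p [q [th [hb /andP[th0 th1] e1 e2 _]]]]]]] :=
  bang_exists H0 H_ge0 H_slc H_levels ((B' - A') / (b - a)) (2 * (B - A - A' * (b - a)) / (b - a) ^+ 2).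
pose xi := b - th * (b - a).
have axi : a < xi < b.
  by rewrite /xi; apply/andP; split; nra.
exists t, m, M, p, q, xi, A, A'; split; [exact: hb|exact: axi|].
have [hg _ _ _ _] := (W2ooP _ _ _).1 Wg.
have Wq := W2_quad A A' a p q axi.
have [hq _ _ _ _] := (W2ooP _ _ _).1 Wq.
rewrite (sub_lin (quad A A' a p q xi) g); apply: (W2oo0P _ ab).2.
split; first exact: (W2_lin (-1) Wg Wq).
have := boundary_values_lin (-1) ab hg hq bv (boundary_values_quad a b A A' a p q xi).
have bxi : b - xi = th * (b - a) by rewrite /xi; ring.
have pb : pos (b - xi) = th * (b - a) by rewrite bxi pos_ge0// mulr_ge0// ltW.
have pa : pos (a - xi) = 0.
  by rewrite pos_le0// subr_le0 ltW//; case/andP: axi.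
have -> : -1 * A + quad A A' a p q xi a = 0.
  by rewrite /quad pa subrr; ring.
have -> : -1 * A' + dquad A' a p q xi a = 0.
  by rewrite /dquad pa subrr; ring.
have -> : -1 * B' + dquad A' a p q xi b = 0.
  rewrite /dquad pb.
  have -> : -1 * B' + (A' + p * (b - a) + (q - p) * (th * (b - a)))
    = -1 * B' + A' + (p + (q - p) * th) * (b - a) by ring.
  by rewrite e1; field.
have -> : -1 * B + quad A A' a p q xi b = 0.
  rewrite /quad pb.
  have -> : -1 * B + (A + A' * (b - a) + p / 2 * (b - a) ^+ 2 + (q - p) / 2 * (th * (b - a)) ^+ 2)
    = -1 * B + A + A' * (b - a) + (p + (q - p) * th ^+ 2) * ((b - a) ^+ 2 / 2) by field.
  by rewrite e2; field.
by [].
Qed.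

End energy.

Lemma mid_between (R : realType) (x y : R) : x < y -> x < (x + y) / 2 /\ (x + y) / 2 < y.
Proof. by move=> xy; split; lra. Qed.

(** * Local profiles of absolute minimisers and their gluing *)

Section absolute_minimisers.
Variable R : realType.
Local Notation mu := (@lebesgue_measure R).
Variables (H : R -> R) (Tm Tp : R -> R).
Hypotheses (H0 : H 0 = 0) (H_ge0 : forall X, H 0 <= H X)
  (H_slc : strictly_level_convex H)
  (H_levels : forall t, 0 < t ->
     Tm t < 0 < Tp t /\ [set X | H X = t] = [set Tm t; Tp t]).
Implicit Types (u v phi g : R -> R).

Lemma compactly_contained_oo (a b c d : R) : a < c -> c < d -> d < b ->
  compactly_contained `]c, d[ `]a, b[.
Proof.
move=> ac cd db; rewrite /compactly_contained closure_oo//.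
by split; [exact: segment_compact|exact: subset_cc_oo].
Qed.

Lemma eq_on_D2 (O : set R) u v x : open O -> O x -> (forall y, O y -> u y = v y) ->
  D2 u x = D2 v x.
Proof.
by move=> oO Ox uv; apply: (eq_on_derive oO Ox) => y Oy; exact: (eq_on_derive oO Oy).
Qed.

(** The bang-bang function with the traces of [u] on [[c, d]] is an admissible competitor, so [u]
    has energy at most [t] there, and strict minimality identifies the two. Minimality is tested on
    compactly contained sets, hence the strict inequalities at [a] and [b]. *)
Lemma AM2_local (a b : R) u (c d : R) : AM2 H a b u -> a < c -> c < d -> d < b ->
  exists t m M p q xi A A' : R, [/\ bang H t m M p q, c < xi < d &
    forall x, `]c, d[%classic x -> u x = quad A A' c p q xi x].
Proof.
move=> [Wu min] ac cd db.
have oI : open (`]c, d[%classic : set R) by exact: interval_open.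
have sub : `]c, d[ `<=` (`]a, b[%classic : set R).
  by move=> x /=; rewrite !in_itv /= => /andP[cx xd]; rewrite (lt_trans ac cx) (lt_trans xd db).
have Wu' : W2 +oo%E `]c, d[ u by apply: W2oo_sub Wu => //; exact: itv_fin.
have [t [m [M [p [q [xi [A [A' [hb cxd W0]]]]]]]]] :=
  W2oo0_quad_sub H0 H_ge0 H_slc H_levels cd Wu'.
exists t, m, M, p, q, xi, A, A'; split; [exact: hb|exact: cxd|].
set U := quad A A' c p q xi in W0 *.
have hE := min _ oI (compactly_contained_oo ac cd db) _ W0.
have UE : u \+ (U \- u) = U by apply/funext => x /=; rewrite addrCA subrr addr0.
rewrite UE in hE.
have WU : W2 +oo%E `]c, d[ U := W2_quad A A' c p q cxd.
have W0' : W2oo0 `]c, d[ (u \- U).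
  apply: (W2oo0P _ cd).2; have [W [b1 b2 b3 b4]] := (W2oo0P _ cd).1 W0.
  have [hC _ _ _ _] := (W2ooP _ _ _).1 W.
  have W00 : W2 +oo%E `]c, d[ (fun x => -1 * (U \- u) x + (U \- u) x) by exact: W2_lin.
  have -> : u \- U = (fun x => -1 * (U \- u) x + (-1 * (U \- u) x + (U \- u) x)).
    by apply/funext => x; rewrite /=; ring.
  split; first by apply: W2_lin.
  have [hC0 _ _ _ _] := (W2ooP _ _ _).1 W00.
  have bv : boundary_values c d (U \- u) 0 0 0 0 by split.
  have bv0 := boundary_values_lin (-1) cd hC hC bv bv.
  have := boundary_values_lin (-1) cd hC hC0 bv bv0.
  by rewrite !mulr0 !addr0.
have hE' : (Eoo H (U \+ (u \- U))%R `]c, d[ <= t%:E)%E.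
  have -> : U \+ (u \- U) = u by apply/funext => x /=; rewrite addrCA subrr addr0.
  exact: le_trans hE (Eoo_bang H0 H_ge0 hb (switches_quad _ _ _ _ _ _ _)).
move=> x Ix; apply/eqP; rewrite -subr_eq0; apply/eqP.
exact: (bang_strict_minimiser H0 H_ge0 H_slc cd hb WU (switches_quad _ _ _ _ _ _ _) W0' hE' Ix).
Qed.

Lemma D2_on_quad (O : set R) u A (A' : R) a p q xi x : open O -> O x ->
  (forall y, O y -> u y = quad A A' a p q xi y) -> x != xi ->
  D2 u x = if x < xi then p else q.
Proof. by move=> oO Ox h xn; rewrite (eq_on_D2 oO Ox h) D2_quad. Qed.

Lemma derivable_on_quad (O : set R) u A (A' : R) a p q xi x : open O -> O x ->
  (forall y, O y -> u y = quad A A' a p q xi y) -> (x != xi) || (p == q) ->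
  derivable (D1 u) x 1.
Proof.
move=> oO Ox h xn; apply: (@eq_on_derivable _ O (dquad A' a p q xi) _ _ oO Ox).
  by move=> y Oy; rewrite (eq_on_derive oO Oy h) D1_quad.
case/orP: xn => [xn|/eqP ->].
  have [k|k] : x < xi \/ xi < x by apply/orP; rewrite -neq_lt.
    have [k1 _] := is_derive_dquad_l A' a p q k; exact: k1.
  have [k1 _] := is_derive_dquad_r A' a p q k; exact: k1.
have [k1 _] := is_derive_dquad_eq A' a q xi x; exact: k1.
Qed.

Lemma not_derivable_on_quad (O : set R) u A (A' : R) a p q xi : open O -> O xi ->
  (forall y, O y -> u y = quad A A' a p q xi y) -> p != q ->
  ~ derivable (D1 u) xi 1.
Proof.
move=> oO Ox h pq du; apply: (@dquad_not_derivable _ A' a p q xi pq).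
apply: (@eq_on_derivable _ O (D1 u) _ _ oO Ox _ du).
by move=> y Oy; rewrite (eq_on_derive oO Oy h) D1_quad.
Qed.

(** Either some compact subinterval shows a kink, which then pins down [xi], [p] and [q] for every
    larger interval, or the second derivative is constant on all of them. *)
Lemma AM2_D2 (a b : R) u : a < b -> AM2 H a b u ->
  exists t m M p q xi : R, [/\ bang H t m M p q, a < xi < b &
    forall x, a < x < b -> x != xi -> D2 u x = if x < xi then p else q].
Proof.
move=> ab hu.
have oI (c d : R) : open (`]c, d[%classic : set R) by exact: interval_open.
have [[c [d [[ac cd db] [t [m [M [p [q [xi [A [A' [pq hb cxd hq]]]]]]]]]]]]|none] :=
  pselect (exists c d : R, [/\ a < c, c < d & d < b] /\
    exists t m M p q xi A A' : R, [/\ p != q, bang H t m M p q, c < xi < d &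
    forall x, `]c, d[%classic x -> u x = quad A A' c p q xi x]).
  have [cx xd] := andP cxd.
  exists t, m, M, p, q, xi; split; [exact: hb| |].
    by rewrite (lt_trans ac cx) (lt_trans xd db).
  move=> x /andP[ax xb] xn.
  (* The interval is enlarged to contain [x] inside []a, b[]. [D1 u] is not differentiable at [xi],
     so the new profile must switch there too. *)
  pose c' := Num.min c ((a + x) / 2); pose d' := Num.max d ((x + b) / 2).
  have c'c : c' <= c by rewrite ge_min lexx.
  have dd' : d <= d' by rewrite le_max lexx.
  have c'x : c' < x by rewrite gt_min; apply/orP; right; case: (mid_between ax).
  have xd' : x < d' by rewrite lt_max; apply/orP; right; case: (mid_between xb).
  have ac' : a < c' by rewrite lt_min ac /=; case: (mid_between ax).
  have d'b : d' < b by rewrite gt_max db /=; case: (mid_between xb).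
  have [t' [m' [M' [p' [q' [xi' [B [B' [hb' cxd' hq']]]]]]]]] :=
    AM2_local hu ac' (lt_trans c'x xd') d'b.
  have in' y : c < y -> y < d -> `]c', d'[%classic y.
    by move=> cy yd; rewrite /= in_itv /= (le_lt_trans c'c cy) (lt_le_trans yd dd').
  have inc y : c < y -> y < d -> `]c, d[%classic y.
    by move=> cy yd; rewrite /= in_itv /= cy yd.
  have nd := not_derivable_on_quad (oI c d) (inc _ cx xd) hq pq.
  have [exi epq] : xi = xi' /\ p' != q'.
    have : ~~ ((xi != xi') || (p' == q')).
      by apply/negP => h; apply: nd; exact: (derivable_on_quad (oI _ _) (in' _ cx xd) hq' h).
    by rewrite negb_or negbK => /andP[/eqP].
  rewrite -exi in hq'.
  (* One point in each phase, where the second derivatives of the two profiles are compared. *)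
  pose y := (c + xi) / 2; pose z := (xi + d) / 2.
  have [cy yx] : c < y /\ y < xi by exact: mid_between.
  have [xz zd] : xi < z /\ z < d by exact: mid_between.
  have yd := lt_trans yx xd; have cz := lt_trans cx xz.
  have yn : y != xi by rewrite lt_eqF.
  have zn : z != xi by rewrite gt_eqF.
  have ep : p = p'.
    have := D2_on_quad (oI _ _) (in' _ cy yd) hq' yn.
    by rewrite (D2_on_quad (oI _ _) (inc _ cy yd) hq yn) yx.
  have eq : q = q'.
    have := D2_on_quad (oI _ _) (in' _ cz zd) hq' zn.
    by rewrite (D2_on_quad (oI _ _) (inc _ cz zd) hq zn) ltNge (ltW xz).
  rewrite ep eq; apply: (D2_on_quad (oI c' d') _ hq' xn).
  by rewrite /= in_itv /= c'x xd'.
(* Without kinks, the second derivative at [x] is compared with the one at the fixed midpoint [z],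
   on an interval containing both. *)
pose z := (a + b) / 2.
have [az zb] : a < z /\ z < b by exact: mid_between.
have key x : a < x -> x < b -> exists t m M p, [/\ bang H t m M p p, D2 u x = p & D2 u z = p].
  move=> ax xb.
  pose c' := (a + Num.min x z) / 2; pose d' := (Num.max x z + b) / 2.
  have h1 : Num.min x z <= x /\ Num.min x z <= z by rewrite !ge_min !lexx orbT.
  have h2 : x <= Num.max x z /\ z <= Num.max x z by rewrite !le_max !lexx orbT.
  have h3 : a < Num.min x z by rewrite lt_min ax az.
  have h4 : Num.max x z < b by rewrite gt_max xb zb.
  have [ac' c'x c'z] : [/\ a < c', c' < x & c' < z].
    have [k1 k2] := mid_between h3; case: h1 => l1 l2.
    by split; [exact: k1|exact: lt_le_trans l1|exact: lt_le_trans l2].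
  have [xd' zd' d'b] : [/\ x < d', z < d' & d' < b].
    have [k1 k2] := mid_between h4; case: h2 => l1 l2.
    by split; [exact: le_lt_trans k1|exact: le_lt_trans k1|exact: k2].
  have [t' [m' [M' [p' [q' [xi' [B [B' [hb' cxd' hq']]]]]]]]] :=
    AM2_local hu ac' (lt_trans c'x xd') d'b.
  have epq : p' = q'.
    apply/eqP/negPn/negP => pq; apply: none; exists c', d'; split.
      by split => //; exact: lt_trans c'x xd'.
    by exists t', m', M', p', q', xi', B, B'; split.
  subst q'; exists t', m', M', p'; split; first exact: hb'.
    by rewrite (eq_on_D2 (oI c' d') _ hq') ?D2_quad_eq//= in_itv /= c'x.
  by rewrite (eq_on_D2 (oI c' d') _ hq') ?D2_quad_eq//= in_itv /= c'z.
have [t [m [M [p [hb _ Dz]]]]] := key z az zb.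
exists t, m, M, p, p, z; split; [exact: hb|by rewrite az zb|].
move=> x /andP[ax xb] _; rewrite if_same.
by have [t' [m' [M' [p' [_ -> e]]]]] := key x ax xb; rewrite -Dz e.
Qed.

(** Carries the formula up to the endpoints: the traces at [a] and the second derivative a.e.
    determine the function. *)
Lemma AM2_is_quad (a b : R) u : a < b -> AM2 H a b u ->
  exists t m M p q xi A A' : R, [/\ bang H t m M p q, a < xi < b &
    forall x, `]a, b[%classic x -> u x = quad A A' a p q xi x].
Proof.
move=> ab hu; have [t [m [M [p [q [xi [hb axb hD]]]]]]] := AM2_D2 ab hu.
have [Wu _] := hu.
have [A [A' [B [B' bv]]]] := W2_boundary_values ab Wu.
exists t, m, M, p, q, xi, A, A'; split; [exact: hb|exact: axb|].
have Wq := W2_quad A A' a p q axb.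
have [hC _ _ _ _] := (W2ooP _ _ _).1 Wu.
have [hq _ _ _ _] := (W2ooP _ _ _).1 Wq.
have [b1 b2 _ _] := boundary_values_lin (-1) ab hq hC (boundary_values_quad a b A A' a p q xi) bv.
have pa : pos (a - xi) = 0 by rewrite pos_le0// subr_le0 ltW//; case/andP: axb.
have e1 : -1 * quad A A' a p q xi a + A = 0 by rewrite /quad pa subrr; ring.
have e2 : -1 * dquad A' a p q xi a + A' = 0 by rewrite /dquad pa subrr; ring.
rewrite e1 in b1; rewrite e2 in b2.
have E2 := derive2_lin (-1) Wq Wu.
have hz : ae_on `]a, b[ (fun x => D2 (fun x => -1 * quad A A' a p q xi x + u x) x = 0).
  apply: ae_on_imp2 E2 (ae_on_neq _ xi) => x Ix -> xn.
  by rewrite D2_quad// hD// mulN1r addrC subrr.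
move=> x Ix; have := W2_D2_eq0 ab (W2_lin (-1) Wq Wu) b1 b2 hz Ix.
by rewrite mulN1r addrC => /eqP; rewrite subr_eq0 => /eqP.
Qed.

End absolute_minimisers.

(** * Functions with prescribed boundary values *)

Section dirichlet_classes.
Variable R : realType.
Implicit Types (u v g : R -> R) (a b : R).

Lemma W2oog_W2 a b g u : W2 +oo%E `]a, b[ g -> W2oog a b g u -> W2 +oo%E `]a, b[ u.
Proof.
move=> Wg [W _]; have -> : u = (fun x => 1 * (u \- g) x + g x).
  by apply/funext => x; rewrite /= mul1r subrK.
exact: W2_lin.
Qed.

Lemma W2oog_boundary_values a b g u A (A' : R) B (B' : R) : a < b ->
  W2 +oo%E `]a, b[ g -> W2oog a b g u ->
  boundary_values a b g A A' B B' -> boundary_values a b u A A' B B'.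
Proof.
move=> ab Wg /(W2oo0P _ ab)[W bv0] bv.
have [hW _ _ _ _] := (W2ooP _ _ _).1 W.
have [hg _ _ _ _] := (W2ooP _ _ _).1 Wg.
have -> : u = (fun x => 1 * (u \- g) x + g x).
  by apply/funext => x; rewrite /= mul1r subrK.
have := boundary_values_lin 1 ab hW hg bv0 bv.
by rewrite !mulr0 !add0r.
Qed.

Lemma W2oog_calE a b g u : a < b -> W2 +oo%E `]a, b[ g -> W2oog a b g u ->
  calE a b u = calE a b g.
Proof.
move=> ab Wg hu; have [A [A' [B [B' bv]]]] := W2_boundary_values ab Wg.
by rewrite (boundary_calE bv) (boundary_calE (W2oog_boundary_values ab Wg hu bv)).
Qed.

Lemma W2oo0_lin a b k u v : a < b -> W2oo0 `]a, b[ u -> W2oo0 `]a, b[ v ->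
  W2oo0 `]a, b[ (fun x => k * u x + v x).
Proof.
move=> ab /(W2oo0P _ ab)[Wu bu] /(W2oo0P _ ab)[Wv bv].
have [hu _ _ _ _] := (W2ooP _ _ _).1 Wu; have [hv _ _ _ _] := (W2ooP _ _ _).1 Wv.
apply: (W2oo0P _ ab).2; split; first exact: W2_lin.
by have := boundary_values_lin k ab hu hv bu bv; rewrite !mulr0 !addr0.
Qed.

Lemma W2oog_sub a b g u v : a < b -> W2oog a b g u -> W2oog a b g v ->
  W2oo0 `]a, b[ (u \- v).
Proof.
move=> ab hu hv; have -> : u \- v = (fun x => -1 * (v \- g) x + (u \- g) x).
  by apply/funext => x; rewrite /=; ring.
exact: W2oo0_lin.
Qed.

Lemma W2oog_refl a b u : a < b -> W2 +oo%E `]a, b[ u -> W2oog a b u u.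
Proof.
move=> ab Wu; have [A [A' [B [B' bv]]]] := W2_boundary_values ab Wu.
have [hu _ _ _ _] := (W2ooP _ _ _).1 Wu.
have E : u \- u = (fun x => -1 * u x + u x) by apply/funext => x; rewrite /=; ring.
rewrite /W2oog /= E; apply: (W2oo0P _ ab).2; split; first exact: W2_lin.
by have := boundary_values_lin (-1) ab hu hu bv bv; rewrite !mulN1r !addNr.
Qed.

Lemma eq_on_boundary_values a b u v A (A' : R) B (B' : R) : a < b ->
  (forall x, `]a, b[%classic x -> u x = v x) ->
  boundary_values a b v A A' B B' -> boundary_values a b u A A' B B'.
Proof.
move=> ab uv [b1 b2 b3 b4].
have oI : open (`]a, b[%classic : set R) by exact: interval_open.
have nr (P : R -> Prop) : (forall x, `]a, b[%classic x -> P x) -> \forall x \near a^'+, P x.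
  by move=> hP; apply: filterS (near_right_itv ab).
have nl (P : R -> Prop) : (forall x, `]a, b[%classic x -> P x) -> \forall x \near b^'-, P x.
  by move=> hP; apply: filterS (near_left_itv ab).
split.
- by apply: cvg_trans b1; apply: near_eq_cvg; apply: nr => x /uv.
- by apply: cvg_trans b2; apply: near_eq_cvg; apply: nr => x Ix; rewrite (eq_on_derive oI Ix uv).
- by apply: cvg_trans b3; apply: near_eq_cvg; apply: nl => x /uv.
- by apply: cvg_trans b4; apply: near_eq_cvg; apply: nl => x Ix; rewrite (eq_on_derive oI Ix uv).
Qed.

End dirichlet_classes.

(** * Shape, existence and uniqueness of absolute minimisers *)

Section structure.
Variable R : realType.
Variables (H : R -> R) (Tm Tp : R -> R).
Hypotheses (H0 : H 0 = 0) (H_ge0 : forall X, H 0 <= H X)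
  (H_slc : strictly_level_convex H)
  (H_levels : forall t, 0 < t ->
     Tm t < 0 < Tp t /\ [set X | H X = t] = [set Tm t; Tp t]).
Implicit Types (u v g : R -> R).
Variables (a b : R).
Hypothesis ab : a < b.
Local Notation O := (`]a, b[%classic : set R).

Let oI : open O. Proof. exact: interval_open. Qed.

Section quad_shape.
Variables (u : R -> R) (t m M p q xi A A' : R).
Hypotheses (hb : bang H t m M p q) (axb : a < xi < b)
  (hu : forall x, O x -> u x = quad A A' a p q xi x).

(** This is [al - ga = (q - p) * th * (1 - th)] with [th = (b - xi) / (b - a)] in []0, 1[], so its
    sign is that of [q - p]. *)
Lemma calE_on_quad :
  calE a b u = (q - p) * ((b - xi) / (b - a)) * (1 - (b - xi) / (b - a)).
Proof.
have bv := eq_on_boundary_values ab hu (boundary_values_quad a b A A' a p q xi).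
rewrite (boundary_calE bv) /quad /dquad.
have ban : b - a != 0 by rewrite gt_eqF// subr_gt0.
have [ax xb] := andP axb.
rewrite (pos_le0 (x := a - xi)); last by rewrite subr_le0 ltW.
rewrite (pos_ge0 (x := b - xi)); last by rewrite subr_ge0 ltW.
by rewrite subrr; field.
Qed.

Lemma calE_on_quad_eq0 : calE a b u = 0 <-> p = q.
Proof.
rewrite calE_on_quad; have [ax xb] := andP axb.
have ba : 0 < b - a by rewrite subr_gt0.
split=> [/eqP|->]; last by rewrite subrr !mul0r.
have th0 : 0 < (b - xi) / (b - a) by rewrite divr_gt0// subr_gt0.
have th1 : 0 < 1 - (b - xi) / (b - a).
  by rewrite subr_gt0 ltr_pdivrMr// mul1r ltrD2l ltrN2.
by rewrite mulf_eq0 (gt_eqF th1) orbF mulf_eq0 (gt_eqF th0) orbF subr_eq0 => /eqP/esym.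
Qed.

Lemma quadratic_on_quad : p = q -> quadratic_on O u.
Proof.
move=> pq; exists (A - A' * a + p / 2 * a ^+ 2), (A' - p * a), (p / 2) => x Ix.
by rewrite hu// /quad -pq subrr !mul0r addr0; field.
Qed.

Lemma piecewise_quadratic_on_quad : piecewise_quadratic a b u.
Proof.
exists [:: xi] => c d ac cd db hs.
have nx : ~ (`]c, d[%classic xi) by apply: hs; rewrite mem_seq1.
have hu' x : `]c, d[%classic x -> u x = quad A A' a p q xi x.
  move=> Ix; apply: hu; move: Ix; rewrite /= !in_itv /= => /andP[cx xd].
  by rewrite (le_lt_trans ac cx) (lt_le_trans xd db).
have [xc|cx] := leP xi c.
  exists (A - A' * a + p / 2 * a ^+ 2 + (q - p) / 2 * xi ^+ 2), (A' - p * a - (q - p) * xi), (q / 2) => x Ix.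
  rewrite hu'// /quad pos_ge0; first by field.
  by move: Ix; rewrite /= in_itv /= => /andP[cx _]; rewrite subr_ge0 (le_trans xc)// ltW.
have dx : d <= xi.
  by rewrite leNgt; apply/negP => xd; apply: nx; rewrite /= in_itv /= cx xd.
exists (A - A' * a + p / 2 * a ^+ 2), (A' - p * a), (p / 2) => x Ix.
rewrite hu'// /quad pos_le0; first by field.
by move: Ix; rewrite /= in_itv /= => /andP[_ xd]; rewrite subr_le0 (le_trans (ltW xd)).
Qed.

Lemma no_second_derivative_on_quad x : O x ->
  no_second_derivative u x -> x = xi /\ p != q.
Proof.
move=> Ix nd; have : ~~ ((x != xi) || (p == q)).
  by apply/negP => h; apply: nd; exact: derivable_on_quad oI Ix hu h.
by rewrite negb_or negbK => /andP[/eqP].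
Qed.

Lemma one_switch_on_quad : p != q -> one_switch a b u.
Proof.
move=> pq; split; first exact: piecewise_quadratic_on_quad.
have [ax xb] := andP axb.
have Ixi : O xi by rewrite /= in_itv.
exists xi; split; first exact: axb.
  move=> x axbx; have Ix : O x by rewrite /= in_itv.
  split=> [/(no_second_derivative_on_quad Ix)[]//|->].
  exact: not_derivable_on_quad oI Ixi hu pq.
have left_val y : `]a, xi[%classic y -> D2 u y = p.
  rewrite /= in_itv /= => /andP[ay yx].
  have Iy : O y by rewrite /= in_itv /= ay (lt_trans yx xb).
  by have /= := D2_on_quad oI Iy hu; rewrite (lt_eqF yx) yx; exact.
have right_val y : `]xi, b[%classic y -> D2 u y = q.
  rewrite /= in_itv /= => /andP[xy yb].
  have Iy : O y by rewrite /= in_itv /= (lt_trans ax xy).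
  by have /= := D2_on_quad oI Iy hu; rewrite (gt_eqF xy) ltNge (ltW xy); exact.
case: (hb) => _ [[e _]|[ep eq /andP[m0 M0]]|[ep eq /andP[m0 M0]]].
- by rewrite e eqxx in pq.
- left; split.
    by apply: filterS (near_left_itv ax) => y /left_val ->; rewrite ep.
  by apply: filterS (near_right_itv xb) => y /right_val ->; rewrite eq.
- right; split.
    by apply: filterS (near_left_itv ax) => y /left_val ->; rewrite ep.
  by apply: filterS (near_right_itv xb) => y /right_val ->; rewrite eq.
Qed.

Lemma at_most_one_singularity_on_quad : at_most_one_singularity a b u.
Proof.
split; first exact: piecewise_quadratic_on_quad.
move=> x y ax ay nx ny.
have Ix : O x by rewrite /= in_itv.
have Iy : O y by rewrite /= in_itv.
have [-> _] := no_second_derivative_on_quad Ix nx.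
by have [-> _] := no_second_derivative_on_quad Iy ny.
Qed.

Lemma constant_energy_density_on_quad : constant_energy_density H a b u.
Proof.
have [h1 h2] := bang_constant_energy hb.
exists t => x ax dx; have Ix : O x by rewrite /= in_itv.
have [e|ne] := eqVneq p q.
  by rewrite (eq_on_D2 oI Ix hu) -e D2_quad_eq.
have xn : x != xi.
  apply/eqP => e; move: dx; rewrite e; apply: not_derivable_on_quad oI _ hu ne.
  by rewrite -e.
by rewrite (D2_on_quad oI Ix hu xn); case: ifP.
Qed.

Lemma switches_on_quad : switches O u p q xi.
Proof.
apply: ae_on_imp (ae_on_neq O xi) => x Ix xn; exact: D2_on_quad oI Ix hu xn.
Qed.

End quad_shape.

(** Both functions are bang-bang; the one of lower level is a competitor for the other with no more
    energy, hence equal to it. *)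
Lemma AM2_unique g u v : AM2 H a b u -> AM2 H a b v -> W2oog a b g u -> W2oog a b g v ->
  eq_on O u v.
Proof.
have key u' v' : AM2 H a b u' -> forall t m M p q xi t' m' M' p' q' xi',
    bang H t m M p q -> bang H t' m' M' p' q' ->
    switches O u' p q xi -> switches O v' p' q' xi' -> t' <= t ->
    W2oo0 O (v' \- u') -> eq_on O v' u'.
  move=> [Wu _] t m M p q xi t' m' M' p' q' xi' hb hb' su sv tt W0 x Ix.
  apply/eqP; rewrite -subr_eq0; apply/eqP.
  apply: (bang_strict_minimiser H0 H_ge0 H_slc ab hb Wu su W0 _ Ix).
  have -> : u' \+ (v' \- u') = v' by apply/funext => y /=; rewrite addrCA subrr addr0.
  by apply: le_trans (Eoo_bang H0 H_ge0 hb' sv) _; rewrite lee_fin.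
move=> hu hv gu gv.
have [t [m [M [p [q [xi [A [A' [hb axb qu]]]]]]]]] := AM2_is_quad H0 H_ge0 H_slc H_levels ab hu.
have [t' [m' [M' [p' [q' [xi' [B [B' [hb' axb' qv]]]]]]]]] := AM2_is_quad H0 H_ge0 H_slc H_levels ab hv.
have su := switches_on_quad qu; have sv := switches_on_quad qv.
have [tt|tt] := leP t' t.
  move=> x Ix; symmetry.
  exact: (key u v hu _ _ _ _ _ _ _ _ _ _ _ _ hb hb' su sv tt (W2oog_sub ab gv gu) x Ix).
exact: (key v u hv _ _ _ _ _ _ _ _ _ _ _ _ hb' hb sv su (ltW tt) (W2oog_sub ab gu gv)).
Qed.

Lemma AM2_exists g : W2 +oo%E O g -> exists u, AM2 H a b u /\ W2oog a b g u.
Proof.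
move=> Wg; have [t [m [M [p [q [xi [A [A' [hb axb W0]]]]]]]]] :=
  W2oo0_quad_sub H0 H_ge0 H_slc H_levels ab Wg.
exists (quad A A' a p q xi); split; last exact: W0.
by apply: AM2_quad axb hb.
Qed.

End structure.

(** * Convergence of approximate minimisers *)

Section estimates.
Variable R : realType.
Implicit Types (H : R -> R).

(** For [r > 1] one has [|X|^r >= |X| - 1]. The linear form is the one in which high powers of [H]
    dominate a fixed power of [X]. *)
Lemma linear_coercivity H (C1 C2 r : R) : 0 < C1 -> 0 < C2 -> 1 < r ->
  (forall X, C1 * `|X| `^ r - C2 <= H X) -> forall X, `|X| <= (H X + (C1 + C2)) / C1.
Proof.
move=> C10 C20 r1 hc X; rewrite ler_pdivlMr//.
have h := hc X.
have : `|X| - 1 <= `|X| `^ r.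
  have [X1|X1] := leP 1 `|X|.
    by rewrite (@le_trans _ _ `|X|) ?lerBlDr ?lerDl// -{1}(powRr1 (normr_ge0 X)) ler_powR// ltW.
  by rewrite (@le_trans _ _ 0) ?powR_ge0// subr_le0 ltW.
move=> h2; have : C1 * (`|X| - 1) <= C1 * `|X| `^ r by rewrite ler_wpM2l// ltW.
by move: h; lra.
Qed.

Lemma affine_sublevel (a b l1 l0 e : R) : a < b -> (l1 != 0) || (l0 != 0) -> 0 < e ->
  exists2 d : R, 0 < d &
    fine (lebesgue_measure (`]a, b[ `&` [set x : R | `|l1 * x + l0| < d])) <= e.
Proof.
move=> ab ln e0; have [l10|l1n] := eqVneq l1 0.
  rewrite l10 eqxx /= in ln.
  exists `|l0|; first by rewrite normr_gt0.
  rewrite (_ : _ `&` _ = set0) ?measure0 ?ltW//.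
  apply/seteqP; split => x //= -[_].
  by rewrite l10 mul0r add0r ltxx.
(* The sublevel set then lies in the interval of length [e] centred at the zero of the affine
   function. *)
exists (`|l1| * (e / 2)); first by rewrite mulr_gt0 ?normr_gt0// divr_gt0.
pose x0 := - l0 / l1.
have sub : `]a, b[ `&` [set x : R | `|l1 * x + l0| < `|l1| * (e / 2)] `<=` `[x0 - e / 2, x0 + e / 2].
  move=> x /= [_ h]; have : `|x - x0| < e / 2.
    rewrite -(@ltr_pM2l _ `|l1|) ?normr_gt0// -normrM mulrBr /x0 mulrCA divff// mulr1.
    by rewrite opprK.
  by rewrite in_itv /= ltr_distl => /andP[h1 h2]; rewrite !ltW.
have mA : measurable (`]a, b[%classic `&` [set x : R | `|l1 * x + l0| < `|l1| * (e / 2)]).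
  apply: measurableI => //.
  have c : continuous (fun x : R => `|l1 * x + l0|).
    move=> x; apply: cvg_norm; apply: cvgD; last exact: cvg_cst.
    by apply: cvgM; [exact: cvg_cst|exact: cvg_id].
  apply: open_measurable.
  have -> : [set x : R | `|l1 * x + l0| < `|l1| * (e / 2)] =
     (fun x : R => `|l1 * x + l0|) @^-1` `]-oo, `|l1| * (e / 2)[.
    by apply/seteqP; split => x /=; rewrite in_itv.
  by apply: open_comp => //; exact: interval_open.
have h : x0 - e / 2 <= x0 + e / 2 by move: e0; clear; lra.
have Ee : e = fine (lebesgue_measure `[x0 - e / 2, x0 + e / 2]%classic).
  by rewrite fine_itvcc//; field.
rewrite [X in _ <= X]Ee.
apply: fine_le.
- rewrite ge0_fin_numE//; apply: le_lt_trans (itvcc_fin (x0 - e / 2) (x0 + e / 2)).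
  by apply: le_measure => //; rewrite inE.
- by rewrite ge0_fin_numE//; exact: itvcc_fin.
- by apply: le_measure => //; rewrite inE.
Qed.

Section excess.
Variables (H : R -> R) (t m M C0 C3 : R).
Hypotheses (H0 : H 0 = 0) (H_ge0 : forall X, H 0 <= H X)
  (H_slc : strictly_level_convex H) (C00 : 0 < C0) (C30 : 0 <= C3)
  (H_lin : forall X, `|X| <= (H X + C3) / C0) (HL : level_set H t m M).

(** With [y = H X / s >= 1] one has [y <= y ^+ n]; the point is that the constant does not depend on
    [n]. *)
Lemma large_bound s X n (B : R) : 0 < s -> s <= H X -> (0 < n)%N -> 0 <= B ->
  (H X + C3) / C0 + B <= ((s + C3) / C0 + B) * (H X / s) ^+ n.
Proof.
move=> s0 sX n0 B0.
have c00 := C00; have c30 := C30.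
pose y := H X / s.
have y1 : 1 <= y by rewrite /y ler_pdivlMr// mul1r.
have yE : H X = y * s by rewrite /y divfK// gt_eqF.
have yn : y <= y ^+ n by exact: ler_eXnr.
rewrite -/y yE.
have K0 : 0 <= (s + C3) / C0 + B by rewrite addr_ge0// divr_ge0 ?ltW// ltr_pwDl.
apply: (@le_trans _ _ (((s + C3) / C0 + B) * y)); last by rewrite ler_wpM2l.
rewrite [leRHS]mulrDl; apply: lerD; last by rewrite ler_peMr.
by rewrite [leRHS]mulrAC ler_pM2r ?invr_gt0// [leRHS]mulrDl [s * y]mulrC lerD2l ler_peMr.
Qed.

(* Bounds the violation of the constraint [m <= X <= M] by an integrable
   penalty, so that the multiplier inequality survives for near-minimisers. *)
Lemma excess_bound (eta : R) : 0 < eta -> exists s K : R, [/\ t < s, 0 <= K &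
  forall X n, (0 < n)%N ->
    pos (X - M) + pos (m - X) <= 2 * eta + K * (H X / s) ^+ n].
Proof.
move=> eta0; have [t0 m0 M0 Hm HM] := HL.
have Mlt : M < M + eta by rewrite ltrDl.
have mlt : m - eta < m by rewrite gtrBl.
have s1 : t < H (M + eta) by rewrite -HM; exact: slc_incr.
have s2 : t < H (m - eta) by rewrite -Hm; exact: slc_decr.
(* The lower of the two energies at distance [eta] outside [[m, M]]: below [s] the violation is at
   most [eta] on either side, and from [s] on the linear bound takes over. *)
pose s := Num.min (H (M + eta)) (H (m - eta)).
have ts : t < s by rewrite lt_min s1.
have s0 : 0 < s by exact: le_lt_trans ts.
have c00 := C00; have c30 := C30.
have K0 : 0 <= 2 * ((s + C3) / C0) by rewrite mulr_ge0// divr_ge0 ?ltW// ltr_pwDl.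
exists s, (2 * ((s + C3) / C0)); split => // X n n0.
have pw : 0 <= (H X / s) ^+ n.
  have HX0 : 0 <= H X by rewrite -H0.
  by apply: exprn_ge0; apply: divr_ge0 => //; exact: ltW.
have [sX|Xs] := leP s (H X).
  have hb := large_bound s0 sX n0 (lexx 0); rewrite !addr0 in hb.
  have hX := le_trans (H_lin X) hb.
  have p1 : pos (X - M) <= `|X|.
    have := ler_norm X; have := normr_ge0 X; rewrite /pos ge_max; move: M0; lra.
  have p2 : pos (m - X) <= `|X|.
    have := ler_norm (- X); have := normr_ge0 X; rewrite normrN /pos ge_max; move: m0; lra.
  by move: p1 p2 hX eta0; lra.
have XM : X <= M + eta.
  rewrite leNgt; apply/negP => h; have h0 : 0 <= M + eta by rewrite addr_ge0// ltW.
  have := slc_incr H0 H_ge0 H_slc h0 h.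
  by rewrite ltNge ltW// (lt_le_trans Xs)// ge_min lexx.
have mX : m - eta <= X.
  rewrite leNgt; apply/negP => h; have h0 : m - eta <= 0 by rewrite (le_trans (ltW mlt)).
  have := slc_decr H0 H_ge0 H_slc h h0.
  by rewrite ltNge ltW// (lt_le_trans Xs)// ge_min lexx orbT.
have p1 : pos (X - M) <= eta by rewrite /pos ge_max ltW//= lerBlDr addrC.
have p2 : pos (m - X) <= eta by rewrite /pos ge_max ltW//= lerBlDr -lerBlDl.
have K1 : 0 <= 2 * ((s + C3) / C0) * (H X / s) ^+ n by rewrite mulr_ge0.
by move: p1 p2 K1; lra.
Qed.

End excess.

End estimates.

(** * Convergence of the second derivatives of near-minimisers *)

Section near_minimisers.
Variable R : realType.
Local Notation mu := (@lebesgue_measure R).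
Variables (H : R -> R) (t m M p q xi C0 C3 : R).
Hypotheses (H_cont : continuous H) (H0 : H 0 = 0) (H_ge0 : forall X, H 0 <= H X)
  (H_slc : strictly_level_convex H) (C00 : 0 < C0) (C30 : 0 <= C3)
  (H_lin : forall X, `|X| <= (H X + C3) / C0) (hb : bang H t m M p q).
Variables (a b : R) (u : R -> R) (u_ : nat -> R -> R).
Local Notation O := (`]a, b[%classic : set R).
Hypotheses (ab : a < b) (Wu : W2 +oo%E O u) (hu : switches O u p q xi)
  (hW : forall n, (0 < n)%N -> W2oo0 O (u_ n \- u))
  (hI : forall n, (0 < n)%N ->
    \int[mu]_(x in O) (H (D2 (u_ n) x) ^+ n) <= (b - a) * (t ^+ n + 2 ^- (n ^ 2))).

Let mO : measurable O. Proof. by []. Qed.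
Let fO : (mu O < +oo)%E. Proof. exact: itv_fin. Qed.
Let ba : 0 < b - a. Proof. by rewrite subr_gt0. Qed.
Let t0 : 0 <= t. Proof. by case: hb => -[]. Qed.
Let H_nneg X : 0 <= H X. Proof. by rewrite -H0. Qed.

Local Notation f n := (D2 (u_ n \- u)).
Local Notation w n := (D2 (u_ n)).

Lemma aeb_f n : (0 < n)%N -> aeb O (f n).
Proof. by move=> /hW[/W2ooP[]]. Qed.

Lemma W2_u_ n : (0 < n)%N -> W2 +oo%E O (u_ n).
Proof. by move=> /hW h; exact: (W2oog_W2 Wu h). Qed.

Lemma aeb_w n : (0 < n)%N -> aeb O (w n).
Proof. by move=> /W2_u_/W2ooP[]. Qed.

Lemma aeb_Hw n k s : (0 < n)%N -> aeb O (fun x => (H (w n x) / s) ^+ k).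
Proof.
move=> n0; apply: aebX.
have -> : (fun x => H (w n x) / s) = (fun x => s^-1 * H (w n x)).
  by apply/funext => x; rewrite mulrC.
by apply: aebZ; apply: (aeb_comp H_cont); exact: aeb_w.
Qed.

Lemma w_split n : (0 < n)%N ->
  ae_on O (fun x => w n x = (if x < xi then p else q) + f n x).
Proof.
move=> n0; have [Wf _] := hW n0.
have h := derive2_lin 1 Wu Wf.
have E : u_ n = fun x => 1 * u x + (u_ n \- u) x by apply/funext => x; rewrite /=; ring.
rewrite -E in h; apply: ae_on_imp2 h hu => x _ -> ->.
by rewrite mul1r.
Qed.

(** Dividing by [s ^+ n] leaves [(t / s) ^+ n] and [((1 / 2) ^+ n / s) ^+ n]. The second tends to 0
    even for small [s]; a tolerance [2 ^- n] would not achieve this. *)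
Lemma J_cvg s : t < s -> forall e : R, 0 < e -> \forall n \near \oo, (0 < n)%N /\
  \int[mu]_(x in O) ((H (w n x) / s) ^+ n) <= e.
Proof.
move=> ts e e0; have s0 : 0 < s := le_lt_trans t0 ts.
have c1 : (t / s) ^+ n @[n --> \oo] --> (0 : R).
  apply: cvg_expr; rewrite ger0_norm; last by apply: divr_ge0; [exact: t0|exact: ltW].
  by rewrite ltr_pdivrMr// mul1r.
have c2 : (1 / 2 : R) ^+ n @[n --> \oo] --> (0 : R).
  by apply: cvg_expr; rewrite ger0_norm//; lra.
pose e1 := e / 2 / (b - a); have e10 : 0 < e1 by rewrite !divr_gt0.
have s20 : 0 < s / 2 by rewrite divr_gt0.
near=> n.
have n0 : (0 < n)%N by near: n; exists 1%N.
split => //.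
have a1 : (t / s) ^+ n <= e1 by near: n; apply: (cvgr_le _ c1).
have a2 : (1 / 2 : R) ^+ n <= e1 by near: n; apply: (cvgr_le _ c2).
have a3 : (1 / 2 : R) ^+ n <= s / 2 by near: n; apply: (cvgr_le _ c2).
have -> : \int[mu]_(x in O) ((H (w n x) / s) ^+ n) = s ^- n * \int[mu]_(x in O) (H (w n x) ^+ n).
  rewrite -I_Z//; last by apply: aebX; apply: (aeb_comp H_cont); exact: aeb_w.
  by apply: eq_Rintegral => x _; rewrite expr_div_n mulrC.
have sn0 : 0 < s ^+ n by exact: exprn_gt0.
apply: (@le_trans _ _ (s ^- n * ((b - a) * (t ^+ n + 2 ^- (n ^ 2))))).
  by apply: ler_wpM2l; [rewrite invr_ge0 ltW|exact: hI].
have -> : s ^- n * ((b - a) * (t ^+ n + 2 ^- (n ^ 2))) = (b - a) * ((t / s) ^+ n + ((1 / 2) ^+ n / s) ^+ n).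
  rewrite mulrCA; congr (_ * _); rewrite mulrDr; congr (_ + _).
    by rewrite expr_div_n mulrC.
  by rewrite expr_div_n -exprM mulnn mulrC expr_div_n expr1n div1r.
have a4 : ((1 / 2) ^+ n / s) ^+ n <= (1 / 2) ^+ n.
  apply: lerXn2r; rewrite ?nnegrE.
  - by rewrite divr_ge0 ?ltW// exprn_ge0//; lra.
  - lra.
  - by rewrite ler_pdivrMr//; move: a3; lra.
have : (t / s) ^+ n + ((1 / 2) ^+ n / s) ^+ n <= e1 + e1 by apply: lerD => //; exact: le_trans a2.
move=> h; apply: (@le_trans _ _ ((b - a) * (e1 + e1))); first by rewrite ler_pM2l.
by rewrite /e1 le_eqVlt; apply/orP; left; apply/eqP; field; rewrite gt_eqF.
Unshelve. all: by end_near. Qed.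

(** Since [l * f n] has integral zero, it may be added to its absolute value under the integral; the
    multiplier inequality bounds the sum by the violation of the constraint. *)
Lemma weighted_cvg : exists l1 l0 : R, (l1 != 0) || (l0 != 0) /\
  forall e : R, 0 < e -> \forall n \near \oo, (0 < n)%N /\
    \int[mu]_(x in O) `|(l1 * x + l0) * f n x| <= e.
Proof.
have [l1 [l0 [ln hl]]] := bang_multiplier xi hb.
exists l1, l0; split => // e e0.
pose L := `|l1| * (`|a| + `|b|) + `|l0| + 1.
have L0 : 0 < L by rewrite ltr_wpDl// addr_ge0// mulr_ge0// addr_ge0.
have Lx x : O x -> `|l1 * x + l0| <= L.
  rewrite /= in_itv /= => /andP[ax xb].
  rewrite (le_trans (ler_normD _ _))// normrM /L -addrA lerD//; last by rewrite lerDl.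
  rewrite ler_wpM2l// ler_norml; have := ler_norm b; have := ler_norm (- a).
  by rewrite normrN; have := normr_ge0 a; have := normr_ge0 b; move: ax xb; lra.
(* [eta] and [e1] are such that [2 * L * (2 * eta * (b - a) + (K + 1) * e1) = e], each summand
   contributing [e / 2]. *)
pose eta := e / (8 * L * (b - a)).
have eta0 : 0 < eta by rewrite divr_gt0// !mulr_gt0.
have [s [K [ts K0 hs]]] := excess_bound H0 H_ge0 H_slc C00 C30 H_lin hb.1 eta0.
pose e1 := e / (4 * L * (K + 1)).
have K10 : 0 < K + 1 by rewrite ltr_wpDl.
have e10 : 0 < e1 by rewrite divr_gt0// !mulr_gt0.
apply: filterS (J_cvg ts e10) => n [n0 hJ]; split => //.
have bl := affine_aeb a b l1 l0.
have bf := aeb_f n0.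
have blf : aeb O (fun x => (l1 * x + l0) * f n x) by exact: aebM.
have mom := W2oo0_moment l1 l0 ab (hW n0).
have bJ := aeb_Hw n s n0.
have bR : aeb O (fun x => 2 * L * (2 * eta + K * (H (w n x) / s) ^+ n)).
  by apply: aebZ; apply: aebD; [exact: aeb_cst|exact: aebZ].
have -> : \int[mu]_(x in O) `|(l1 * x + l0) * f n x| =
   \int[mu]_(x in O) (`|(l1 * x + l0) * f n x| + (l1 * x + l0) * f n x).
  by rewrite I_D//; [rewrite mom addr0|exact: aeb_norm].
apply: (@le_trans _ _ (\int[mu]_(x in O) (2 * L * (2 * eta + K * (H (w n x) / s) ^+ n)))).
  apply: I_le => //; first by apply: aebD => //; exact: aeb_norm.
  apply: ae_on_imp2 (w_split n0) (ae_on_neq O xi) => x Ox hw xn.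
  have := hl x (w n x) xn; lazy zeta.
  have cancel (X Y : R) : X + Y - X = Y by ring.
  rewrite hw cancel -hw -normrM => h.
  apply: (le_trans h); rewrite -mulrA -[leRHS]mulrA ler_pM2l// mulrC.
  by apply: ler_pM => //; [rewrite addr_ge0// /pos le_max lexx|exact: Lx|exact: hs].
rewrite I_Z//; last by apply: aebD; [exact: aeb_cst|exact: aebZ].
rewrite I_D//; [|exact: aeb_cst|exact: aebZ].
rewrite (I_Z mO fO K)//.
have -> : \int[mu]_(_ in O) (2 * eta) = 2 * eta * (b - a).
  by rewrite (Rintegral_cst mu mO (2 * eta)) fine_itv// ltW.
set J := Rintegral _ _ _ in hJ *.
have KJ : K * J <= (K + 1) * e1.
  by apply: (@le_trans _ _ (K * e1)); [rewrite ler_wpM2l|rewrite ler_wpM2r ?ltW// ltrDl].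
have -> : e = 2 * L * (2 * eta * (b - a) + (K + 1) * e1).
  by rewrite /eta /e1; field; rewrite !gt_eqF.
by rewrite ler_pM2l ?mulr_gt0// lerD2l.
Unshelve. all: by end_near. Qed.

(* Three regions: near the zero of [l1 x + l0] the set is small; away from it [f]
   is controlled by [(l1 x + l0) f]; where [H (w n x) >= t + 1] the n-th power of
   the energy dominates every fixed power of [w]. *)
Lemma power_cvg k : forall e : R, 0 < e -> \forall n \near \oo, (0 < n)%N /\
    \int[mu]_(x in O) (`|f n x| ^+ k.+1) <= e.
Proof.
move=> e e0; have [l1 [l0 [ln hA]]] := weighted_cvg.
pose S := t + 1; have S0 : 0 < S by rewrite ltr_wpDl.
have tS : t < S by rewrite ltrDl.
pose B := `|p| + `|q|; have B0 : 0 <= B by rewrite addr_ge0.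
(* Bounds [f n] in absolute value where [H (w n x) < S]; the added 1 makes the powers of [K]
   nondecreasing. *)
pose K := (S + C3) / C0 + B + 1.
have K1 : 1 <= K by rewrite lerDr addr_ge0// divr_ge0 ?ltW// ltr_pwDl.
have K0 : 0 < K by exact: lt_le_trans K1.
pose Kk := K ^+ k.+1; have Kk0 : 0 < Kk by exact: exprn_gt0.
pose e1 := e / (3 * Kk); have e10 : 0 < e1 by rewrite divr_gt0// mulr_gt0.
have [d d0 hd] := affine_sublevel ab ln e10.
pose D := O `&` [set x : R | `|l1 * x + l0| < d].
have mD : measurable D.
  apply: measurableI => //.
  have c : continuous (fun x : R => `|l1 * x + l0|).
    move=> x; apply: cvg_norm; apply: cvgD; last exact: cvg_cst.
    by apply: cvgM; [exact: cvg_cst|exact: cvg_id].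
  apply: open_measurable.
  have -> : [set x : R | `|l1 * x + l0| < d] = (fun x : R => `|l1 * x + l0|) @^-1` `]-oo, d[.
    by apply/seteqP; split => x /=; rewrite in_itv.
  by apply: open_comp => //; exact: interval_open.
have ed0 : 0 < e1 * d by rewrite mulr_gt0.
near=> n.
have [n0 hJ] : (0 < n)%N /\ \int[mu]_(x in O) ((H (w n x) / S) ^+ n) <= e1.
  by near: n; exact: J_cvg.
have [_ hL] : (0 < n)%N /\ \int[mu]_(x in O) `|(l1 * x + l0) * f n x| <= e1 * d.
  by near: n; exact: hA.
have kn : (k.+1 <= n)%N by near: n; exists k.+1.
split => //.
have bf := aeb_f n0.
have blf : aeb O (fun x => `|(l1 * x + l0) * f n x|).
  by apply: aeb_norm; apply: aebM => //; exact: affine_aeb.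
have bJ := aeb_Hw n S n0.
have bi : aeb O (\1_D : R -> R) by exact: aeb_indic.
have b1 : aeb O (fun x => \1_D x + d^-1 * `|(l1 * x + l0) * f n x|) by apply: aebD => //; exact: aebZ.
have bb := aebD b1 bJ.
(* One term for each region, each with integral at most [e1 = e / (3 * Kk)]. *)
apply: (@le_trans _ _ (\int[mu]_(x in O) (Kk * (\1_D x + d^-1 * `|(l1 * x + l0) * f n x| + (H (w n x) / S) ^+ n)))).
  apply: I_le => //; [by apply: aebX; exact: aeb_norm|exact: aebZ|].
  apply: ae_on_imp (w_split n0) => x Ox hw.
  have w0b : `|if x < xi then p else q| <= B by case: ifP => _; rewrite ?lerDl ?lerDr.
  have fX : `|f n x| <= `|w n x| + B.
    have -> : f n x = w n x - (if x < xi then p else q) by rewrite hw addrC addKr.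
    by rewrite (le_trans (ler_normB _ _))// lerD2l.
  have y0 : 0 <= H (w n x) / S by rewrite divr_ge0// ltW.
  have p1 : 0 <= \1_D x :> R by rewrite indicE.
  have p2 : 0 <= d^-1 * `|(l1 * x + l0) * f n x| by rewrite mulr_ge0// invr_ge0 ltW.
  have p3 : 0 <= (H (w n x) / S) ^+ n by exact: exprn_ge0.
  have [SH|HS] := leP S (H (w n x)).
    have h1 : `|f n x| <= K * (H (w n x) / S) ^+ 1.
      apply: (le_trans fX); apply: (@le_trans _ _ ((H (w n x) + C3) / C0 + B)); first by rewrite lerD2r.
      apply: (le_trans (large_bound C00 C30 S0 SH (ltn0Sn 0) B0)).
      by rewrite ler_wpM2r ?exprn_ge0// lerDl.
    rewrite expr1 in h1.
    have h2 : `|f n x| ^+ k.+1 <= (K * (H (w n x) / S)) ^+ k.+1.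
      by apply: lerXn2r => //; rewrite nnegrE// mulr_ge0// ltW.
    apply: (le_trans h2); rewrite exprMn ler_pM2l//.
    have h3 : (H (w n x) / S) ^+ k.+1 <= (H (w n x) / S) ^+ n.
      by apply: ler_weXn2l => //; rewrite ler_pdivlMr// mul1r.
    by apply: (le_trans h3); rewrite lerDr addr_ge0.
  have h1 : `|f n x| <= K.
    apply: (le_trans fX); rewrite /K -addrA lerD//; last by rewrite lerDl.
    by apply: (le_trans (H_lin _)); rewrite ler_pM2r ?invr_gt0// lerD2r ltW.
  have h2 : `|f n x| ^+ k.+1 <= Kk by apply: lerXn2r => //; rewrite nnegrE// ltW.
  have [xd|dx] := ltP `|l1 * x + l0| d.
    apply: (le_trans h2); rewrite -{1}(mulr1 Kk) ler_pM2l// indicE mem_set /=; last by split.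
    by rewrite -addrA lerDl addr_ge0.
  have h3 : `|f n x| <= d^-1 * `|(l1 * x + l0) * f n x|.
    by rewrite ler_pdivlMl// normrM ler_wpM2r.
  (* All but one of the [k + 1] factors are bounded by [K]; the remaining one is controlled by
     [l * f n]. *)
  have h4 : `|f n x| ^+ k.+1 <= Kk * `|f n x|.
    rewrite exprSr /Kk ler_wpM2r//; apply: (@le_trans _ _ (K ^+ k)).
      by apply: lerXn2r => //; rewrite nnegrE// ltW.
    by rewrite exprSr ler_peMr// exprn_ge0// ltW.
  apply: (le_trans h4); rewrite ler_pM2l//; apply: (le_trans h3).
  by rewrite -addrA addrCA lerDl addr_ge0.
rewrite I_Z// I_D// I_D//; last exact: aebZ.
rewrite I_Z// I_indic//; last by move=> x [].
set J := Rintegral _ _ _ in hJ *; set L := Rintegral _ _ _ in hL *.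
have dL : d^-1 * L <= e1 by rewrite ler_pdivrMl// mulrC.
have -> : e = Kk * (e1 + e1 + e1) by rewrite /e1; field; rewrite gt_eqF.
by rewrite ler_pM2l//; apply: lerD => //; apply: lerD.
Unshelve. all: by end_near. Qed.

End near_minimisers.

(** * Strong convergence in W^{2,q} *)

Section Lq_norms.
Variable R : realType.
Local Notation mu := (@lebesgue_measure R).
Variable D : set R.
Hypotheses (mD : measurable D) (fD : (mu D < +oo)%E).
Implicit Types (h : R -> R) (q e : R).

Lemma aeb_powR h q : 0 <= q -> aeb D h -> aeb D (fun x => `|h x| `^ q).
Proof.
move=> q0 bh; have [mh [K hK]] := aeb_norm bh; split.
  exact: (measurableT_comp (@measurable_powR R q) mh).
exists (`|K| `^ q); apply: ae_on_imp hK => x _ h1.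
rewrite ger0_norm ?powR_ge0//; apply: ge0_ler_powR; rewrite ?nnegrE//.
by rewrite normr_id in h1; rewrite (le_trans h1)// ler_norm.
Qed.

Lemma Lnorm_on_le h q e : 0 < q -> 0 <= e -> aeb D h ->
  \int[mu]_(x in D) (`|h x| `^ q) <= e `^ q -> (Lnorm_on q%:E D h <= e%:E)%E.
Proof.
move=> q0 e0 bh hI; rewrite /Lnorm_on unlock /=.
have -> : (\int[mu]_x (`|((EFin \o h) \_ D) x| `^ q) = (\int[mu]_(x in D) (`|h x| `^ q))%:E)%E.
  rewrite -I_EFin//; last by apply: aeb_powR => //; exact: ltW.
  rewrite [RHS]integral_mkcond; apply: eq_integral => x _.
  rewrite !patchE; case: ifPn => _ //=.
  by rewrite normr0 powR0// gt_eqF.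
rewrite poweR_EFin lee_fin.
have -> : e = (e `^ q) `^ q^-1 by rewrite -powRrM mulfV ?gt_eqF// powRr1.
apply: ge0_ler_powR => //; rewrite ?nnegrE ?invr_ge0 ?powR_ge0 ?(ltW q0)//.
by apply: Rintegral_ge0 => x _; exact: powR_ge0.
Qed.

(** The factor [fine (mu D) + 1] dominates [mu D] to the power [1 / q] for all [q >= 1] at once. *)
Lemma Lnorm_on_bounded h q (K : R) : 1 <= q -> 0 <= K -> aeb D h ->
  ae_on D (fun x => `|h x| <= K) ->
  (Lnorm_on q%:E D h <= (K * (fine (mu D) + 1))%:E)%E.
Proof.
move=> q1 K0 bh hK; have q0 : 0 < q by exact: lt_le_trans q1.
have L0 : 0 <= fine (mu D) by exact: fine_ge0.
have L1 : 1 <= fine (mu D) + 1 by rewrite lerDr.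
have L2 : 0 <= fine (mu D) + 1 by exact: le_trans L1.
apply: Lnorm_on_le => //; first exact: mulr_ge0.
rewrite powRM//; apply: (@le_trans _ _ (K `^ q * fine (mu D))); last first.
  apply: ler_wpM2l; first exact: powR_ge0.
  apply: (@le_trans _ _ (fine (mu D) + 1)); first by rewrite lerDl.
  by rewrite -{1}(powRr1 L2); apply: ler_powR.
apply: le_trans (ler_norm _) _; apply: I_norm_le => //.
  by apply: aeb_powR => //; exact: ltW.
apply: ae_on_imp hK => x _ hx; rewrite ger0_norm ?powR_ge0//.
by apply: ge0_ler_powR; rewrite ?nnegrE// ltW.
Qed.

Lemma aeb_Lebesgue_space h q : 1 <= q -> aeb D h -> Lebesgue_space q%:E D h.
Proof.
move=> q1 bh; split; first by case: bh.
have [_ [K hK]] := bh.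
apply: le_lt_trans (@Lnorm_on_bounded h q `|K| q1 _ bh _) _ => //; last exact: ltry.
by apply: ae_on_imp hK => x _ hx; rewrite (le_trans hx)// ler_norm.
Qed.

(** The first term dominates for [x <= 1], the integer power for [x > 1]; this passes from integer
    to real exponents. *)
Lemma powR_le_interpolation (x q : R) k : 0 <= x -> 1 <= q -> q <= k.+1%:R ->
  x `^ q <= x + x ^+ k.+1.
Proof.
move=> x0 q1 qk; have p0 : 0 <= x ^+ k.+1 by exact: exprn_ge0.
have [->|xn0] := eqVneq x 0; first by rewrite powR0 ?add0r ?expr0n// gt_eqF// (lt_le_trans _ q1).
have xp : 0 < x by rewrite lt_def xn0.
have [x1|x1] := leP x 1.
  apply: (@le_trans _ _ x); last by rewrite lerDl.
  by rewrite -{2}(powRr1 x0); apply: ger_powR => //; rewrite xp.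
apply: (@le_trans _ _ (x ^+ k.+1)); last by rewrite lerDr.
by rewrite -powR_mulrn//; apply: ler_powR => //; exact: ltW.
Qed.

End Lq_norms.

Section weak_convergence.
Variable R : realType.
Local Notation mu := (@lebesgue_measure R).
Variables (a b : R) (u : R -> R) (u_ : nat -> R -> R).
Hypothesis ab : a < b.
Local Notation O := (`]a, b[%classic : set R).

Let mO : measurable O. Proof. by []. Qed.
Let fO : (mu O < +oo)%E. Proof. exact: itv_fin. Qed.

Lemma W2oo_W2 v (q : R) : 1 <= q -> W2 +oo%E O v -> W2 q%:E O v.
Proof.
move=> q1 [hC h0 h1 h2 hw]; split.
- exact: hC.
- by apply: aeb_Lebesgue_space => //; exact/Lebesgue_oo_aeb.
- by apply: aeb_Lebesgue_space => //; exact/Lebesgue_oo_aeb.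
- by apply: aeb_Lebesgue_space => //; exact/Lebesgue_oo_aeb.
- exact: hw.
Qed.

(** A Poincare inequality from the zero trace of [D1 phi] at [a]; it reduces the [W^{2,q}] norm to
    second derivatives. *)
Lemma W2oo0_derive_bound phi x : W2oo0 O phi -> O x ->
  `|D1 phi x| <= \int[mu]_(y in O) `|D2 phi y|.
Proof.
move=> /(W2oo0P _ ab)[W [_ h _ _]] Ox.
have /W2ooP[_ _ _ b2 _] := W.
have [ax xb] : a < x /\ x < b by move: Ox; rewrite /= in_itv /= => /andP[].
have c1 : `|D1 phi x - D1 phi y| @[y --> a^'+] --> `|D1 phi x - 0|.
  by apply: cvg_norm; apply: cvgB => //; exact: cvg_cst.
rewrite -[D1 phi x]subr0; apply: (cvgr_to_le c1).
near=> y.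
have ay : a < y by near: y; exact: nbhs_right_gt.
have yx : y <= x by near: y; exact: nbhs_right_le.
have sub := subset_cc_oo ay xb.
rewrite (W2_FTC W ay yx xb).
have mI : measurable (`[y, x]%classic : set R) by [].
apply: (le_trans (I_norm mI (itvcc_fin y x) (aeb_sub mO sub b2))).
by apply: I_subset => //; exact: aeb_norm.
Unshelve. all: by end_near. Qed.

Lemma W2oo0_bound phi x : W2oo0 O phi -> O x ->
  `|phi x| <= (b - a) * \int[mu]_(y in O) `|D2 phi y|.
Proof.
move=> W0 Ox; have [W [h _ _ _]] := (W2oo0P _ ab).1 W0.
have /W2ooP[hC _ _ b2 _] := W.
set N := Rintegral _ _ _.
have [ax xb] : a < x /\ x < b by move: Ox; rewrite /= in_itv /= => /andP[].
have c1 : `|phi x - phi y| @[y --> a^'+] --> `|phi x - 0|.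
  by apply: cvg_norm; apply: cvgB => //; exact: cvg_cst.
rewrite -[phi x]subr0; apply: (cvgr_to_le c1).
near=> y.
have ay : a < y by near: y; exact: nbhs_right_gt.
have yx : y <= x by near: y; exact: nbhs_right_le.
have d1 z : z \in `]y, x[%R -> is_derive z 1 phi (D1 phi z).
  rewrite in_itv /= => /andP[yz zx]; apply: (C1_on_is_derive hC).
  by rewrite /= in_itv /= (lt_trans ay yz) (lt_trans zx xb).
have d2 : {within `[y, x], continuous phi}.
  apply: continuous_in_subspaceT => z; rewrite inE /= in_itv /= => /andP[yz zx].
  apply: (C1_on_continuous hC).
  by rewrite /= in_itv /= (lt_le_trans ay yz) (le_lt_trans zx xb).
have [z zyx ->] := MVT_segment yx d1 d2.
have Oz : O z.
  move: zyx; rewrite /= !in_itv /= => /andP[yz zx].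
  by rewrite (lt_le_trans ay yz) (le_lt_trans zx xb).
rewrite normrM (@ger0_norm _ (x - y)) ?subr_ge0// mulrC.
apply: ler_pM => //; rewrite ?subr_ge0//; first by rewrite lerB// ltW.
exact: W2oo0_derive_bound.
Unshelve. all: by end_near. Qed.

Hypotheses (Wu : W2 +oo%E O u) (hW : forall n, (0 < n)%N -> W2oo0 O (u_ n \- u))
  (hP : forall k (e : R), 0 < e -> \forall n \near \oo, (0 < n)%N /\
     \int[mu]_(x in O) (`|D2 (u_ n \- u) x| ^+ k.+1) <= e).

Lemma W2_norm_cvg0 (q e : R) : 1 <= q -> 0 < e -> \forall n \near \oo, (0 < n)%N /\
  (W2_norm q%:E O (u_ n \- u)%R <= e%:E)%E.
Proof.
move=> q1 e0; have q0 : 0 < q by exact: lt_le_trans q1.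
have ba : 0 < b - a by rewrite subr_gt0.
pose e3 := e / 3; have e30 : 0 < e3 by rewrite divr_gt0.
pose L := b - a + 1; have L0 : 0 < L by rewrite addr_gt0.
(* An integer exponent [k.+1] above [q]; each of the two terms of the interpolation then receives
   half of [e3] to the power [q]. *)
pose k := Num.truncn q; have qk : q <= k.+1%:R by exact/ltW/truncnS_gt.
pose d := e3 `^ q / 2; have d0 : 0 < d by rewrite divr_gt0// powR_gt0.
pose d1 := e3 / L; have d10 : 0 < d1 by rewrite divr_gt0.
pose d2 := e3 / L / (b - a); have d20 : 0 < d2 by rewrite !divr_gt0.
near=> n.
have [n0 i1] : (0 < n)%N /\ \int[mu]_(x in O) (`|D2 (u_ n \- u) x| ^+ 1) <= d.
  by near: n; exact: hP.
have [_ i2] : (0 < n)%N /\ \int[mu]_(x in O) (`|D2 (u_ n \- u) x| ^+ k.+1) <= d.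
  by near: n; exact: hP.
have [_ i3] : (0 < n)%N /\ \int[mu]_(x in O) (`|D2 (u_ n \- u) x| ^+ 1) <= d1.
  by near: n; exact: hP.
have [_ i4] : (0 < n)%N /\ \int[mu]_(x in O) (`|D2 (u_ n \- u) x| ^+ 1) <= d2.
  by near: n; exact: hP.
split; first exact: n0.
have W0 := hW n0; move: (u_ n \- u) W0 i1 i2 i3 i4 => phi W0 i1 i2 i3 i4.
have [/W2ooP[_ c0 c1 c2 _] _] := W0.
have E : \int[mu]_(x in O) (`|D2 phi x| ^+ 1) = \int[mu]_(x in O) `|D2 phi x|.
  by apply: eq_Rintegral => x _; rewrite expr1.
rewrite E in i1 i3 i4.
have LE : fine (mu O) + 1 = L by rewrite fine_itv// ltW.
have e3L : d1 * L = e3 by rewrite /d1 divfK// gt_eqF.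
have b0 : (Lnorm_on q%:E O phi <= e3%:E)%E.
  rewrite -e3L -LE; apply: Lnorm_on_bounded => //; first exact: ltW.
  apply: ae_onW => x Ox; apply: (le_trans (W2oo0_bound W0 Ox)).
  by rewrite mulrC -ler_pdivlMr.
have b1 : (Lnorm_on q%:E O (D1 phi) <= e3%:E)%E.
  rewrite -e3L -LE; apply: Lnorm_on_bounded => //; first exact: ltW.
  by apply: ae_onW => x Ox; apply: (le_trans (W2oo0_derive_bound W0 Ox)).
have b2 : (Lnorm_on q%:E O (D2 phi) <= e3%:E)%E.
  apply: Lnorm_on_le => //; first exact: ltW.
  have n2 : aeb O (fun x => `|D2 phi x| ^+ k.+1) by apply: aebX; exact: aeb_norm.
  apply: (@le_trans _ _ (\int[mu]_(x in O) (`|D2 phi x| + `|D2 phi x| ^+ k.+1))).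
    apply: I_le => //; [by apply: aeb_powR => //; exact: ltW|by apply: aebD => //; exact: aeb_norm|].
    by apply: ae_onW => x _; exact: powR_le_interpolation.
  rewrite I_D//; last exact: aeb_norm.
  by rewrite [leRHS]splitr; exact: lerD.
have -> : e = e3 + e3 + e3 by rewrite /e3; field.
by rewrite /W2_norm !EFinD; apply: leeD => //; exact: leeD.
Unshelve. all: by end_near. Qed.

(** A bounded functional turns convergence in norm into convergence of its values. The shift avoids
    [u_ 0], about which nothing is known. *)
Lemma W2_weak_cvgS (q : R) : 1 <= q -> W2_weak_cvg q%:E O (fun j => u_ j.+1) u.
Proof.
move=> q1 l [lin [C hC]].
suff h : l (u_ n) @[n --> \oo] --> l u by rewrite (cvg_shiftS (fun n => l (u_ n))).
apply/cvgrPdist_le => e e0.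
pose e1 := e / (`|C| + 1).
have C1 : 0 < `|C| + 1 by rewrite ltr_wpDl.
have e10 : 0 < e1 by rewrite divr_gt0.
apply: filterS (W2_norm_cvg0 q1 e10) => n [n0 hn].
have [Wp _] := hW n0.
have Wq := W2oo_W2 q1 Wp.
have E : u_ n = (fun x => 1 * (u_ n \- u) x + u x) by apply/funext => x /=; ring.
have El : l (u_ n) = 1 * l (u_ n \- u) + l u by rewrite {1}E; apply: (lin 1 _ _ Wq); exact: W2oo_W2.
have E2 : l u - l (u_ n) = - l (u_ n \- u) by rewrite El; ring.
rewrite E2 normrN -lee_fin; apply: (le_trans (hC _ Wq)).
have N0 : (0 <= W2_norm q%:E O (u_ n \- u)%R)%E by rewrite /W2_norm !adde_ge0// Lnorm_ge0.
apply: (@le_trans _ _ ((`|C| + 1)%:E * e1%:E)%E).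
  apply: (@le_trans _ _ ((`|C| + 1)%:E * W2_norm q%:E O (u_ n \- u)%R)%E).
    apply: lee_wpmul2r => //; rewrite lee_fin; apply: le_trans (ler_norm C) _.
    by rewrite lerDl.
  by apply: lee_wpmul2l => //; rewrite lee_fin ltW.
by rewrite -EFinM lee_fin /e1 mulrC divfK// gt_eqF.
Qed.

End weak_convergence.

Section limn_einf_bound.
Variable R : realType.

Lemma limn_einf_ge (v : (\bar R)^nat) (x : \bar R) :
  (\forall n \near \oo, (x <= v n)%E) -> (x <= limn_einf v)%E.
Proof.
move=> [N _ hN]; rewrite limn_einf_lim; apply: lime_ge; first exact: is_cvg_einfs.
exists N => // n /= Nn; apply: le_ereal_inf_tmp => _ [k /= nk <-].
by apply: hN => /=; exact: leq_trans nk.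
Qed.

End limn_einf_bound.

Section mean_energy.
Variable R : realType.
Local Notation mu := (@lebesgue_measure R).
Variables (H : R -> R).
Hypotheses (H_cont : continuous H) (H0 : H 0 = 0) (H_ge0 : forall X, H 0 <= H X).
Variable D : set R.
Hypotheses (mD : measurable D) (fD : (mu D < +oo)%E).
Implicit Types (v : R -> R).

Let H_nneg X : 0 <= H X. Proof. by rewrite -H0. Qed.

Lemma Ep_ge0 n v B : (0 <= Ep H n v B)%E.
Proof. by rewrite /Ep; case: ifP => // _; exact: poweR_ge0. Qed.

Lemma EpE n v B : measurable B -> B `<=` D -> mu B != 0 -> aeb D (D2 v) ->
  Ep H n v B =
  (((fine (mu B))^-1 * \int[mu]_(x in B) (H (D2 v x) ^+ n)) `^ n%:R^-1)%:E.
Proof.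
move=> mB BD B0 bv; rewrite /Ep (negbTE B0).
rewrite (@I_EFin _ _ mB (fin_sub mD fD mB BD)) ?poweR_EFin//.
by apply: aebX; apply: (aeb_comp H_cont); exact: aeb_sub bv.
Qed.

Lemma EpX n v B : measurable B -> B `<=` D -> mu B != 0 -> aeb D (D2 v) ->
  (0 < n)%N ->
  (Ep H n v B ^+ n)%E =
  ((fine (mu B))^-1 * \int[mu]_(x in B) (H (D2 v x) ^+ n))%:E.
Proof.
move=> mB BD B0 bv n0; rewrite EpE// -EFin_expe; congr EFin.
rewrite -powR_mulrn ?powR_ge0// -powRrM mulVf ?pnatr_eq0 -?lt0n// powRr1//.
apply: mulr_ge0; first by rewrite invr_ge0; exact: fine_ge0.
by apply: Rintegral_ge0 => x _; exact: exprn_ge0.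
Qed.

Lemma Ep_ge n v B (s : R) : measurable B -> B `<=` D -> mu B != 0 -> aeb D (D2 v) ->
  (0 < n)%N -> 0 <= s ->
  s ^+ n * fine (mu B) <= \int[mu]_(x in B) (H (D2 v x) ^+ n) -> (s%:E <= Ep H n v B)%E.
Proof.
move=> mB BD B0 bv n0 s0 h; rewrite EpE// lee_fin.
have -> : s = (s ^+ n) `^ n%:R^-1.
  by rewrite -powR_mulrn// -powRrM mulfV ?powRr1// pnatr_eq0 -lt0n.
have fB0 : 0 < fine (mu B).
  by apply: fine_gt0; rewrite lt0e B0 measure_ge0 (fin_sub mD fD mB BD).
have h2 : s ^+ n <= (fine (mu B))^-1 * \int[mu]_(x in B) (H (D2 v x) ^+ n).
  by rewrite ler_pdivlMl// mulrC.
have s1 : 0 <= s ^+ n by exact: exprn_ge0.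
apply: ge0_ler_powR => //; rewrite nnegrE//; exact: le_trans h2.
Qed.

End mean_energy.

(** * Lower bound for the limiting energies *)

Section limit.
Variable R : realType.
Local Notation mu := (@lebesgue_measure R).
Variables (H : R -> R) (t m M p q xi C0 C3 : R).
Hypotheses (H_cont : continuous H) (H0 : H 0 = 0) (H_ge0 : forall X, H 0 <= H X)
  (H_slc : strictly_level_convex H) (C00 : 0 < C0) (C30 : 0 <= C3)
  (H_lin : forall X, `|X| <= (H X + C3) / C0) (hb : bang H t m M p q).
Variables (a b : R) (u : R -> R).
Local Notation O := (`]a, b[%classic : set R).
Hypotheses (ab : a < b) (Wu : W2 +oo%E O u) (hu : switches O u p q xi).

Let mO : measurable O. Proof. by []. Qed.
Let fO : (mu O < +oo)%E. Proof. exact: itv_fin. Qed.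
Let ba : 0 < b - a. Proof. by rewrite subr_gt0. Qed.
Let t0 : 0 <= t. Proof. by case: hb => -[]. Qed.
Let H_nneg X : 0 <= H X. Proof. by rewrite -H0. Qed.

(** The profile takes only the values [p] and [q], both of energy [t], so continuity of [H] at two
    points gives a [d] uniform in [x]. *)
Lemma energy_near_level s : s < t -> exists2 d : R, 0 < d &
  forall x y, H ((if x < xi then p else q) + y) < s -> d <= `|y|.
Proof.
move=> st; have [hp hq] := bang_constant_energy hb.
have key c : H c = t -> exists2 d : R, 0 < d & forall y, H (c + y) < s -> d <= `|y|.
  move=> hc; have : \forall z \near c, s < H z.
    have hcc : H z @[z --> c] --> H c by exact: H_cont.
    by apply: (cvgr_gt _ hcc); rewrite hc.
  move=> [d /= d0 hd]; exists d => // y hy; rewrite leNgt; apply/negP => yd.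
  have : s < H (c + y) by apply: hd => /=; rewrite opprD addNKr normrN.
  by rewrite ltNge ltW.
have [d1 d10 h1] := key _ hp; have [d2 d20 h2] := key _ hq.
exists (Num.min d1 d2); first by rewrite lt_min d10.
by move=> x y; case: ifP => _ h; rewrite ge_min ?(h1 _ h)// (h2 _ h) orbT.
Qed.

Variable u_ : nat -> R -> R.
Hypotheses (hW : forall n, (0 < n)%N -> W2oo0 O (u_ n \- u))
  (hI : forall n, (0 < n)%N ->
    \int[mu]_(x in O) (H (D2 (u_ n) x) ^+ n) <= (b - a) * (t ^+ n + 2 ^- (n ^ 2))).

(** Where [f n] is below [d] in absolute value the density is at least [s'], and by Chebyshev's
    inequality the rest has at most half the measure of [B]; so the mean of the n-th powers is at
    least [s' ^+ n / 2]. *)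
Lemma Ep_eventually_ge B s : measurable B -> B `<=` O -> mu B != 0 -> 0 < s -> s < t ->
  \forall n \near \oo, (s%:E <= Ep H n (u_ n) B)%E.
Proof.
move=> mB BO B0 s0 st.
(* The intermediate level absorbs the lost factor, since eventually [(s / s') ^+ n <= 1 / 2]. *)
pose s' := (s + t) / 2; have [ss' s't] : s < s' /\ s' < t by rewrite /s'; split; lra.
have s'0 : 0 < s' by exact: lt_trans ss'.
have [d d0 hd] := energy_near_level s't.
have fB := fin_sub mO fO mB BO.
have B1 : 0 < fine (mu B) by apply: fine_gt0; rewrite lt0e B0 measure_ge0 fB.
pose e := d * (fine (mu B) / 2); have e0 : 0 < e by rewrite mulr_gt0// divr_gt0.
have c2 : (s / s') ^+ n @[n --> \oo] --> (0 : R).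
  apply: cvg_expr; rewrite ger0_norm; last by apply: divr_ge0; exact: ltW.
  by rewrite ltr_pdivrMr// mul1r.
near=> n.
have [n0 hJ] : (0 < n)%N /\ \int[mu]_(x in O) (`|D2 (u_ n \- u) x| ^+ 1) <= e.
  by near: n; exact: (power_cvg H_cont H0 H_ge0 H_slc C00 C30 H_lin hb ab Wu hu hW hI 0).
have hs : (s / s') ^+ n <= 1 / 2 by near: n; apply: (cvgr_le _ c2); rewrite divr_gt0.
have [/W2ooP[_ _ _ bf _] _] := hW n0.
have Wn : W2 +oo%E O (u_ n) := W2oog_W2 Wu (hW n0).
have /W2ooP[_ _ _ bw _] := Wn.
apply: (Ep_ge H_cont mO fO mB BO B0 bw n0 (ltW s0)).
have ws := w_split Wu hu hW n0.
pose A := O `&` [set x | d <= `|D2 (u_ n \- u) x|].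
have baf := aeb_norm bf.
have mA : measurable A by exact: measurable_ge.
have bHn : aeb O (fun x => H (D2 (u_ n) x) ^+ n) by apply: aebX; exact: aeb_comp.
have hA : d * fine (mu A) <= e.
  have nn x : O x -> 0 <= `|D2 (u_ n \- u) x| by [].
  apply: (le_trans (I_chebyshev mO fO baf nn d0)).
  have <- : \int[mu]_(x in O) (`|D2 (u_ n \- u) x| ^+ 1) = \int[mu]_(x in O) `|D2 (u_ n \- u) x|.
    by apply: eq_Rintegral => x _; rewrite expr1.
  exact: hJ.
have hA2 : fine (mu A) <= fine (mu B) / 2 by rewrite -(ler_pM2l d0).
have bB : aeb B (fun x => H (D2 (u_ n) x) ^+ n) by exact: aeb_sub bHn.
have bA : aeb B (\1_A : R -> R) by exact: aeb_indic.
have b1 : aeb B (fun x => s' ^+ n * (1 - \1_A x)).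
  by apply: aebZ; apply: aebB => //; exact: aeb_cst.
apply: (@le_trans _ _ (\int[mu]_(x in B) (s' ^+ n * (1 - \1_A x)))); last first.
  apply: I_le => //; apply: ae_on_imp (ae_on_sub BO ws) => x Bx hx.
  rewrite indicE; case: (boolP (x \in A)) => [_|nA]; first by rewrite subrr mulr0 exprn_ge0.
  rewrite subr0 mulr1; apply: lerXn2r; rewrite ?nnegrE ?(ltW s'0)//.
  rewrite leNgt; apply/negP => h; rewrite hx in h.
  have dx := hd _ _ h.
  by move: nA; rewrite notin_setE; apply; split; [exact: BO|].
rewrite (I_Z mB fB)//; last by apply: aebB => //; exact: aeb_cst.
rewrite (I_B mB fB) //; last exact: aeb_cst.
rewrite (Rintegral_cst mu mB 1) mul1r.
have iA : \int[mu]_(x in B) (\1_A x : R) <= fine (mu A).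
  rewrite -(I_indic mO)//; last by move=> x [].
  by apply: I_subset => //; exact: aeb_indic.
have h3 : s ^+ n <= s' ^+ n * (1 / 2).
  by rewrite mulrC -ler_pdivrMr ?exprn_gt0// -expr_div_n.
apply: (@le_trans _ _ (s' ^+ n * (1 / 2) * fine (mu B))).
  by rewrite ler_pM2r.
rewrite -mulrA; apply: ler_wpM2l; first exact/exprn_ge0/ltW.
by move: iA hA2; lra.
Unshelve. all: by end_near. Qed.

Lemma Eoo_le_limn_einf B : measurable B -> B `<=` O ->
  (Eoo H u B <= limn_einf (fun j => Ep H j.+1 (u_ j.+1) B))%E.
Proof.
move=> mB BO.
have lim0 : (0 <= limn_einf (fun j => Ep H j.+1 (u_ j.+1) B))%E.
  by apply: limn_einf_ge; apply: nearW => j; exact: Ep_ge0.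
have [B0|B0] := eqVneq (mu B) 0.
  apply: le_trans lim0; apply/(Eoo_leP H0 H_ge0) => //.
  by exists B; split => // x /= h; apply: contrapT => nB; apply: h => /nB.
apply: (le_trans (Eoo_bang H0 H_ge0 hb (switches_sub BO hu))).
have [t00|tn0] := eqVneq t 0; first by rewrite t00.
have tp : 0 < t by rewrite lt_def tn0 t0.
apply/lee_addgt0Pr => e e0.
have [te|et] := leP t e.
  by rewrite (@le_trans _ _ (e%:E))// leeDr.
rewrite -leeBlDr// -EFinB; apply: limn_einf_ge.
have te0 : 0 < t - e by rewrite subr_gt0.
have tet : t - e < t by rewrite gtrBl.
have [N _ hN] := Ep_eventually_ge mB BO B0 te0 tet.
by exists N => // n /= Nn; apply: hN; exact: leqW.
Qed.

End limit.

(** * Existence and uniqueness of the L^p-limit function *)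

Section Lp_limits.
Variable R : realType.
Local Notation mu := (@lebesgue_measure R).
Variables (H : R -> R) (t m M p q xi C0 C3 : R).
Hypotheses (H_cont : continuous H) (H0 : H 0 = 0) (H_ge0 : forall X, H 0 <= H X)
  (H_slc : strictly_level_convex H) (C00 : 0 < C0) (C30 : 0 <= C3)
  (H_lin : forall X, `|X| <= (H X + C3) / C0) (hb : bang H t m M p q).
Variables (a b : R) (g u : R -> R).
Local Notation O := (`]a, b[%classic : set R).
Hypotheses (ab : a < b) (Wg : W2 +oo%E O g) (gu : W2oog a b g u)
  (hu : switches O u p q xi).

Let mO : measurable O. Proof. by []. Qed.
Let fO : (mu O < +oo)%E. Proof. exact: itv_fin. Qed.
Let ba : 0 < b - a. Proof. by rewrite subr_gt0. Qed.
Let t0 : 0 <= t. Proof. by case: hb => -[]. Qed.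
Let Wu : W2 +oo%E O u. Proof. exact: W2oog_W2 Wg gu. Qed.
Let muO : mu O != 0.
Proof.
apply/eqP => e; have := fine_itv (ltW ab); rewrite e /= => /eqP.
by rewrite eq_sym subr_eq0 gt_eqF.
Qed.

(** Testing the infimum with [u] bounds it by [t ^+ n], whence the last clause, the estimate that
    drives the convergence. The premise [0 < n] sits under the existential so that [choice] yields a
    sequence on all of [nat]. *)
Lemma near_minimiser_exists n : exists v, (0 < n)%N ->
  [/\ W2oog a b g v,
    (Ep H n v O ^+ n <= (2 ^- (n ^ 2))%:E +
      ereal_inf [set Ep H n w O ^+ n | w in W2oog a b g])%E &
    \int[mu]_(x in O) (H (D2 v x) ^+ n) <= (b - a) * (t ^+ n + 2 ^- (n ^ 2))].
Proof.
have [->|] := posnP n; first by exists u.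
move=> n0; set S := [set _ | _ in _].
have muOE : fine (mu O) = b - a by rewrite fine_itv// ltW.
have Su : (ereal_inf S <= (t ^+ n)%:E)%E.
  apply: ge_ereal_inf; exists (Ep H n u O ^+ n)%E; first by exists u.
  have /W2ooP[_ _ _ b2 _] := Wu.
  rewrite (EpX H_cont H0 H_ge0 mO fO)// lee_fin muOE ler_pdivrMl// mulrC.
  have bHn : aeb O (fun x => H (D2 u x) ^+ n) by apply: aebX; exact: aeb_comp.
  have -> : t ^+ n * (b - a) = \int[mu]_(x in O) t ^+ n.
    by rewrite (Rintegral_cst mu mO) muOE.
  apply: I_le => //; first exact: aeb_cst.
  have [h1 h2] := bang_constant_energy hb.
  by apply: ae_on_imp hu => x _ ->; case: ifP; rewrite ?h1 ?h2.
have S0 : (0 <= ereal_inf S)%E.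
  by apply: le_ereal_inf_tmp => _ [w _ <-]; apply: expe_ge0; exact: Ep_ge0.
have Sf : ereal_inf S \is a fin_num.
  by rewrite ge0_fin_numE//; apply: le_lt_trans Su _; exact: ltry.
have e0 : 0 < 2 ^- (n ^ 2) :> R by rewrite invr_gt0 exprn_gt0.
have [_ [v gv <-] /ltW hv] := lb_ereal_inf_adherent e0 Sf.
exists v => _; split; [exact: gv|by rewrite addeC|].
have Wv := W2oog_W2 Wg gv.
have /W2ooP[_ _ _ b2 _] := Wv.
have := le_trans hv (leeD2r _ Su).
rewrite (EpX H_cont H0 H_ge0 mO fO)// -EFinD lee_fin muOE.
by rewrite ler_pdivrMl.
Qed.

Lemma Lp_limit_switches : Lp_limit H a b g u.
Proof.
have [u_ hu_] := choice near_minimiser_exists.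
have hW n : (0 < n)%N -> W2oo0 O (u_ n \- u).
  by move=> /hu_[h _ _]; exact: (W2oog_sub ab h gu).
have hI n : (0 < n)%N ->
    \int[mu]_(x in O) (H (D2 (u_ n) x) ^+ n) <= (b - a) * (t ^+ n + 2 ^- (n ^ 2)).
  by move=> /hu_[].
split; first exact: gu.
  move=> psi gpsi; apply: (le_trans (Eoo_bang H0 H_ge0 hb hu)).
  have := bang_energy_ge H0 H_ge0 H_slc ab hb Wu hu (W2oog_sub ab gpsi gu).
  have -> : (u \+ (psi \- u))%R = psi by apply/funext => x /=; ring.
  exact.
(* The whole sequence converges, so the subsequence is just the shift that skips index 0. *)
exists u_, succn; split.
- by move=> n /hu_[].
- by split=> // i j; rewrite ltnS.
- by move=> n /hu_[].
- move=> s s1; apply: (W2_weak_cvgS ab Wu hW) => // k e e0.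
  exact: (power_cvg H_cont H0 H_ge0 H_slc C00 C30 H_lin hb ab Wu hu hW hI).
- move=> B mB BO.
  exact: (Eoo_le_limn_einf H_cont H0 H_ge0 H_slc C00 C30 H_lin hb ab Wu hu hW hI).
Qed.

(** The minimality clause bounds the energy of [v] by that of [u], which is at most [t]; strict
    minimality of [u] concludes. *)
Lemma Lp_limit_unique v : Lp_limit H a b g v -> eq_on O v u.
Proof.
move=> [gv hv _] x Ox; have W0 := W2oog_sub ab gv gu.
have E : (u \+ (v \- u))%R = v by apply/funext => y /=; ring.
have hE : (Eoo H (u \+ (v \- u))%R O <= t%:E)%E.
  by rewrite E; apply: (le_trans (hv _ gu)); exact: (Eoo_bang H0 H_ge0 hb hu).
have := bang_strict_minimiser H0 H_ge0 H_slc ab hb Wu hu W0 hE Ox.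
by move=> /eqP; rewrite subr_eq0 => /eqP.
Qed.

End Lp_limits.

(** * Diffuse third derivatives *)

Section nonmeasurable_integrands.
Local Open Scope ereal_scope.
Context d (T : measurableType d) (R : realType).
Variable m : {measure set T -> \bar R}.

(** The integral of a nonnegative function is a supremum over simple functions below it, hence
    monotone without measurability. The integrands to come contain suprema and inner integrals whose
    measurability is not established. *)
Lemma ge0_integral_mono (D : set T) (f g : T -> \bar R) :
  (forall x, D x -> 0 <= f x) -> (forall x, D x -> f x <= g x) ->
  \int[m]_(x in D) f x <= \int[m]_(x in D) g x.
Proof.
move=> f0 fg; have g0 x : D x -> 0 <= g x by move=> Dx; exact: le_trans (f0 _ Dx) (fg _ Dx).
rewrite !ge0_integralE//; apply: ereal_sup_le => _ [h /= hf <-].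
exists h => // x; apply: (le_trans (hf x)); rewrite !patchE.
by case: ifPn => // /set_mem; exact: fg.
Qed.

Lemma null_support_integral (N : set T) (f : T -> \bar R) :
  measurable N -> m N = 0 -> (forall x, ~ N x -> f x = 0) -> \int[m]_x f x = 0.
Proof.
move=> mN N0 fN.
have key (g : T -> \bar R) : (forall x, 0 <= g x) -> (forall x, ~ N x -> g x = 0) ->
    \int[m]_x g x = 0.
  move=> g0 gN; apply/eqP; rewrite eq_le integral_ge0// andbT.
  apply: (@le_trans _ _ (\int[m]_(x in N) +oo)).
    rewrite [leRHS]integral_mkcond; apply: ge0_integral_mono => // x _.
    rewrite patchE; case: ifPn => [_|nN]; first exact: leey.
    by rewrite gN//; move: nN; rewrite notin_setE.
  by rewrite null_set_integral//; exact: measurable_cst.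
rewrite integralE !key ?subee//.
- by move=> x /fN fx; rewrite funenegE fx oppe0 maxxx.
- by move=> x /fN fx; rewrite funeposE fx maxxx.
Qed.

End nonmeasurable_integrands.

(** * A test function that detects mass away from 0 *)

Section test_functions.
Variable R : realType.
Local Notation Rbar := (one_point_compactification R).

(** Continuous on the compactification and zero exactly at [Some 0], so its integral detects any
    other mass, including mass at infinity. *)
Definition zeta (X : Rbar) : R := if X is Some Y then Num.min (Y ^+ 2) 1 else 1.

Lemma zeta_ge0 X : 0 <= zeta X.
Proof. by case: X => [Y|] //=; rewrite le_min sqr_ge0 ler01. Qed.

Lemma zeta_le1 X : zeta X <= 1.
Proof. by case: X => [Y|] //=; rewrite ge_min lexx orbT. Qed.

Lemma zeta_gt0 X : X <> Some 0 -> 0 < zeta X.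
Proof.
case: X => [Y|] //= Y0; rewrite lt_min ltr01 andbT exprn_even_gt0//=.
by apply/eqP => e; apply: Y0; rewrite e.
Qed.

Lemma continuous_sqr_min1 : continuous (fun Y : R => Num.min (Y ^+ 2) 1).
Proof.
move=> Y; apply: (@continuous_min _ _ (fun Z : R => Z ^+ 2) (fun=> 1)).
  exact: exprn_continuous.
exact: cvg_cst.
Qed.

Lemma continuous_zeta : continuous zeta.
Proof.
case=> [x|] A.
  exact: (@continuous_sqr_min1 x).
(* [zeta] is constant outside the compact set [[-1, 1]], hence near infinity. *)
move=> /nbhs_singleton A1; exists `[-1, 1]%classic.
  by split; [exact: segment_compact|exact: interval_closed].
move=> X [[Y /= Y1 <-] /=|->//].
suff -> : Num.min (Y ^+ 2) 1 = 1 :> R by [].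
apply/min_idPr; rewrite leNgt; apply/negP => h; apply: Y1.
by rewrite /= in_itv /= -ler_norml -(expr_le1 (ltn0Sn 1))// real_normK ?num_real// ltW.
Qed.

Lemma open_zeta_gt (e : R) : open [set X : Rbar | e < zeta X].
Proof.
have -> : [set X : Rbar | e < zeta X] = zeta @^-1` `]e, +oo[%classic.
  by apply/seteqP; split => X /=; rewrite in_itv /= andbT.
by apply: open_comp; [move=> X _; exact: continuous_zeta|exact: interval_open].
Qed.

Lemma measurable_zeta_gt (e : R) : measurable ([set X | e < zeta X] : set (borel_Rbar R)).
Proof. by apply: sub_sigma_algebra; exact: open_zeta_gt. Qed.

Lemma dirac_zeta_gt0 :
  (\d_(Some (0 : R) : borel_Rbar R) : probability (borel_Rbar R) R) [set X | 0 < zeta X] = 0%E.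
Proof.
have z0 : ([set X | 0 < zeta X] : set Rbar) (Some 0) = False.
  by apply/propext; split => //=; rewrite expr0n /= min_l// ltxx.
by rewrite /= /dirac indicE memNset// z0.
Qed.

End test_functions.

Section diffuse_derivatives.
Variable R : realType.
Local Notation mu := (@lebesgue_measure R).
Variables (a b p q xi : R) (u : R -> R).
Local Notation O := (`]a, b[%classic : set R).
Hypotheses (axb : a < xi < b)
  (hu : forall x, O x -> x != xi -> D2 u x = if x < xi then p else q).

Let mO : measurable O. Proof. by []. Qed.
Let fO : (mu O < +oo)%E. Proof. exact: itv_fin. Qed.

(* Difference quotients of step at most [e] see only one phase from here. *)
Definition away (e : R) : set R := `]a + e, xi - e[%classic `|` `]xi + e, b - e[%classic.

Lemma measurable_away e : measurable (away e).
Proof. exact: measurableU. Qed.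

Lemma away_exists x : O x -> x != xi -> \forall k \near \oo, away (k.+1%:R^-1) x.
Proof.
rewrite /= in_itv /= => /andP[ax xb] xn.
have : x < xi \/ xi < x by apply/orP; rewrite -neq_lt.
have key (e : R) : 0 < e -> \forall k \near \oo, k.+1%:R^-1 < e.
  by move=> e0; have := near_infty_natSinv_lt (PosNum e0).
case=> [xxi|xix].
  near=> k; left; rewrite /= in_itv /=.
  have k1 : k.+1%:R^-1 < x - a by near: k; apply: key; rewrite subr_gt0.
  have k2 : k.+1%:R^-1 < xi - x by near: k; apply: key; rewrite subr_gt0.
  move: (k.+1%:R^-1) k1 k2 => e k1 k2.
  by apply/andP; split; lra.
near=> k; right; rewrite /= in_itv /=.
have k1 : k.+1%:R^-1 < x - xi by near: k; apply: key; rewrite subr_gt0.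
have k2 : k.+1%:R^-1 < b - x by near: k; apply: key; rewrite subr_gt0.
move: (k.+1%:R^-1) k1 k2 => e k1 k2.
by apply/andP; split; lra.
Unshelve. all: by end_near. Qed.

Lemma diff_quotient_away e h x : 0 < e -> `|h| < e -> away e x ->
  diff_quotient h (patch (fun=> 0) O (D2 u)) x = 0.
Proof.
have [axi xib] := andP axb.
have hl y : a < y -> y < xi -> patch (fun=> 0) O (D2 u) y = p.
  move=> ay yx; have Oy : O y by rewrite /= in_itv /= ay (lt_trans yx xib).
  by rewrite patchE mem_set// hu ?yx// lt_eqF.
have hr y : xi < y -> y < b -> patch (fun=> 0) O (D2 u) y = q.
  move=> yx yb; have Oy : O y by rewrite /= in_itv /= yb (lt_trans axi yx).
  by rewrite patchE mem_set// hu ?gt_eqF// ltNge (ltW yx).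
move=> e0; rewrite ltr_norml => /andP[h1 h2].
rewrite /diff_quotient => -[|]; rewrite /= in_itv /= => /andP[x1 x2].
  rewrite !hl ?subrr ?mulr0//; lra.
rewrite !hr ?subrr ?mulr0//; lra.
Qed.

Variable nu : R -> probability (borel_Rbar R) R.
Hypothesis hnu : diffuse_D3 a b u nu.

(** Cutting [zeta] off to [away e] gives a test function annihilated by the Dirac masses of all
    difference quotients of step below [e]; weak convergence passes this to [nu]. *)
Definition away_test (e x : R) (X : one_point_compactification R) : R := \1_(away e) x * zeta X.

Lemma L1_away_test e : 0 < e -> L1_C_Rbar O (away_test e).
Proof.
move=> e0; have mA := measurable_away e.
split.
- move=> x _ X.
  apply: (@cvg_comp _ _ _ (@zeta R) ( *%R (\1_(away e) x))); first exact: continuous_zeta.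
  exact: mulrl_continuous.
- move=> X; apply: measurable_funM; last exact: measurable_cst.
  exact: (aeb_indic O mA).1.
- apply: (@le_lt_trans _ _ (\int[mu]_(x in O) (\1_(away e) x)%:E)%E); last first.
    by rewrite integral_indic//; apply: le_lt_trans fO; apply: le_measure; rewrite ?inE//; exact: measurableI.
  apply: ge0_integral_mono => x _.
    apply: (@le_trans _ _ (`|away_test e x None|%:E)); first by rewrite lee_fin.
    by apply: ereal_sup_ubound; exists None.
  apply: ge_ereal_sup => _ [X _ <-]; rewrite lee_fin ger0_norm.
    by rewrite ler_piMr ?zeta_le1// indicE.
  by rewrite mulr_ge0 ?zeta_ge0// indicE.
Qed.

Lemma diffuse_away_integral e : 0 < e ->
  (\int[mu]_(x in O) \int[nu x]_X (away_test e x X)%:E = 0)%E.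
Proof.
move=> e0; have [_ [h [h0 hc hY]]] := hnu.
apply/esym; apply: (cvg_unique _ _ (hY _ (L1_away_test e0))) => //.
apply: cvg_near_cst.
have hlt : \forall m \near \oo, `|h m| < e by
  move/cvgrPdist_lt: hc => /(_ _ e0); apply: filterS => m; rewrite sub0r normrN.
near=> m; have hm : `|h m| < e by near: m.
apply: integral0_eq => x Ox.
have [Ax|nA] := pselect (away e x); last first.
  apply: integral0_eq => X _.
  by rewrite /away_test indicE memNset// mul0r.
apply: (null_support_integral (measurable_zeta_gt 0)).
- by rewrite (diff_quotient_away e0 hm Ax); exact: dirac_zeta_gt0.
- move=> X /negP; rewrite -leNgt => X0; rewrite /away_test.
  by have -> : zeta X = 0; [apply/eqP; rewrite eq_le X0 zeta_ge0|rewrite mulr0].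
Unshelve. all: by end_near. Qed.

(** Chebyshev's inequality: on [away e] the inner integral is at least [e * nu x U]. This minorant
    is measurable by the definition of a Young measure, so its zero integral forces it to vanish
    a.e. *)
Lemma diffuse_away e : 0 < e ->
  ae_on O (fun x => away e x -> nu x [set X | e < zeta X] = 0%E).
Proof.
move=> e0; have [mY _] := hnu; have mA := measurable_away e.
set U := [set X | e < zeta X].
have mU : measurable (U : set (borel_Rbar R)) by exact: measurable_zeta_gt.
pose f x := ((e * \1_(away e) x)%:E * nu x U)%E.
have f0 x : (0 <= f x)%E.
  apply: mule_ge0; last exact: measure_ge0.
  by rewrite lee_fin; apply: mulr_ge0; [exact: ltW|rewrite indicE].
have mf : measurable_fun O f.
  apply: emeasurable_funM; last by apply: mY; exact: open_zeta_gt.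
  apply/measurable_EFinP; apply: measurable_funM; first exact: measurable_cst.
  exact: (aeb_indic O mA).1.
have fle x : (f x <= \int[nu x]_X (away_test e x X)%:E)%E.
  have [Ax|nA] := pselect (away e x); last first.
    rewrite /f indicE memNset// mulr0 mul0e; apply: integral_ge0 => X _.
    by rewrite lee_fin mulr_ge0 ?zeta_ge0// indicE.
  rewrite /f indicE mem_set// mulr1 -integral_cst// [leLHS]integral_mkcond.
  apply: ge0_integral_mono => X _; rewrite patchE; case: ifPn => //= XU.
  - by rewrite lee_fin ltW.
  - by rewrite /away_test indicE mem_set// mul1r lee_fin ltW//; move/set_mem: XU.
  - by rewrite /away_test lee_fin mulr_ge0 ?zeta_ge0// indicE.
have If : (\int[mu]_(x in O) f x = 0)%E.
  apply/eqP; rewrite eq_le integral_ge0 ?andbT; last by move=> x _; exact: f0.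
  by rewrite -(diffuse_away_integral e0); apply: ge0_integral_mono.
have : (\int[mu]_(x in O) `|f x| = 0)%E.
  by rewrite -If; apply: eq_integral => x _; rewrite gee0_abs.
move/(ae_eq_integral_abs mu mO mf).
apply: ae_on_imp => x _ [] /eqP; rewrite /f mule_eq0 => h Ax.
by move: h; rewrite indicE mem_set// mulr1 eqe gt_eqF//= => /eqP.
Qed.

(** Countably many radii [1 / (k + 1)] suffice: the regions [away] exhaust the interval without
    [xi], and the sets where [zeta] exceeds the radius exhaust the complement of [Some 0]. The union
    starts at an index [N] from which on [x] belongs to every region. *)
Lemma diffuse_zero : ae_on O (fun x => nu x [set X | 0 < zeta X] = 0%E).
Proof.
have h1 : {ae mu, forall x, forall k, O x -> away k.+1%:R^-1 x ->
    nu x [set X | k.+1%:R^-1 < zeta X] = 0%E}.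
  by apply/ae_foralln => k; apply: diffuse_away; rewrite invr_gt0.
have h2 : ae_on O (fun x => forall k, away k.+1%:R^-1 x ->
    nu x [set X | k.+1%:R^-1 < zeta X] = 0%E).
  by apply: (@filterS _ _ (ae_filter_ringOfSetsType mu)) h1 => x h Ox k; exact: h.
apply: ae_on_imp2 h2 (ae_on_neq O xi) => x Ox h xn.
have [N _ hN] := away_exists Ox xn.
have sub : ([set X | 0 < zeta X] : set (borel_Rbar R)) `<=`
    \bigcup_k [set X | (N + k).+1%:R^-1 < zeta X].
  move=> X /= X0; have [N' _ hN'] := near_infty_natSinv_lt (PosNum X0).
  by exists N' => //=; apply: hN' => /=; exact: leq_addl.
apply: (measure_negligible (measurable_zeta_gt 0)); apply: (negligibleS sub).
apply: negligible_bigcup => k.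
exists [set X : borel_Rbar R | (N + k).+1%:R^-1 < zeta X]; split => //.
  exact: measurable_zeta_gt.
by apply: h; apply: hN => /=; exact: leq_addr.
Qed.

End diffuse_derivatives.

(** * Absolute minimisers as D-solutions; conclusion *)

Section D_solutions.
Variable R : realType.
Local Notation mu := (@lebesgue_measure R).

(** Almost every [nu x] is concentrated at [Some 0], where the factor [Y ^+ 2] vanishes. *)
Lemma D_solution_switches (H u : R -> R) (a b p q xi : R) : a < xi < b ->
  W2 +oo%E `]a, b[ u ->
  (forall x, `]a, b[%classic x -> x != xi -> D2 u x = if x < xi then p else q) ->
  D_solution H a b u.
Proof.
move=> axb Wu hu; have oO : open (`]a, b[%classic : set R) by exact: interval_open.
split.
  have [hC /Lebesgue_oo_aeb h0 /Lebesgue_oo_aeb h1 /Lebesgue_oo_aeb h2 hw] := Wu.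
  by split; [exact: hC|exact: aeb_locally_integrable oO (itv_fin a b) h0|
    exact: aeb_locally_integrable oO (itv_fin a b) h1|
    exact: aeb_locally_integrable oO (itv_fin a b) h2|exact: hw].
move=> nu hnu Phi _ _.
apply: (@filterS _ _ (ae_filter_ringOfSetsType mu)) (diffuse_zero axb hu hnu) => x hx axbx.
have Ox : `]a, b[%classic x by rewrite /= in_itv.
apply: (null_support_integral (measurable_zeta_gt 0) (hx Ox)).
move=> X nX; have -> : X = Some 0 by apply: contrapT => /(@zeta_gt0 R).
by rewrite expr0n mulr0.
Qed.

End D_solutions.

Section main_steps.
Variable R : realType.
Variables (H : R -> R) (Tm Tp : R -> R) (C0 C3 a b : R).
Hypotheses (H_cont : continuous H) (H0 : H 0 = 0) (H_ge0 : forall X, H 0 <= H X)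
  (H_slc : strictly_level_convex H) (C00 : 0 < C0) (C30 : 0 <= C3)
  (H_lin : forall X, `|X| <= (H X + C3) / C0)
  (H_levels : forall t, 0 < t ->
     Tm t < 0 < Tp t /\ [set X | H X = t] = [set Tm t; Tp t])
  (ab : a < b).
Implicit Types (u g : R -> R).

Lemma AM2_has_structure g u : W2 +oo%E `]a, b[ g -> W2oog a b g u -> AM2 H a b u ->
  AM2_structure H a b g u.
Proof.
move=> Wg gu hu.
have [t [m [M [p [q [xi [A [A' [hb axb E]]]]]]]]] := AM2_is_quad H0 H_ge0 H_slc H_levels ab hu.
have su := switches_on_quad E.
have Ecal := calE_on_quad_eq0 ab axb E.
(* [calE] depends on the boundary values only, so it is the same for [u] and [g]. *)
rewrite (W2oog_calE ab Wg gu) in Ecal.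
split.
- by move=> /Ecal pq; exact: quadratic_on_quad E pq.
- move=> c0; have pq : p != q by apply: contra_neq c0 => /Ecal.
  exact: one_switch_on_quad hb axb E pq.
- exact: constant_energy_density_on_quad hb E.
- exact: (Lp_limit_switches H_cont H0 H_ge0 H_slc C00 C30 H_lin hb ab Wg gu su).
- move=> v hv x Ox.
  exact: (Lp_limit_unique H0 H_ge0 H_slc hb ab Wg gu su hv).
Qed.

Lemma AM2_D_solution u : AM2 H a b u -> D_solution H a b u.
Proof.
move=> hu; have [Wu _] := hu.
have [t [m [M [p [q [xi [A [A' [hb axb E]]]]]]]]] := AM2_is_quad H0 H_ge0 H_slc H_levels ab hu.
apply: (D_solution_switches H axb Wu) => x Ox xn.
by apply: (D2_on_quad _ Ox E xn); exact: interval_open.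
Qed.

Lemma AM2_at_most_one_singularity u : AM2 H a b u -> at_most_one_singularity a b u.
Proof.
move=> hu.
have [t [m [M [p [q [xi [A [A' [hb axb E]]]]]]]]] := AM2_is_quad H0 H_ge0 H_slc H_levels ab hu.
exact: at_most_one_singularity_on_quad E.
Qed.

End main_steps.

Theorem theorem7 (R : realType) (H : R -> R)
  (H_cont : continuous H) (H0 : H 0 = 0) (H_ge0 : forall X, H 0 <= H X)
  (H_slc : strictly_level_convex H)
  (C1 C2 r : R) (C1_gt0 : 0 < C1) (C2_gt0 : 0 < C2) (r_gt1 : 1 < r)
  (H_coercive : forall X, C1 * `|X| `^ r - C2 <= H X)
  (Tm Tp : R -> R)
  (H_levels : forall t, 0 < t ->
     Tm t < 0 < Tp t /\ [set X | H X = t] = [set Tm t; Tp t])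
  (H_ratio :
     let ratio := fun t : R => `|Tm t / Tp t|%:E in
     [/\ (0 < limf_einf ratio (pinfty_nbhs R))%E,
         (limf_einf ratio (pinfty_nbhs R)
            <= limf_esup ratio (pinfty_nbhs R))%E &
         (limf_esup ratio (pinfty_nbhs R) < +oo)%E])
  (a b : R) (ab : a < b) (g : R -> R) (Wg : W2 +oo%E `]a, b[ g) :
  [/\ exists u : R -> R,
        [/\ AM2 H a b u, W2oog a b g u,
            forall v, AM2 H a b v -> W2oog a b g v -> eq_on `]a, b[ v u &
            AM2_structure H a b g u],
      forall u, AM2 H a b u -> AM2_structure H a b u u,
      C1_on setT H ->
        (exists u : R -> R,
          [/\ AM2 H a b u, D_solution H a b u, W2oog a b g u,
              at_most_one_singularity a b u &
              forall v, AM2 H a b v -> D_solution H a b v ->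
                W2oog a b g v -> eq_on `]a, b[ v u]) /\
        (forall v, AM2 H a b v -> D_solution H a b v -> W2oog a b g v ->
          at_most_one_singularity a b v) &
      C1_on setT H -> forall u, AM2 H a b u -> D_solution H a b u].
Proof.
have C00 := C1_gt0.
have C30 : 0 <= C1 + C2 by rewrite addr_ge0// ltW.
have H_lin := linear_coercivity C1_gt0 C2_gt0 r_gt1 H_coercive.
have [u [hu gu]] := AM2_exists H0 H_ge0 H_slc H_levels ab Wg.
have unique v : AM2 H a b v -> W2oog a b g v -> eq_on `]a, b[ v u.
  by move=> hv gv; exact: (AM2_unique H0 H_ge0 H_slc H_levels ab hv hu gv gu).
have structure g' v := @AM2_has_structure R H Tm Tp _ _ a b
  H_cont H0 H_ge0 H_slc C00 C30 H_lin H_levels ab g' v.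
have D_sol v := @AM2_D_solution R H Tm Tp a b H0 H_ge0 H_slc H_levels ab v.
have one_sing v := @AM2_at_most_one_singularity R H Tm Tp a b H0 H_ge0 H_slc H_levels ab v.
split.
- exists u; split; [exact: hu|exact: gu|exact: unique|exact: structure].
- move=> v hv; have [Wv _] := hv.
  by apply: (structure _ _ Wv _ hv); exact: W2oog_refl.
- move=> _; split; last by move=> v hv _ _; exact: one_sing.
  exists u; split; [exact: hu|exact: D_sol|exact: gu|exact: one_sing|].
  by move=> v hv _ gv; exact: unique.
- by move=> _ v hv; exact: D_sol.
Qed.
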